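(* Fix a monomial order on $\mathbb{N}^n$. There is an algorithm that, given a finite group $G$ and a finite set of generators of a shift-stable subgroup $I \leq G^{(\mathbb{N}^n)}$, computes a standard basis of $I$. Furthermore, given the generators of $I$, there are algorithms for the following problems: (i) (Membership problem) given $f \in G^{(\mathbb{N}^n)}$, decide whether $f \in I$. (ii) (Subgroup saturation) for $\varepsilon_n = (0, 0, \ldots, 1) \in \mathbb{N}^n$, compute a finite set of generators for the shift-stable subgroup $$I \colon \varepsilon_n^{\infty} := \{f \in G^{(\mathbb{N}^n)} \mid \exists t \in \mathbb{N} \text{ such that } {}^{t\varepsilon_n}f \in I\}.$$ (iii) (Variable elimination) given $d \geq 1$, compute a finite set of generators for the ($\mathbb{N}^{n-1}$-)shift-stable subgroup $$I_{[0, d-1] \times \mathbb{N}^{n-1}} := \{f \in I \mid \operatorname{supp}(f) \subseteq [0, d-1] \times \mathbb{N}^{n-1}\} \leq (G^d)^{(\mathbb{N}^{n-1})}.$$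
   Context: $\mathbb{N}$ contains $0$. For a group $G$ with neutral element $e$ and a map $f\colon \mathbb{N}^n \to G$, $\operatorname{supp}(f) = \{\alpha\in\mathbb{N}^n \mid f(\alpha)\neq e\}$. $G^{(\mathbb{N}^n)}$ is the group of finitely supported maps $f\colon\mathbb{N}^n\to G$ (''tiles'') under pointwise multiplication. For $\beta\in\mathbb{N}^n$ the shift ${}^{\beta}f$ is defined by ${}^{\beta}f(\alpha)=f(\alpha-\beta)$ if $\alpha-\beta\in\mathbb{N}^n$ and $e$ otherwise. A subgroup $I\leq G^{(\mathbb{N}^n)}$ is shift-stable if ${}^{\beta}f\in I$ for all $f\in I$, $\beta\in\mathbb{N}^n$. For $S\subseteq G^{(\mathbb{N}^n)}$, $\langle S\rangle$ denotes the smallest shift-stable subgroup containing $S$, i.e. the subgroup generated by all ${}^{\beta}s$ with $\beta\in\mathbb{N}^n$, $s\in S$; generators of a shift-stable subgroup $I$ are the elements of a set $S$ with $\langle S\rangle=I$. A monomial order on $\mathbb{N}^n$ is a total order $<$ that is a well-order and satisfies $\alpha<\beta\Rightarrow\alpha+\gamma<\beta+\gamma$ for all $\gamma\in\mathbb{N}^n$. With respect to $<$, for a tile $f$, $\operatorname{multideg}(f)$ is the $<$-maximal element of $\operatorname{supp}(f)$, and the leading term $\operatorname{LT}(f)$ is the tile taking the value $f(\operatorname{multideg}(f))$ at $\operatorname{multideg}(f)$ and $e$ elsewhere. Let $\operatorname{LT}(I)=\{\operatorname{LT}(f)\mid f\in I\}$. A finite subset $B=\{b_1,\ldots,b_k\}$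 of a shift-stable subgroup $I$ is a standard basis of $I$ if $\langle \operatorname{LT}(I)\rangle=\langle \operatorname{LT}(b_1),\ldots,\operatorname{LT}(b_k)\rangle$. For integers $x\le y$, $[x,y]=\{x,x+1,\dots,y\}$. Tiles supported in $[0,d-1]\times\mathbb{N}^{n-1}$ are identified with elements of $(G^d)^{(\mathbb{N}^{n-1})}$ via $f\mapsto\hat f$, $\hat f(\alpha)=(f(0,\alpha),\dots,f(d-1,\alpha))$; under this identification $I_{[0,d-1]\times\mathbb{N}^{n-1}}$ is stable under shifts by $\mathbb{N}^{n-1}$. The finite group $G$ may be given by any effective representation, for example its multiplication table. *)

(* Defs.v *)
From HB Require Import structures.
From mathcomp Require Import all_boot all_order all_fingroup all_algebra.
From mathcomp Require Import finmap mpoly.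

Set Implicit Arguments.
Unset Strict Implicit.
Unset Printing Implicit Defensive.

Local Open Scope fset_scope.
Local Open Scope group_scope.
Local Open Scope nat_scope.

(* The group of finitely supported maps N^n -> G. *)
Definition tile (n : nat) (G : groupType) : Type :=
  {fsfun 'X_{1..n} -> G for fun=> 1%g}.

HB.instance Definition _ n (G : groupType) := Choice.on (tile n G).

Section TileGroup.
Variables (n : nat) (G : groupType).
Implicit Types f g h : tile n G.

Definition tile_one : tile n G := [fsfun for fun=> 1%g].
Definition tile_mul f g : tile n G :=
  [fsfun a in finsupp f `|` finsupp g => (f a * g a)%g].
Definition tile_inv f : tile n G := [fsfun a in finsupp f => (f a)^-1%g].

Lemma tile_oneE a : tile_one a = 1%g.
Proof. by rewrite /tile_one fsfunE. Qed.

Lemma tile_mulE f g a : tile_mul f g a = (f a * g a)%g.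
Proof.
rewrite fsfunE in_fsetU; case: finsuppP => [_|//]; case: finsuppP => //= _.
by rewrite mulg1.
Qed.

Lemma tile_invE f a : tile_inv f a = (f a)^-1%g.
Proof. by rewrite fsfunE; case: finsuppP => //= _; rewrite invg1. Qed.

Fact tile_mulA : associative tile_mul.
Proof. by move=> f g h; apply/fsfunP => a; rewrite !tile_mulE mulgA. Qed.
Fact tile_mul1 : left_id tile_one tile_mul.
Proof. by move=> f; apply/fsfunP => a; rewrite tile_mulE tile_oneE mul1g. Qed.
Fact tile_mulr1 : right_id tile_one tile_mul.
Proof. by move=> f; apply/fsfunP => a; rewrite tile_mulE tile_oneE mulg1. Qed.
Fact tile_mulV : left_inverse tile_one tile_inv tile_mul.
Proof.
by move=> f; apply/fsfunP => a; rewrite tile_mulE tile_invE tile_oneE mulVg.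
Qed.
Fact tile_mulrV : right_inverse tile_one tile_inv tile_mul.
Proof.
by move=> f; apply/fsfunP => a; rewrite tile_mulE tile_invE tile_oneE mulgV.
Qed.

HB.instance Definition _ := isGroup.Build (tile n G)
  tile_mulA tile_mul1 tile_mulr1 tile_mulV tile_mulrV.

Definition shift (b : 'X_{1..n}) f : tile n G :=
  [fsfun a in [fset (c + b)%MM | c in finsupp f] => f (a - b)%MM].

Lemma shiftE b f a : shift b f a = if (b <= a)%MM then f (a - b)%MM else 1%g.
Proof.
rewrite fsfunE; case: ifP => [/imfsetP[c /= _ ->]|]; first by rewrite lem_addl.
case: ifP => // leba; case: (finsuppP f (a - b)%MM) => // fab.
by case/imfsetP; exists (a - b)%MM => //; rewrite submK.
Qed.

(* Arbitrary (possibly infinite, undecidable) sets of tiles are [Prop]-valued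
   predicates; finite sets of tiles are lists. *)

Definition shift_subgroup (I : tile n G -> Prop) : Prop :=
  [/\ I 1%g,
      forall f g, I f -> I g -> I (f * g)%g,
      forall f, I f -> I f^-1%g
    & forall b f, I f -> I (shift b f)].

Definition span (S : tile n G -> Prop) : tile n G -> Prop :=
  fun f => forall J, shift_subgroup J -> (forall s, S s -> J s) -> J f.

Definition generates (S : seq (tile n G)) (I : tile n G -> Prop) : Prop :=
  forall f, span (fun s => s \in S) f <-> I f.

End TileGroup.

Definition monomial_order n (lt : rel 'X_{1..n}) : Prop :=
  [/\ irreflexive lt,
      transitive lt,
      forall a b, [|| lt a b, a == b | lt b a],
      well_founded (fun a b => lt a b)
    & forall a b c, lt a b -> lt (a + c)%MM (b + c)%MM].

Section LeadingTerms.
Variables (n : nat) (G : groupType) (lt : rel 'X_{1..n}).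
Implicit Types (f : tile n G) (I : tile n G -> Prop).

(* [multideg 1] is a dummy value; it is only used in [LT 1], which is [1]. *)
Definition multideg f : 'X_{1..n} :=
  head 0%MM [seq a <- finsupp f |
               all (fun b => (b == a) || lt b a) (finsupp f)].

Definition LT f : tile n G :=
  [fsfun a in [fset multideg f] => f a].

Definition standard_basis I (B : seq (tile n G)) : Prop :=
  (forall b, b \in B -> I b) /\
  (forall f, span (fun g => exists2 h, I h & g = LT h) f
         <-> span (fun g => g \in map LT B) f).

End LeadingTerms.

(* [U_(ord_max)] is (0, .., 0, 1). *)
Definition saturation n (G : groupType) (I : tile n.+1 G -> Prop) :
    tile n.+1 G -> Prop :=
  fun f => exists t : nat, I (shift (U_(ord_max) *+ t)%MM f).

Definition mcons n (i : nat) (a : 'X_{1..n}) : 'X_{1..n.+1} :=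
  [multinom of i :: a].

Definition mbehead n (a : 'X_{1..n.+1}) : 'X_{1..n} :=
  [multinom of behead a].

(* [hat d f] is a |-> (f (0, a), .., f (d - 1, a)). *)
Definition hat n (G : groupType) (d : nat) (f : tile n.+1 G) :
    tile n {ffun 'I_d -> G} :=
  [fsfun a in [fset mbehead b | b in finsupp f] =>
    [ffun i : 'I_d => f (mcons i a)]].

Lemma hatE n (G : groupType) d (f : tile n.+1 G) a (i : 'I_d) :
  hat d f a i = f (mcons i a).
Proof.
rewrite fsfunE; case: ifP => [_|]; rewrite ffunE //.
case: (finsuppP f (mcons i a)) => // fia /imfsetP[]; exists (mcons i a) => //.
by apply/val_inj/val_inj.
Qed.

Definition elimination n (G : groupType) (d : nat) (I : tile n.+1 G -> Prop) :
    tile n {ffun 'I_d -> G} -> Prop :=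
  fun h => exists f, [/\ I f,
    forall a, a \in finsupp f -> a ord0 < d & h = hat d f].

Arguments elimination {n G} d I _.

(* Programs for Kleene's partial recursive functions. Arities are not recorded;
   [RNil] and [RCons] build the tuple of inner functions of a composition. *)
Inductive recfun : Type :=
  | RZero
  | RSucc
  | RProj of nat
  | RComp of recfun & recfuns
  | RPrec of recfun & recfun
  | RMu of recfun
with recfuns : Type :=
  | RNil
  | RCons of recfun & recfuns.

(* [eval p v y]: the program [p] halts on the arguments [v] with result [y]. *)
Inductive eval : recfun -> seq nat -> nat -> Prop :=
  | EZero v : eval RZero v 0
  | ESucc x v : eval RSucc (x :: v) x.+1
  | EProj i v : i < size v -> eval (RProj i) v (nth 0 v i)
  | EComp p qs v w y : evals qs v w -> eval p w y -> eval (RComp p qs) v y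
  | EPrec0 p q v y : eval p v y -> eval (RPrec p q) (0 :: v) y
  | EPrecS p q k v u y :
      eval (RPrec p q) (k :: v) u -> eval q [:: k, u & v] y ->
      eval (RPrec p q) (k.+1 :: v) y
  | EMu p v y :
      eval p (y :: v) 0 ->
      (forall z, z < y -> exists u, eval p (z :: v) u.+1) ->
      eval (RMu p) v y
with evals : recfuns -> seq nat -> seq nat -> Prop :=
  | ENil v : evals RNil v [::]
  | ECons q qs v z w : eval q v z -> evals qs v w -> evals (RCons q qs) v (z :: w).

Scheme recfun_mut := Induction for recfun Sort Prop
  with recfuns_mut := Induction for recfuns Sort Prop.

Lemma eval_det p v y y' : eval p v y -> eval p v y' -> y = y'.
Proof.
move: p v y y'; apply: (recfun_mut
  (P0 := fun qs => forall v w w', evals qs v w -> evals qs v w' -> w = w')).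
- by move=> v y y' h h'; inversion h; inversion h'.
- by move=> v y y' h h'; inversion h; inversion h'; subst; congruence.
- by move=> i v y y' h h'; inversion h; inversion h'; subst.
- move=> p IHp qs IHqs v y y' h h'; inversion h; inversion h'; subst.
  match goal with h1 : evals _ _ ?w, h2 : evals _ _ ?w' |- _ =>
    have ww' := IHqs _ _ _ h1 h2 end.
  by subst; eauto.
- move=> p IHp q IHq [|k v] y y' h h'; first by inversion h.
  elim: k y y' h h' => [|k IHk] y y' h h'; inversion h; inversion h'; subst.
    by eauto.
  match goal with h1 : eval (RPrec _ _) (k :: _) ?u,
                  h2 : eval (RPrec _ _) (k :: _) ?u' |- _ =>
    have uu' := IHk _ _ h1 h2 end.
  by subst; eauto.
- move=> p IHp v y y' h h'.
  have mu z : eval (RMu p) v z -> eval p (z :: v) 0 /\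
      forall t, t < z -> exists u, eval p (t :: v) u.+1.
    by move=> hz; inversion hz.
  have [[hy lty] [hy' lty']] := (mu _ h, mu _ h').
  case: (ltngtP y y') => // [/lty'|/lty] [u hu].
    by have := IHp _ _ _ hy hu.
  by have := IHp _ _ _ hy' hu.
- by move=> v w w' h h'; inversion h; inversion h'.
- move=> q IHq qs IHqs v w w' h h'; inversion h; inversion h'; subst.
  by congr cons; eauto.
Qed.

(* MathComp's encoding of lists and pairs of natural numbers: a natural number
   encodes itself, [:: x1; ..; xk] is encoded by applying [CodeSeq.code] to the
   list of codes of the [xi], and [(x, y)] is encoded like [:: x; y]. The name
   is qualified because finmap redefines [pickle]. *)
Definition encode (T : countType) (x : T) : nat := choice.pickle x.

(* A finite group is given by its multiplication table with respect to some
   numbering [e] of its elements: [x] has the number [index x e]. *)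
Definition numbering (gT : finGroupType) (e : seq gT) : Prop :=
  perm_eq e (enum gT).

Definition mul_table (gT : finGroupType) (e : seq gT) : seq (seq nat) :=
  [seq [seq index (x * y)%g e | y <- e] | x <- e].

Definition elt_code (gT : finGroupType) (e : seq gT) (x : gT) : nat :=
  index x e.

Definition vec_code (gT : finGroupType) (e : seq gT) (d : nat)
    (x : {ffun 'I_d -> gT}) : seq nat :=
  [seq elt_code e (x i) | i <- enum 'I_d].

Arguments vec_code {gT} e {d} x.

(* [c] lists in some order the pairs [(a, f a)] with [a] in the support of [f],
   values being encoded by [code]. *)
Definition tile_code n (G : groupType) (C : eqType) (code : G -> C)
    (f : tile n G) (c : seq (seq nat * C)) : bool :=
  perm_eq c [seq (tval (multinom_val a), code (f a)) | a <- finsupp f].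

Definition tiles_code n (G : groupType) (C : eqType) (code : G -> C)
    (S : seq (tile n G)) (c : seq (seq (seq nat * C))) : bool :=
  all2 (tile_code code) S c.

Definition gens_code n (G : groupType) (C : eqType) (code : G -> C)
    (I : tile n G -> Prop) (c : seq (seq (seq nat * C))) : Prop :=
  exists2 S : seq (tile n G), generates S I & tiles_code code S c.

(* Main.v *)
(** A program cannot use [lt], which need not be computable.  It computes instead
    finitely many tiles which form a standard basis of I for all monomial orders
    at once; the other three problems use such universal bases too.

    Let F be a finite set of generators of I with supports in [0, E]^n.  As in
    Buchberger's criterion, F is a standard basis for an order if every tile in
    some group L of tiles of I supported in [0, 2E]^n, which contains the shifts
    of F by [0, E]^n, is a product of shifts of F that do not exceed its top.
    This is a well-founded induction on the top index a: a shift of F with top a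
    normalizes the group generated by the smaller shifts, since a conjugation
    either happens at a smaller index already (common shift), or is trivial
    (disjoint supports), or lies in L; hence a product of shifts below a whose
    value at a is trivial is a product of smaller shifts and of a shift of an
    element of L.  The criterion depends on the order in a finite box only.
    So a program can search for a box size N such that each linear order of
    [0, N]^n satisfying the axioms of a monomial order inside the box passes the
    test.  The search succeeds: otherwise a cluster point of bad orders would be a
    monomial order, and for it Dickson's lemma, applied to the pairs (top index,
    top value) of the tiles of I, yields a finite F passing the test.

    Membership uses a degree order, for which the tiles involved stay in a known
    box; elimination uses an order refining the exponent of the first variable;
    saturation uses a reverse lexicographic order after homogenization.  *)

From Stdlib Require Import ClassicalEpsilon.
Require Import Defs.
From HB Require Import structures.
From mathcomp Require Import all_boot all_order all_fingroup all_algebra.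
From mathcomp Require Import all_solvable finmap mpoly zify.

Set Implicit Arguments.
Unset Strict Implicit.
Unset Printing Implicit Defensive.

(** * Computable functions on coded data *)

(** The obstacle is that G is not commutative: the factors of a product of shifts cannot be sorted
    by their tops without conjugating, so comparing generators in pairs does not control longer
    products. This is why the criterion tests a whole group [L] of small tiles. Its box has side 2E
    because the shifts relevant at one index differ from their largest common shift by at most E,
    and the shifted tiles themselves extend up to E.

    Finiteness of G is used three times. Inverses are powers, so only products are considered.
    Dickson's lemma is applied once for each value of G. The tiles in a box form a finite set, so
    products of increasing length stabilize, and membership in a group generated inside a box can be
    tested.

    Excluded middle and choice serve only to prove facts about the programs, for instance that a
    search succeeds; the programs themselves are terms of [recfun].

    In the saturation part, the homogenized generators need not span the homogenizations of all
    tiles of I. Those of sufficiently large degree do lie in their span, and this is enough. *)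

Definition recursive (k : nat) (f : seq nat -> nat) : Prop :=
  exists p, forall v, size v = k -> eval p v (f v).

Definition recursive1 (g : nat -> nat) := recursive 1 (fun v => g (nth 0 v 0)).

Section Recursive.
Variable k : nat.
Implicit Types f g h : seq nat -> nat.

Lemma recursive_ext f g :
  (forall v, size v = k -> f v = g v) -> recursive k f -> recursive k g.
Proof. by move=> fg [p hp]; exists p => v sv; rewrite -fg //; apply: hp. Qed.

Lemma recursive_proj i : i < k -> recursive k (fun v => nth 0 v i).
Proof. by move=> ik; exists (RProj i) => v sv; apply: EProj; rewrite sv. Qed.

Lemma recursive_comp1 g f :
  recursive 1 g -> recursive k f -> recursive k (fun v => g [:: f v]).
Proof.
move=> [p hp] [q hq]; exists (RComp p (RCons q RNil)) => v sv.
by apply: EComp (hp [:: f v] erefl); apply: ECons (hq v sv) (ENil v).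
Qed.

Lemma recursive_comp2 g f1 f2 :
  recursive 2 g -> recursive k f1 -> recursive k f2 ->
  recursive k (fun v => g [:: f1 v; f2 v]).
Proof.
move=> [p hp] [q1 h1] [q2 h2]; exists (RComp p (RCons q1 (RCons q2 RNil))).
move=> v sv; apply: EComp (hp [:: f1 v; f2 v] erefl).
by apply: ECons (h1 v sv) (ECons (h2 v sv) (ENil v)).
Qed.

Lemma recursive_succ f : recursive k f -> recursive k (fun v => (f v).+1).
Proof.
have hS : recursive 1 (fun v => (nth 0 v 0).+1).
  by exists RSucc => -[|x []] // _; apply: ESucc.
by move/(recursive_comp1 hS).
Qed.

Lemma recursive_const c : recursive k (fun=> c).
Proof.
elim: c => [|c]; first by exists RZero => v _; apply: EZero.
exact: recursive_succ.
Qed.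

Fixpoint projections i m : recfuns :=
  if m is m'.+1 then RCons (RProj i) (projections i.+1 m') else RNil.

Lemma eval_projections v i m :
  i + m = size v -> evals (projections i m) v (drop i v).
Proof.
elim: m i => [|m IHm] i /=.
  by rewrite addn0 => ->; rewrite drop_size; apply: ENil.
move=> im; have iv : i < size v by rewrite -im addnS ltnS leq_addr.
rewrite (drop_nth 0 iv); apply: ECons; first exact: EProj.
by apply: IHm; rewrite addSnnS.
Qed.

Lemma recursive_rec f g h :
  recursive k f -> recursive k.+2 g -> recursive k h ->
  recursive k (fun v => nat_rect (fun=> nat) (f v)
                          (fun i r => g [:: i, r & v]) (h v)).
Proof.
move=> [p hp] [q hq] [r hr].
exists (RComp (RPrec p q) (RCons r (projections 0 k))) => v sv.
have ev : evals (RCons r (projections 0 k)) v (h v :: v).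
  by apply: ECons (hr v sv) _; rewrite -{2}[v]drop0; apply: eval_projections.
apply: EComp ev _; elim: (h v) => [|i IHi] /=.
  by apply: EPrec0; apply: hp.
by apply: EPrecS IHi _; apply: hq; rewrite /= sv.
Qed.

Lemma recursive_if f g h :
  recursive k f -> recursive k g -> recursive k h ->
  recursive k (fun v => if f v is 0 then g v else h v).
Proof.
move=> [p hp] [q hq] [r hr].
pose shift2 := RComp r (projections 2 k).
have h2 : recursive k.+2 (fun v => h (drop 2 v)).
  exists shift2 => v sv; apply: (@EComp _ _ _ (drop 2 v)).
    by apply: eval_projections; rewrite sv add2n.
  by apply: hr; rewrite size_drop sv subn2.
apply: recursive_ext (recursive_rec (f := g) (h := f) _ h2 _).
- by move=> v _ /=; case: (f v) => //= m; rewrite drop0.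
- by exists q.
- by exists p.
Qed.

Lemma recursive_search f g :
  recursive k.+1 f ->
  (forall v, size v = k ->
     f (g v :: v) = 0 /\ forall z, z < g v -> f (z :: v) <> 0) ->
  recursive k g.
Proof.
move=> [p hp] fg; exists (RMu p) => v sv.
have [f0 fS] := fg v sv; apply: EMu => [|z /fS].
  by rewrite -f0; apply: hp; rewrite /= sv.
have := hp (z :: v); rewrite /= sv => /(_ erefl).
by case: (f _) => // m h _; exists m.
Qed.

End Recursive.

(** * Coding of lists by natural numbers *)

Definition ccons x s := 2 ^ x * s.*2.+1.
Definition chead z := logn 2 z.
Definition ctail z := (iter (chead z) half z)./2.

Lemma iter_half x m : iter x half (2 ^ x * m) = m.
Proof. by elim: x => [|x IHx];
  rewrite ?mul1n // iterSr expnS -mulnA mul2n doubleK. Qed.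

Lemma ccons_gt0 x s : 0 < ccons x s.
Proof. by rewrite muln_gt0 expn_gt0. Qed.

Lemma cconsK x s : chead (ccons x s) = x.
Proof.
rewrite /chead /ccons lognM ?expn_gt0 // pfactorK // logn_coprime ?addn0 //.
by rewrite coprime2n /= odd_double.
Qed.

Lemma ctailK x s : ctail (ccons x s) = s.
Proof. by rewrite /ctail cconsK iter_half /= uphalf_double. Qed.

Lemma recursive_double : recursive1 double.
Proof.
apply: recursive_ext (recursive_rec (f := fun=> 0)
  (g := fun v => (nth 0 v 1).+2) (h := fun v => nth 0 v 0) _ _ _).
- by move=> v _; elim: (nth 0 v 0) => //= i ->.
- exact: recursive_const.
- by do 2!apply: recursive_succ; apply: recursive_proj.
- exact: recursive_proj.
Qed.

Lemma recursive_odd : recursive1 odd.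
Proof.
apply: recursive_ext (recursive_rec (f := fun=> 0)
  (g := fun v => if nth 0 v 1 is 0 then 1 else 0) (h := fun v => nth 0 v 0) _ _ _).
- by move=> v _; elim: (nth 0 v 0) => //= i ->; case: (odd i).
- exact: recursive_const.
- by apply: recursive_if; try apply: recursive_const; apply: recursive_proj.
- exact: recursive_proj.
Qed.

Lemma recursive_half : recursive1 half.
Proof.
apply: recursive_ext (recursive_rec (f := fun=> 0)
  (g := fun v => if (odd (nth 0 [:: nth 0 v 0] 0) : nat) is 0
                 then nth 0 v 1 else (nth 0 v 1).+1)
  (h := fun v => nth 0 v 0) _ _ _).
- move=> v _; elim: (nth 0 v 0) => //= i ->.
  by rewrite uphalf_half; case: (odd i).
- exact: recursive_const.
- apply: recursive_if.
  + by apply: (recursive_comp1 recursive_odd); apply: recursive_proj.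
  + exact: recursive_proj.
  + by apply: recursive_succ; apply: recursive_proj.
- exact: recursive_proj.
Qed.

Lemma recursive_iter k g f h : recursive1 g -> recursive k f -> recursive k h ->
  recursive k (fun v => iter (f v) g (h v)).
Proof.
move=> hg hf hh; apply: recursive_ext (recursive_rec hh
  (g := fun v => g (nth 0 [:: nth 0 v 1] 0)) _ hf).
- by move=> v _; elim: (f v) => //= i ->.
- by apply: (recursive_comp1 hg); apply: recursive_proj.
Qed.

Lemma recursive_ccons : recursive 2 (fun v => ccons (nth 0 v 0) (nth 0 v 1)).
Proof.
have hd : recursive 2 (fun v => (nth 0 v 1).*2.+1).
  by apply: recursive_succ; apply: (recursive_comp1 recursive_double);
    apply: recursive_proj.
apply: recursive_ext (recursive_iter recursive_double
  (recursive_proj (i := 0) _) hd) => // v _.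
rewrite /ccons; elim: (nth 0 v 0) => [|x IHx]; first by rewrite mul1n.
by rewrite iterS IHx expnS -mulnA mul2n.
Qed.

Lemma recursive_chead : recursive1 chead.
Proof.
(* The least shift that makes the argument odd is its 2-adic valuation. The argument 0 never becomes
   odd; it is accepted at once, in accordance with [logn 2 0 = 0]. *)
have h : recursive 2 (fun v => if nth 0 v 1 is 0 then 0 else
    if (odd (iter (nth 0 v 0) half (nth 0 v 1)) : nat) is 0 then 1 else 0).
  apply: recursive_if; [exact: recursive_proj | exact: recursive_const |].
  apply: recursive_if; try exact: recursive_const.
  apply: (recursive_comp1 recursive_odd).
  by apply: (recursive_iter recursive_half); apply: recursive_proj.
apply: (recursive_search h) => -[|z []] //= _.
case: z => [|z]; first by rewrite /chead logn0.
have [s sE] : exists s, z.+1 = 2 ^ chead z.+1 * s.*2.+1.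
  have [m om mE] := pfactor_coprime (p := 2) isT (ltn0Sn z).
  exists m./2; rewrite -[m./2.*2.+1]add1n.
  have {2}-> : 1 = odd m by move: om; rewrite coprime2n => ->.
  by rewrite odd_double_half mulnC -mE.
rewrite {2 4}sE; split.
  by rewrite iter_half /= odd_double.
move=> x xlt; rewrite -(subnKC xlt) addSnnS expnD -mulnA iter_half.
by rewrite expnS -mulnA oddM.
Qed.

Lemma recursive_ctail : recursive1 ctail.
Proof.
apply: (recursive_comp1 recursive_half).
apply: (recursive_iter recursive_half); last exact: recursive_proj.
exact: recursive_chead.
Qed.

(** A code is any map to numbers, chosen by type; injectivity is a separate class, required only
    where elements are compared. *)
Class code (T : Type) := cd : T -> nat.
#[global] Instance code_nat : code nat := id.
#[global] Instance code_bool : code bool := nat_of_bool.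
#[global] Instance code_seq T {_ : code T} : code (seq T) :=
  foldr (fun a z => ccons (cd a) z) 0.
#[global] Instance code_prod T U {_ : code T} {_ : code U} : code (T * U) :=
  fun x => ccons (cd x.1) (ccons (cd x.2) 0).
Arguments cd : simpl never.

Definition computable {T U} {_ : code T} {_ : code U} (f : T -> U) : Prop :=
  exists p, forall x, eval p [:: cd x] (cd (f x)).

(** * Combinators for computable functions of an environment [X]; a bound variable enlarges it to a
    product *)

Section Computable.
Context {X : Type} {codeX : code X}.

Lemma computable_lift1 {T U} {_ : code T} {_ : code U} (g : nat -> nat)
    (f : X -> T) (h : T -> U) :
  recursive1 g -> (forall t, g (cd t) = cd (h t)) -> computable f ->
  computable (fun x => h (f x)).
Proof.
move=> [p hp] gh [q hq]; exists (RComp p (RCons q RNil)) => x.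
rewrite -gh; apply: EComp (hp [:: cd (f x)] erefl).
exact: ECons (hq x) (ENil _).
Qed.

Lemma computable_lift2 {T1 T2 U} {_ : code T1} {_ : code T2} {_ : code U}
    (g : seq nat -> nat) (f1 : X -> T1) (f2 : X -> T2) (h : T1 -> T2 -> U) :
  recursive 2 g -> (forall t1 t2, g [:: cd t1; cd t2] = cd (h t1 t2)) ->
  computable f1 -> computable f2 -> computable (fun x => h (f1 x) (f2 x)).
Proof.
move=> [p hp] gh [q1 h1] [q2 h2]; exists (RComp p (RCons q1 (RCons q2 RNil))).
move=> x; rewrite -gh; apply: EComp (hp [:: cd (f1 x); cd (f2 x)] erefl).
exact: ECons (h1 x) (ECons (h2 x) (ENil _)).
Qed.

Lemma computable_comp {T U} {_ : code T} {_ : code U} (f : X -> T) (g : T -> U) :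
  computable g -> computable f -> computable (fun x => g (f x)).
Proof.
move=> [p hp] [q hq]; exists (RComp p (RCons q RNil)) => x.
by apply: EComp (hp _); apply: ECons (hq x) (ENil _).
Qed.

Lemma computable_id : computable (fun x : X => x).
Proof. by exists (RProj 0) => x; apply: EProj. Qed.

Lemma computable_const {U} {_ : code U} (c : U) : computable (fun _ : X => c).
Proof.
have [p hp] := recursive_const 1 (cd c).
by exists p => x; apply: hp.
Qed.

Lemma computable_cd {U} {_ : code U} (f : X -> U) :
  computable f -> computable (fun x => cd (f x) : nat).
Proof. by move=> [p hp]; exists p. Qed.

Lemma computable_pair {T U} {_ : code T} {_ : code U} (f : X -> T) (g : X -> U) :
  computable f -> computable g -> computable (fun x => (f x, g x)).
Proof.
apply: (computable_lift2 (g :=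
  fun v => ccons (nth 0 v 0) (ccons (nth 0 v 1) 0))) => //.
apply: (recursive_comp2 (g :=
  fun v => ccons (nth 0 v 0) (nth 0 v 1)) recursive_ccons).
  exact: recursive_proj.
apply: (recursive_comp2 (g :=
  fun v => ccons (nth 0 v 0) (nth 0 v 1)) recursive_ccons).
  exact: recursive_proj.
exact: recursive_const.
Qed.

Lemma computable_fst {T U} {_ : code T} {_ : code U} (f : X -> T * U) :
  computable f -> computable (fun x => (f x).1).
Proof.
by apply: (computable_lift1 (h := fst) recursive_chead) => -[a b]; apply: cconsK.
Qed.

Lemma computable_snd {T U} {_ : code T} {_ : code U} (f : X -> T * U) :
  computable f -> computable (fun x => (f x).2).
Proof.
apply: (computable_lift1 (h := snd) (g := fun z => chead (ctail z))).
  exact: (recursive_comp1 recursive_chead recursive_ctail).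
by move=> [a b]; rewrite /cd /code_prod ctailK cconsK.
Qed.

Lemma computable_succ (f : X -> nat) :
  computable f -> computable (fun x => (f x).+1).
Proof.
apply: (computable_lift1 (h := S) (g := S)) => //.
by apply: recursive_succ; apply: recursive_proj.
Qed.

Lemma computable_cons {T} {_ : code T} (f : X -> T) (g : X -> seq T) :
  computable f -> computable g -> computable (fun x => f x :: g x).
Proof. exact: (computable_lift2 recursive_ccons). Qed.

Lemma computable_eqfun {U} {_ : code U} (f g : X -> U) :
  f =1 g -> computable f -> computable g.
Proof. by move=> fg [p hp]; exists p => x; rewrite -fg. Qed.

Lemma computable_nat_of_bool (f : X -> bool) :
  computable f -> computable (fun x => nat_of_bool (f x)).
Proof. by move=> [p hp]; exists p. Qed.

(** Primitive recursion hands its step the counter, the accumulator and the environment, in this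
    order; this reassembles them as the code of [(x, i, u)]. *)
Let pack3 : recursive 3 (fun v => ccons (ccons (nth 0 v 2) (ccons (nth 0 v 0) 0))
                                    (ccons (nth 0 v 1) 0)).
Proof.
have cc f g : recursive 3 f -> recursive 3 g ->
    recursive 3 (fun v => ccons (f v) (g v)).
  exact: (recursive_comp2 recursive_ccons).
by apply: (cc _ _ (cc _ _ _ (cc _ _ _ _)) (cc _ _ _ _));
  first [exact: recursive_proj | exact: recursive_const].
Qed.

Lemma computable_nat_rect {U} {_ : code U} (m : X -> nat) (f : X -> U)
    (g : X -> nat -> U -> U) :
  computable m -> computable f ->
  computable (fun p : X * nat * U => g p.1.1 p.1.2 p.2) ->
  computable (fun x => nat_rect (fun=> U) (f x) (g x) (m x)).
Proof.
move=> [pm hm] [pf hf] [pg hg]; have [pk hk] := pack3.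
exists (RComp (RPrec pf (RComp pg (RCons pk RNil)))
          (RCons pm (RCons (RProj 0) RNil))) => x.
apply: (@EComp _ _ _ [:: m x; cd x]).
  by apply: ECons (hm x) (ECons (EProj _) (ENil _)).
elim: (m x) => [|i IHi] /=; first exact: EPrec0.
apply: EPrecS IHi _; apply: EComp (hg (x, i, _)).
exact: ECons (hk [:: i; _; cd x] erefl) (ENil _).
Qed.

(** A case distinction made from primitive recursion runs the base program [pa] in both cases, so
    [pa] must always halt; [pb] runs only for [0 < c], and nothing is asked of it otherwise. *)
Lemma eval_if pc pa pb v c y :
  eval pc v c -> (c = 0 -> eval pa v y) -> (0 < c -> eval pb v y) ->
  (c = 0 \/ exists y', eval pa v y') ->
  eval (RComp (RPrec pa (RComp pb (projections 2 (size v))))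
              (RCons pc (projections 0 (size v)))) v y.
Proof.
move=> ec ea eb ex; apply: (@EComp _ _ _ (c :: v)).
  by apply: ECons ec _; rewrite -{3}[v]drop0; apply: eval_projections.
case: c ec ea eb ex => [|c] _ ea eb ex; first by apply: EPrec0; apply: ea.
have pbe i u : eval (RComp pb (projections 2 (size v))) [:: i, u & v] y.
  apply: EComp (eb isT).
  by have := @eval_projections [:: i, u & v] 2 (size v) erefl; rewrite /= drop0.
have [y' hy'] : exists y', eval pa v y' by case: ex.
have [u hu] : exists u,
  eval (RPrec pa (RComp pb (projections 2 (size v)))) (c :: v) u.
  by elim: c {ea eb ex} => [|c [u hu]]; [exists y'; apply: EPrec0 | exists y;
    apply: EPrecS hu _].
exact: EPrecS hu _.
Qed.

(** The code of a list thus serves as the number of rounds of a loop over the list. *)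
Lemma size_cd {T} {_ : code T} (s : seq T) : size s <= cd s.
Proof.
elim: s => //= a s IHs; rewrite [cd _]/(ccons (cd a) (cd s)).
apply: leq_ltn_trans IHs _; rewrite /ccons.
by apply: leq_trans (leq_pmull _ _); rewrite ?expn_gt0 // ltnS -addnn leq_addr.
Qed.

Lemma iter_ctail {T} {_ : code T} i (s : seq T) : iter i ctail (cd s) = cd
  (drop i s).
Proof.
elim: i s => [|i IHi] s; first by rewrite drop0.
case: s => [|a s]; last by rewrite iterSr [ctail _]ctailK IHi.
have ct0 : ctail 0 = 0 by rewrite /ctail /chead logn0.
have c0 : cd ([::] : seq T) = 0 by [].
by rewrite iterSr c0 ct0 -c0 IHi.
Qed.

Lemma computable_foldl {T U} {_ : code T} {_ : code U} (l : X -> seq T)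
    (z : X -> U) (h : X -> U -> T -> U) :
  computable l -> computable z ->
  computable (fun p : X * T * U => h p.1.1 p.2 p.1.2) ->
  computable (fun x => foldl (h x) (z x) (l x)).
Proof.
move=> [pl hl] [pz hz] [ph hh]; have [pk hk] := pack3.
have [pt ht] : recursive 2 (fun v => iter (nth 0 v 0) ctail (nth 0 v 1)).
  by apply: (recursive_iter recursive_ctail); apply: recursive_proj.
have [pd hd] := recursive_chead.
pose rest := RComp pt (RCons (RProj 0) (RCons (RComp pl (RCons (RProj 2) RNil))
  RNil)).
pose new := RComp ph (RCons (RComp pk
  (RCons (RComp pd (RCons rest RNil)) (RCons (RProj 1) (RCons (RProj 2)
    RNil)))) RNil).
(* The loop runs past the end of the list. There [chead] returns 0, which need not be the code of an
   element, so [ph] must not be called: a rest with code 0 leaves the accumulator unchanged. *)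
pose stp := RComp (RPrec (RProj 1) (RComp new (projections 2 3)))
              (RCons rest (projections 0 3)).
exists (RComp (RPrec pz stp) (RCons pl (RCons (RProj 0) RNil))) => x.
have rstE i r : eval rest [:: i; r; cd x] (cd (drop i (l x))).
  rewrite -iter_ctail; apply: EComp (ht [:: i; cd (l x)] erefl).
  apply: ECons (EProj _) (ECons _ (ENil _)) => //.
  by apply: EComp (hl x); apply: ECons (EProj _) (ENil _).
apply: (@EComp _ _ _ [:: cd (l x); cd x]).
  by apply: ECons (hl x) (ECons (EProj _) (ENil _)).
have -> : foldl (h x) (z x) (l x) = foldl (h x) (z x) (take (cd (l x)) (l x)).
  by rewrite take_oversize // size_cd.
elim: (cd (l x)) => [|i IHi]; first by rewrite take0; apply: EPrec0.
apply: EPrecS IHi _; apply: eval_if (rstE _ _) _ _ _ => /=; last first.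
- by right; eexists; apply: EProj.
- case: (ltnP i (size (l x))) => [il _|/drop_oversize-> //].
  case: (l x) il (rstE i) => // d l' il; rewrite (drop_nth d il) => rE.
  rewrite (take_nth d il) foldl_rcons.
  apply: EComp (hh (x, nth d (d :: l') i, _)); apply: ECons _ (ENil _).
  apply: EComp (hk [:: cd (nth d (d :: l') i); _; cd x] erefl).
  apply: ECons _ (ECons (EProj _) (ECons (EProj _) (ENil _))) => //=.
  set r := (X in eval _ [:: i; X; _]).
  have cE : chead (cd (nth d (d :: l') i :: drop i.+1 (d :: l')))
          = cd (nth d (d :: l') i) by exact: cconsK.
  rewrite -cE; have := rE r; set z' := (cd (_ :: _)) => e.
  exact: EComp (ECons e (ENil _)) (hd [:: _] erefl).
- case: (ltnP i (size (l x))) => [il|il _].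
    case: (l x) il => // d l' il; rewrite (drop_nth d il) => /eqP.
    by rewrite [_ == _]negbTE // -lt0n; apply: ccons_gt0.
  rewrite !take_oversize ?leqW //.
  exact: (@EProj 1 [:: i; _; cd x]).
Qed.

Lemma computable_iter {U} {_ : code U} (m : X -> nat) (f : X -> U) (g : X -> U
  -> U) :
  computable m -> computable f -> computable (fun p : X * U => g p.1 p.2) ->
  computable (fun x => iter (m x) (g x) (f x)).
Proof.
move=> hm hf hg.
apply: computable_eqfun (computable_nat_rect (g := fun x _ u => g x u) hm hf _).
  by move=> x; elim: (m x) => //= i ->.
have [p hp] := hg; have [q hq] : recursive1 (fun z =>
    ccons (chead (chead z)) (ccons (chead (ctail z)) 0)).
  apply: (recursive_comp2 (g :=
    fun v => ccons (nth 0 v 0) (nth 0 v 1)) recursive_ccons).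
    exact: (recursive_comp1 recursive_chead recursive_chead).
  apply: (recursive_comp2 (g :=
    fun v => ccons (nth 0 v 0) (nth 0 v 1)) recursive_ccons).
    exact: (recursive_comp1 recursive_chead recursive_ctail).
  exact: recursive_const.
exists (RComp p (RCons q RNil)) => -[[x i] u].
apply: EComp (hp (x, u)); apply: ECons _ (ENil _).
have c1 : chead (cd (x, i, u)) = cd (x, i) by exact: cconsK.
have c2 : ctail (cd (x, i, u)) = ccons (cd u) 0 by exact: ctailK.
set z := cd (x, i, u) in c1 c2 *; have := hq [:: z] erefl.
by rewrite /= c1 c2 cconsK [chead _]cconsK.
Qed.

Lemma computable_if {U} {_ : code U} (b : X -> bool) (f g : X -> U) :
  computable b -> computable f -> computable g ->
  computable (fun x => if b x then f x else g x).
Proof.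
move=> hb hf hg; apply: computable_eqfun (computable_nat_rect
  (g := fun x _ _ => f x) (computable_nat_of_bool hb) hg _).
  by move=> x; case: (b x).
have [p hp] := hf; have [q hq] := recursive_comp1 recursive_chead recursive_chead.
exists (RComp p (RCons q RNil)) => -[[x i] u].
apply: EComp (hp x); apply: ECons _ (ENil _).
have c1 : chead (cd (x, i, u)) = cd (x, i) by exact: cconsK.
set z := cd (x, i, u) in c1 *; have := hq [:: z] erefl.
by rewrite /= c1 [chead _]cconsK.
Qed.

Lemma computable_behead {T} {_ : code T} (l : X -> seq T) :
  computable l -> computable (fun x => behead (l x)).
Proof.
apply: (computable_lift1 recursive_ctail) => -[|a s]; last exact: ctailK.
by rewrite (_ : cd ([::] : seq T) = 0) // /ctail /chead logn0.
Qed.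

End Computable.

(** * Automation: proofs of computability by recursion on the shape of a term *)

Ltac comp_user := fail.
Ltac comp_step := cbv beta;
  first [ simple apply computable_const | simple apply computable_id |
  exact (computable_fst computable_id) | exact (computable_snd computable_id) |
  exact (computable_succ computable_id) | comp_user |
  lazymatch goal with
  | |- computable (fun _ => (_, _)) => simple apply computable_pair
  | |- computable (fun _ => fst _) => simple apply computable_fst
  | |- computable (fun _ => snd _) => simple apply computable_snd
  | |- computable (fun _ => S _) => simple apply computable_succ
  | |- computable (fun _ => _ :: _) => simple apply computable_cons
  | |- computable (fun _ => nat_of_bool _) => simple apply computable_nat_of_bool
  | |- computable (fun _ => foldl _ _ _) => simple apply computable_foldl
  | |- computable (fun _ => iter _ _ _) => simple apply computable_iter
  | |- computable (fun _ => if _ then _ else _) => simple apply computable_if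
  | |- computable (fun _ => nat_rect _ _ _ _) => simple apply computable_nat_rect
  | |- computable (fun _ => behead _) => simple apply computable_behead
  end ].
Ltac comp := repeat comp_step; try eassumption.

Class injective_code (T : Type) {codeT : code T} := cd_inj : injective (@cd T _).
Arguments injective_code T {codeT}.
Arguments cd_inj {T codeT _} [x1 x2] _.
#[global] Instance injective_code_nat : injective_code nat := fun x y => id.
#[global] Instance injective_code_seq T {_ : code T} {_ : injective_code T} :
  injective_code (seq T).
Proof.
have ccons_neq0 x z : ccons x z <> 0.
  by move=> e; have := ccons_gt0 x z; rewrite e.
move=> s t; elim: s t => [|a s IHs] [|b t] // e.
- by have e' : 0 = ccons (cd b) (cd t) by []; case: (ccons_neq0 _ _ (esym e')).
- by have e' : ccons (cd a) (cd s) = 0 by []; case: (ccons_neq0 _ _ e').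
have e' : ccons (cd a) (cd s) = ccons (cd b) (cd t) by exact: e.
have := congr1 chead e'; have := congr1 ctail e'.
by rewrite !ctailK !cconsK => es ea; rewrite (IHs _ es) (cd_inj ea).
Qed.

Lemma computable_weaken {X T U} {_ : code X} {_ : code T} {_ : code U} (g : X
  -> U) :
  computable g -> computable (fun p : X * T => g p.1).
Proof. by move=> hg; exact: (computable_comp hg (computable_fst
  computable_id)). Qed.

Lemma computable_rev {X} {_ : code X} {T} {_ : code T} (l : X -> seq T) :
  computable l -> computable (fun x => rev (l x)).
Proof.
move=> hl; apply: (computable_eqfun
  (f := fun x => foldl (fun r a => a :: r) [::] (l x))); last by comp.
move=> x /=; rewrite -[RHS]cats0 /rev -catrevE.
by elim: (l x) [::] => //= a s IHs r; rewrite IHs.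
Qed.

Lemma computable_foldr {X} {_ : code X} {T U} {_ : code T} {_ : code U} (l : X
  -> seq T)
    (z : X -> U) (h : X -> T -> U -> U) :
  computable l -> computable z ->
  computable (fun p : X * T * U => h p.1.1 p.1.2 p.2) ->
  computable (fun x => foldr (h x) (z x) (l x)).
Proof.
move=> hl hz hh; apply: (computable_eqfun
  (f := fun x => foldl (fun r a => h x a r) (z x) (rev (l x)))).
  by move=> x; rewrite foldl_rev.
by apply: computable_foldl => //; apply: computable_rev.
Qed.

Lemma computable_cat {X} {_ : code X} {T} {_ : code T} (s t : X -> seq T) :
  computable s -> computable t -> computable (fun x => s x ++ t x).
Proof.
move=> hs ht; apply: (computable_eqfun
  (f := fun x => foldr (fun a r => a :: r) (t x) (s x))).
  by move=> x; elim: (s x) => //= a r ->.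
by apply: computable_foldr => //; comp.
Qed.

Lemma computable_map {X} {_ : code X} {T U} {_ : code T} {_ : code U} (h : X ->
  T -> U)
    (l : X -> seq T) :
  computable (fun p : X * T => h p.1 p.2) -> computable l ->
  computable (fun x => map (h x) (l x)).
Proof.
move=> hh hl; apply: (computable_eqfun
  (f := fun x => foldr (fun a r => h x a :: r) [::] (l x))).
  by move=> x; elim: (l x) => //= a s ->.
apply: computable_foldr => //; comp.
exact: (computable_weaken hh).
Qed.

Lemma computable_flatten {X} {_ : code X} {T} {_ : code T} (l : X -> seq (seq T)) :
  computable l -> computable (fun x => flatten (l x)).
Proof.
move=> hl; apply: computable_foldr => //; first by comp.
by apply: computable_cat; comp.
Qed.

Lemma computable_filter {X} {_ : code X} {T} {_ : code T} (a : X -> T -> bool)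
  (l : X -> seq T) :
  computable (fun p : X * T => a p.1 p.2) -> computable l ->
  computable (fun x => filter (a x) (l x)).
Proof.
move=> ha hl; apply: (computable_eqfun
  (f := fun x => foldr (fun b r => if a x b then b :: r else r) [::] (l x))).
  by move=> x; elim: (l x) => //= b s ->.
apply: computable_foldr => //; comp.
exact: (computable_weaken ha).
Qed.

Lemma computable_negb {X} {_ : code X} (a : X -> bool) :
  computable a -> computable (fun x => ~~ a x).
Proof.
move=> ha; apply: (computable_eqfun (f := fun x => if a x then false else true)).
  by move=> x; case: (a x).
by comp.
Qed.

Lemma computable_andb {X} {_ : code X} (a b : X -> bool) :
  computable a -> computable b -> computable (fun x => a x && b x).
Proof. by move=> ha hb; rewrite /andb; comp. Qed.

Lemma computable_orb {X} {_ : code X} (a b : X -> bool) :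
  computable a -> computable b -> computable (fun x => a x || b x).
Proof. by move=> ha hb; rewrite /orb; comp. Qed.

Lemma computable_implb {X} {_ : code X} (a b : X -> bool) :
  computable a -> computable b -> computable (fun x => a x ==> b x).
Proof. by move=> ha hb; rewrite /implb; comp. Qed.

Lemma computable_all {X} {_ : code X} {T} {_ : code T} (a : X -> T -> bool) (l
  : X -> seq T) :
  computable (fun p : X * T => a p.1 p.2) -> computable l ->
  computable (fun x => all (a x) (l x)).
Proof.
move=> ha hl; apply: (computable_eqfun
  (f := fun x => foldr (fun b r => a x b && r) true (l x))).
  by move=> x; elim: (l x) => //= b s ->.
apply: computable_foldr => //; comp; apply: computable_andb; comp.
exact: (computable_weaken ha).
Qed.

Lemma computable_has {X} {_ : code X} {T} {_ : code T} (a : X -> T -> bool) (l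
  : X -> seq T) :
  computable (fun p : X * T => a p.1 p.2) -> computable l ->
  computable (fun x => has (a x) (l x)).
Proof.
move=> ha hl; apply: (computable_eqfun
  (f := fun x => foldr (fun b r => a x b || r) false (l x))).
  by move=> x; elim: (l x) => //= b s ->.
apply: computable_foldr => //; comp; apply: computable_orb; comp.
exact: (computable_weaken ha).
Qed.

Lemma computable_find {X} {_ : code X} {T} {_ : code T} (a : X -> T -> bool) (l
  : X -> seq T) :
  computable (fun p : X * T => a p.1 p.2) -> computable l ->
  computable (fun x => find (a x) (l x)).
Proof.
move=> ha hl; apply: (computable_eqfun
  (f := fun x => foldr (fun b r => if a x b then 0 else r.+1) 0 (l x))).
  by move=> x; elim: (l x) => //= b s ->.
apply: computable_foldr => //; comp.
exact: (computable_weaken ha).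
Qed.

Lemma computable_size {X} {_ : code X} {T} {_ : code T} (l : X -> seq T) :
  computable l -> computable (fun x => size (l x)).
Proof.
move=> hl; apply: (computable_eqfun
  (f := fun x => foldr (fun _ r => r.+1) 0 (l x))).
  by move=> x; elim: (l x) => //= b s ->.
by apply: computable_foldr => //; comp.
Qed.

Lemma computable_addn {X} {_ : code X} (f g : X -> nat) :
  computable f -> computable g -> computable (fun x => f x + g x).
Proof.
move=> hf hg; apply: (computable_eqfun (f := fun x => iter (f x) S (g x))).
  by move=> x; rewrite iter_succn addnC.
by comp.
Qed.

Lemma computable_predn {X} {_ : code X} (f : X -> nat) :
  computable f -> computable (fun x => (f x).-1).
Proof.
move=> hf; apply: (computable_eqfun
  (f := fun x => nat_rect (fun=> nat) 0 (fun i _ => i) (f x))).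
  by move=> x; case: (f x).
by comp.
Qed.

Lemma computable_subn {X} {_ : code X} (f g : X -> nat) :
  computable f -> computable g -> computable (fun x => f x - g x).
Proof.
move=> hf hg; apply: (computable_eqfun (f := fun x => iter (g x) predn (f x))).
  by move=> x; elim: (g x) => [|i]; rewrite ?subn0 // iterS subnS => ->.
comp; apply: computable_predn; comp.
Qed.

Lemma computable_sumn {X} {_ : code X} (f : X -> seq nat) :
  computable f -> computable (fun x => sumn (f x)).
Proof. by move=> hf; apply: computable_foldr => //; comp;
  apply: computable_addn; comp. Qed.

Lemma computable_leq {X} {_ : code X} (f g : X -> nat) :
  computable f -> computable g -> computable (fun x => f x <= g x).
Proof.
move=> hf hg; apply: (computable_eqfun
  (f := fun x => nat_rect (fun=> bool) true (fun _ _ => false) (f x - g x))).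
  by move=> x; rewrite /leq; case: (f x - g x).
by comp; apply: computable_subn.
Qed.

Lemma computable_eq {X} {_ : code X} {T : eqType} {_ : code T} {_ :
  injective_code T} (f g : X -> T) :
  computable f -> computable g -> computable (fun x => f x == g x).
Proof.
move=> hf hg; apply: (computable_eqfun
  (f := fun x => (cd (f x) <= cd (g x)) && (cd (g x) <= cd (f x)))).
  move=> x; rewrite -eqn_leq; apply/eqP/eqP => [e|-> //].
  exact: (cd_inj e).
by apply: computable_andb; apply: computable_leq; apply: computable_cd.
Qed.

Lemma computable_mem {X} {_ : code X} {T : eqType} {_ : code T} {_ :
  injective_code T} (f : X -> T) l :
  computable f -> computable l -> computable (fun x => f x \in (l x : seq T)).
Proof.
move=> hf hl; apply: (computable_eqfun (f :=
  fun x => has (fun y => y == f x) (l x))).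
  by move=> x; rewrite has_pred1.
apply: computable_has => //; apply: computable_eq; comp.
exact: (computable_weaken hf).
Qed.

Lemma computable_index {X} {_ : code X} {T : eqType} {_ : code T} {_ :
  injective_code T} (f : X -> T) l :
  computable f -> computable l -> computable (fun x => index (f x) (l x)).
Proof.
move=> hf hl; apply: (computable_eqfun (f :=
  fun x => find (fun y => y == f x) (l x))).
  by move=> x; rewrite /index; apply: eq_find.
apply: computable_find => //; apply: computable_eq; comp.
exact: (computable_weaken hf).
Qed.

Lemma computable_head {X} {_ : code X} {T} {_ : code T} (d : X -> T) l :
  computable d -> computable l -> computable (fun x => head (d x) (l x)).
Proof.
move=> hd hl; apply: (computable_eqfun (f :=
  fun x => foldr (fun a _ => a) (d x) (l x))).
  by move=> x; case: (l x).
by apply: computable_foldr; comp.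
Qed.

Lemma computable_drop {X} {_ : code X} {T} {_ : code T} (i : X -> nat) (l : X
  -> seq T) :
  computable i -> computable l -> computable (fun x => drop (i x) (l x)).
Proof.
move=> hi hl; apply: (computable_eqfun (f := fun x => iter (i x) behead (l x))).
  move=> x; elim: (i x) (l x) => [|k IHk] s; first by rewrite drop0.
  by rewrite iterSr IHk; case: s.
by comp.
Qed.

Lemma computable_take {X} {_ : code X} {T} {_ : code T} (i : X -> nat) (l : X
  -> seq T) :
  computable i -> computable l -> computable (fun x => take (i x) (l x)).
Proof.
move=> hi hl; apply: (computable_eqfun
   (f := fun x => rev (drop (size (l x) - i x) (rev (l x))))).
  move=> x; rewrite drop_rev revK; case: (leqP (i x) (size (l x))) => il.
    by rewrite subKn.
  by move/ltnW: il => il; rewrite (eqP il) subn0 take_size take_oversize.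
apply: computable_rev; apply: computable_drop; last exact: computable_rev.
by apply: computable_subn => //; apply: computable_size.
Qed.

Lemma computable_nth {X} {_ : code X} {T} {_ : code T} (d : X -> T) l i :
  computable d -> computable l -> computable i ->
  computable (fun x => nth (d x) (l x) (i x)).
Proof.
move=> hd hl hi; apply: (computable_eqfun (f :=
  fun x => head (d x) (drop (i x) (l x)))).
  by move=> x; rewrite -nth0 nth_drop addn0.
by apply: computable_head => //; apply: computable_drop.
Qed.

Lemma computable_iota0 {X} {_ : code X} (m : X -> nat) :
  computable m -> computable (fun x => iota 0 (m x)).
Proof.
move=> hm; apply: (computable_eqfun
  (f := fun x => nat_rect (fun=> seq nat) [::] (fun i s => s ++ [:: i]) (m x))).
  move=> x; elim: (m x) => // i IHi.
  by rewrite -[in RHS]addn1 iotaD /= IHi.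
by comp; apply: computable_cat; comp.
Qed.

Ltac comp_lists := lazymatch goal with
  | |- computable (fun _ => rev _) => simple apply computable_rev
  | |- computable (fun _ => foldr _ _ _) => simple apply computable_foldr
  | |- computable (fun _ => _ ++ _) => simple apply computable_cat
  | |- computable (fun _ => flatten _) => simple apply computable_flatten
  | |- computable (fun _ => map _ _) => simple apply computable_map
  | |- computable (fun _ => filter _ _) => simple apply computable_filter
  | |- computable (fun _ => ~~ _) => simple apply computable_negb
  | |- computable (fun _ => _ && _) => simple apply computable_andb
  | |- computable (fun _ => _ || _) => simple apply computable_orb
  | |- computable (fun _ => _ ==> _) => simple apply computable_implb
  | |- computable (fun _ => all _ _) => simple apply computable_all
  | |- computable (fun _ => has _ _) => simple apply computable_has
  | |- computable (fun _ => find _ _) => simple apply computable_find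
  | |- computable (fun _ => size _) => simple apply computable_size
  | |- computable (fun _ => _ + _) => simple apply computable_addn
  | |- computable (fun _ => _ - _) => simple apply computable_subn
  | |- computable (fun _ => sumn _) => simple apply computable_sumn
  | |- computable (fun _ => _ <= _) => simple apply computable_leq
  | |- computable (fun _ => _ == _) => simple apply computable_eq
  | |- computable (fun _ => _ \in _) => simple apply computable_mem
  | |- computable (fun _ => index _ _) => simple apply computable_index
  | |- computable (fun _ => head _ _) => simple apply computable_head
  | |- computable (fun _ => drop _ _) => simple apply computable_drop
  | |- computable (fun _ => take _ _) => simple apply computable_take
  | |- computable (fun _ => nth _ _ _) => simple apply computable_nth
  | |- computable (fun _ => iota 0 _) => simple apply computable_iota0
  end.
(** A hook, redefined after each layer of definitions by a tactic that falls back on the previous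
    one; [comp] then treats these definitions as primitives and never unfolds them. *)
Ltac comp_defs := fail.
Ltac comp_user ::= first [comp_lists | comp_defs].

Lemma search_program {X U} {_ : code X} {_ : code U} (pk : recfun)
    (chk : X -> nat -> bool) (out : X -> nat -> U) :
  computable (fun p : X * nat => chk p.1 p.2) ->
  computable (fun p : X * nat => out p.1 p.2) ->
  exists P, forall x v, eval pk v (cd x) -> (exists w, chk x w) ->
    exists2 w, chk x w & eval P v (cd (out x w)).
Proof.
move=> hchk [po ho]; have [pc hc] := computable_negb hchk.
have [pp hp] : recursive 2 (fun v => ccons (nth 0 v 1) (ccons (nth 0 v 0) 0)).
  have cc f g : recursive 2 f -> recursive 2 g ->
      recursive 2 (fun v => ccons (f v) (g v)).
    exact: (recursive_comp2 recursive_ccons).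
  by apply: (cc _ _ _ (cc _ _ _ _));
    first [exact: recursive_proj | exact: recursive_const].
pose mu := RMu (RComp pc (RCons pp RNil)).
pose fin := RComp po (RCons (RComp pp (RCons mu (RCons (RProj 0) RNil))) RNil).
exists (RComp fin (RCons pk RNil)) => x v ev ex.
have pairE z : eval pp [:: z; cd x] (cd (x, z)) by exact: (hp [:: z; cd x] erefl).
have chkE z : eval (RComp pc (RCons pp RNil)) [:: z; cd x] (~~ chk x z).
  exact: EComp (ECons (pairE z) (ENil _)) (hc (x, z)).
case: (ex_minnP ex) => w hw minw; exists w => //.
have muE : eval mu [:: cd x] w.
  apply: EMu => [|z zw]; first by have := chkE w; rewrite hw.
  exists 0; have := chkE z; case: (boolP (chk x z)) => // /minw.
  by rewrite leqNgt zw.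
apply: (@EComp _ _ _ [:: cd x]); first exact: ECons ev (ENil _).
apply: (@EComp _ _ _ [:: cd (x, w)]); last exact: ho (x, w).
apply: ECons _ (ENil _); apply: EComp (pairE w).
exact: ECons muE (ECons (EProj _) (ENil _)).
Qed.

Lemma pack2_program {A B} {_ : code A} {_ : code B} :
  exists pk, forall (a : A) (b : B), eval pk [:: cd a; cd b] (cd (a, b)).
Proof.
have [pp hp] : recursive 2 (fun v => ccons (nth 0 v 0) (ccons (nth 0 v 1) 0)).
  have cc f g : recursive 2 f -> recursive 2 g ->
      recursive 2 (fun v => ccons (f v) (g v)).
    exact: (recursive_comp2 recursive_ccons).
  by apply: (cc _ _ _ (cc _ _ _ _));
    first [exact: recursive_proj | exact: recursive_const].
by exists pp => a b; exact: (hp [:: cd a; cd b] erefl).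
Qed.

Lemma pack3_program {A B C} {_ : code A} {_ : code B} {_ : code C} :
  exists pk, forall (a : A) (b : B) (c : C),
    eval pk [:: cd a; cd b; cd c] (cd (a, b, c)).
Proof.
have [pp hp] : recursive 3 (fun v => ccons (ccons (nth 0 v 0) (ccons (nth 0 v 1) 0))
    (ccons (nth 0 v 2) 0)).
  have cc f g : recursive 3 f -> recursive 3 g ->
      recursive 3 (fun v => ccons (f v) (g v)).
    exact: (recursive_comp2 recursive_ccons).
  by apply: (cc _ _ (cc _ _ _ (cc _ _ _ _)) (cc _ _ _ _));
    first [exact: recursive_proj | exact: recursive_const].
by exists pp => a b c; exact: (hp [:: cd a; cd b; cd c] erefl).
Qed.

(** [ccons] is the step of [CodeSeq.code], so both codings of lists agree once they agree on the
    entries. *)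
Lemma encode_seq {T : countType} {_ : code T} :
  (forall x : T, encode x = cd x) -> forall s : seq T, encode s = cd s.
Proof.
move=> eT s; rewrite /encode /choice.pickle /=.
by elim: s => //= a s IHs; congr (ccons _ _).
Qed.

Lemma encode_prod {T U : countType} {_ : code T} {_ : code U} :
  (forall x : T, encode x = cd x) -> (forall x : U, encode x = cd x) ->
  forall p : T * U, encode p = cd p.
Proof.
move=> eT eU [a b]; rewrite /encode /=.
rewrite -[cd (a, b)]/(ccons (cd a) (ccons (cd b) 0)) -eT -eU.
by [].
Qed.

Lemma encode_nat (m : nat) : encode m = cd m.
Proof. by []. Qed.

Definition words {A} (s : seq A) (k : nat) : seq (seq A) :=
  iter k (fun acc => flatten [seq [seq a :: w | w <- acc] | a <- s]) [:: [::]].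

Lemma computable_words {X A} {_ : code X} {_ : code A} (s : X -> seq A) k :
  computable s -> computable k -> computable (fun x => words (s x) (k x)).
Proof. by move=> hs hk; rewrite /words; comp; exact: (computable_weaken hs). Qed.

Local Open Scope nat_scope.

(** * Groups of tiles generated by shifts *)

Section Tiles.
Variables (n : nat) (G : groupType).
Implicit Types (f g h : tile n G) (a b c : 'X_{1..n}) (D : 'X_{1..n} -> Prop).

Lemma tile_1 a : (1%g : tile n G) a = 1%g.
Proof. exact: tile_oneE. Qed.

Lemma tile_M f g a : (f * g)%g a = (f a * g a)%g.
Proof. exact: tile_mulE. Qed.

Lemma tile_V f a : (f^-1)%g a = (f a)^-1%g.
Proof. exact: tile_invE. Qed.

Lemma tile_X f k a : (f ^+ k)%g a = (f a ^+ k)%g.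
Proof. by elim: k => [|k IHk]; rewrite ?expg0 ?tile_1 // !expgS tile_M IHk. Qed.

Lemma shift_add b f a : shift b f (a + b)%MM = f a.
Proof. by rewrite shiftE lem_addl addmK. Qed.

Lemma shift_supp b f a : shift b f a != 1%g ->
  exists2 c, a = (c + b)%MM & f c != 1%g.
Proof.
rewrite shiftE; case: ifP => [ba fab|_]; last by rewrite eqxx.
by exists (a - b)%MM; rewrite ?submK.
Qed.

Lemma shift_mul b f g : shift b (f * g)%g = (shift b f * shift b g)%g.
Proof.
apply/fsfunP => a; rewrite tile_M !shiftE tile_M; case: ifP => // _.
by rewrite mulg1.
Qed.

Lemma shift_1 b : shift b (1%g : tile n G) = 1%g.
Proof. by apply/fsfunP => a; rewrite shiftE !tile_1; case: ifP. Qed.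

Lemma shift_shift b c f : shift b (shift c f) = shift (b + c)%MM f.
Proof.
apply/fsfunP => a; rewrite !shiftE.
have -> : (b + c <= a)%MM = (b <= a)%MM && (c <= a - b)%MM.
  apply/mnm_lepP/andP => [h|[/mnm_lepP h1 /mnm_lepP h2] i].
    split; apply/mnm_lepP => i; have := h i; rewrite !mnmDE ?mnmBE; lia.
  by have := h1 i; have := h2 i; rewrite mnmBE mnmDE; lia.
by case: (b <= a)%MM => //=; rewrite submDA.
Qed.

Lemma shift0 f : shift 0%MM f = f.
Proof.
apply/fsfunP => a; rewrite shiftE subm0; case: ifP => // /mnm_lepP[] i.
by rewrite mnm0E.
Qed.

Lemma shift_inj b : injective (@shift n G b).
Proof.
by move=> f g e; apply/fsfunP => a; rewrite -(shift_add b f) e shift_add.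
Qed.

Definition within D f : Prop := forall a, f a != 1%g -> D a.

Lemma within_sub D D' f : (forall a, D a -> D' a) -> within D f -> within D' f.
Proof. by move=> DD' Df a /Df/DD'. Qed.

Lemma within_1 D : within D 1%g.
Proof. by move=> a; rewrite tile_1 eqxx. Qed.

Lemma within_M D f g : within D f -> within D g -> within D (f * g)%g.
Proof.
move=> Df Dg a; case: (eqVneq (f a) 1%g) => [fa|/Df //].
by rewrite tile_M fa mul1g => /Dg.
Qed.

Lemma within_V D f : within D f -> within D (f^-1)%g.
Proof. by move=> Df a; rewrite tile_V invg_eq1 => /Df. Qed.

Lemma within_shift D b f :
  within D (shift b f) <-> within (fun a => D (a + b)%MM) f.
Proof.
split=> [Df a fa|Df a /shift_supp[c -> /Df //]].
by apply: Df; rewrite shift_add.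
Qed.

(** Products without inverses: over a finite group inverses are powers, see [gen_V], and inductions
    need to treat only one kind of factor. *)
Inductive gen (A : tile n G -> Prop) : tile n G -> Prop :=
  | gen_1 : gen A 1%g
  | gen_cons x f : A x -> gen A f -> gen A (x * f)%g.

Lemma gen_base A x : A x -> gen A x.
Proof. by move=> Ax; rewrite -[x]mulg1; apply: gen_cons (gen_1 _). Qed.

Lemma gen_M A f g : gen A f -> gen A g -> gen A (f * g)%g.
Proof.
by move=> gf gg; elim: gf => [|x h Ax _ IH]; rewrite ?mul1g // -mulgA;
  apply: gen_cons.
Qed.

Lemma gen_X A f k : gen A f -> gen A (f ^+ k)%g.
Proof.
move=> gf; elim: k => [|k IHk]; rewrite ?expg0 ?expgS; first exact: gen_1.
exact: gen_M.
Qed.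

Lemma gen_bind (A B : tile n G -> Prop) f :
  (forall x, A x -> gen B x) -> gen A f -> gen B f.
Proof.
by move=> AB; elim=> [|x g /AB gx _ gg]; [apply: gen_1 | apply: gen_M].
Qed.

Lemma gen_sub (A B : tile n G -> Prop) f :
  (forall x, A x -> B x) -> gen A f -> gen B f.
Proof. by move=> AB; apply: gen_bind => x /AB; apply: gen_base. Qed.

Lemma gen_within A D f : (forall x, A x -> within D x) -> gen A f -> within D f.
Proof. by move=> AD; elim=> [|x g /AD Dx _];
  [apply: within_1 | apply: within_M]. Qed.

Definition shifts_in (F : tile n G -> Prop) D : tile n G -> Prop :=
  fun g => (exists j c, F j /\ g = shift c j) /\ within D g.

Lemma shifts_in_sub (F F' : tile n G -> Prop) D D' f :
  (forall j, F j -> F' j) -> (forall a, D a -> D' a) ->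
  gen (shifts_in F D) f -> gen (shifts_in F' D') f.
Proof.
move=> FF' DD'; apply: gen_sub => g [[j [c [/FF' Fj gE]]] Dg].
by split; [exists j, c | apply: within_sub Dg].
Qed.

Lemma shifts_in_within F D f : gen (shifts_in F D) f -> within D f.
Proof. by apply: gen_within => g []. Qed.

Lemma gen_shift F D b f : gen (shifts_in F D) f ->
  gen (shifts_in F (fun a => exists2 c, D c & a = (c + b)%MM)) (shift b f).
Proof.
elim=> [|x g [[j [c [Fj ->]]] Dx] _ IH]; first by rewrite shift_1; apply: gen_1.
rewrite shift_mul; apply: gen_cons IH; split.
  by exists j, (b + c)%MM; rewrite shift_shift.
by apply/within_shift => a /Dx Da; exists a.
Qed.

End Tiles.

Section FiniteTiles.
Variables (n : nat) (gT : finGroupType).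
Implicit Types (f g h : tile n gT) (a b c : 'X_{1..n}) (F : tile n gT -> Prop).

Lemma tile_invX f : (f^-1)%g = (f ^+ #|gT|.-1)%g.
Proof.
apply/fsfunP => a; rewrite tile_V tile_X; apply/eqP; rewrite eq_invg_mul -expgS.
rewrite prednK; last by apply/card_gt0P; exists 1%g.
by rewrite -cardsT expg_cardG ?inE.
Qed.

Lemma gen_V (A : tile n gT -> Prop) f : gen A f -> gen A (f^-1)%g.
Proof. by rewrite tile_invX; apply: gen_X. Qed.

Lemma span_gen F f : Defs.span F f <-> gen (shifts_in F (fun=> True)) f.
Proof.
split=> [spf|gf J [J1 JM _ Js] FJ]; last first.
  elim: gf => // x g [[j [c [Fj ->]]] _] _ Jg.
  by apply: JM => //; apply: Js; apply: FJ.
apply: spf => [|s Fs]; last first.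
  by apply: gen_base; split=> //; exists s, 0%MM; rewrite shift0.
split=> [|g h|g|b g]; [exact: gen_1 | exact: gen_M | exact: gen_V |].
by move=> /(gen_shift b); apply: shifts_in_sub.
Qed.

Lemma shift_subgroup_gen (J F : tile n gT -> Prop) D f :
  shift_subgroup J -> (forall j, F j -> J j) -> gen (shifts_in F D) f -> J f.
Proof.
move=> sJ FJ gf; apply: (proj2 (span_gen F f)) (sJ) FJ.
exact: shifts_in_sub gf.
Qed.

End FiniteTiles.

Definition inbox (n E : nat) (a : 'X_{1..n}) : bool := [forall i, a i <= E].

Lemma inboxP n E (a : 'X_{1..n}) : reflect (forall i, a i <= E) (inbox E a).
Proof. exact: forallP. Qed.

(** * Monomial orders and the criterion *)

Section MonomialOrder.
Variables (n : nat) (lt : rel 'X_{1..n}).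
Hypothesis hlt : monomial_order lt.
Implicit Types a b c : 'X_{1..n}.

Definition ordle a b := (a == b) || lt a b.

Lemma ord_irr a : lt a a = false.
Proof. by case: hlt. Qed.

Lemma ord_trans b a c : lt a b -> lt b c -> lt a c.
Proof. by case: hlt => _ t _ _ _; apply: t. Qed.

Lemma ordleNgt a b : ordle a b = ~~ lt b a.
Proof.
rewrite /ordle; case: hlt => _ _ tot _ _; case/or3P: (tot a b) => [ab|/eqP->|ba].
- rewrite ab orbT; apply/esym/negP => ba.
  by have := ord_trans ab ba; rewrite ord_irr.
- by rewrite eqxx ord_irr.
- rewrite ba; apply/negbTE/negP => /orP[/eqP ab|ab].
    by move: ba; rewrite ab ord_irr.
  by have := ord_trans ab ba; rewrite ord_irr.
Qed.

Lemma ord_le a b : lt a b -> ordle a b.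
Proof. by move=> ab; rewrite /ordle ab orbT. Qed.

Lemma ordle_refl a : ordle a a.
Proof. by rewrite /ordle eqxx. Qed.

Lemma ordle_lt_trans b a c : ordle a b -> lt b c -> lt a c.
Proof. by case/orP => [/eqP->|/ord_trans]; last apply. Qed.

Lemma ord_le_trans b a c : lt a b -> ordle b c -> lt a c.
Proof. by move=> ab /orP[/eqP<-|]; last exact: ord_trans. Qed.

Lemma ordle_trans b a c : ordle a b -> ordle b c -> ordle a c.
Proof. by case/orP => [/eqP->//|ab] bc; apply/ord_le/(ord_le_trans ab). Qed.

Lemma ordle_total a b : ordle a b || ordle b a.
Proof. by rewrite orbC [ordle b a]ordleNgt;
  case: (boolP (lt a b)) => //= /ord_le. Qed.

Lemma ord_add c a b : lt (a + c)%MM (b + c)%MM = lt a b.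
Proof.
have add x y : lt x y -> lt (x + c)%MM (y + c)%MM by case: hlt => _ _ _ _; apply.
apply/idP/idP => [abc|/add //]; rewrite -[lt a b]negbK -ordleNgt.
apply/negP => /orP[/eqP e|/add bac]; first by move: abc; rewrite e ord_irr.
by have := ord_trans abc bac; rewrite ord_irr.
Qed.

Lemma ordle_add c a b : ordle (a + c)%MM (b + c)%MM = ordle a b.
Proof. by rewrite !ordleNgt ord_add. Qed.

Lemma ord_wf : well_founded (fun a b => lt a b).
Proof. by case: hlt. Qed.

(** If [c] were below 0, adding [c] again and again would give an infinite descent from any
    monomial. *)
Lemma ordle_0 c : ordle 0%MM c.
Proof.
rewrite ordleNgt; apply/negP => c0.
suff: forall a : 'X_{1..n}, False by apply; exact: 0%MM.
apply: (well_founded_ind ord_wf) => a IH; apply: (IH (c + a)%MM).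
by rewrite -[X in lt _ X]add0m ord_add.
Qed.

Lemma ordle_addl a c : ordle a (c + a)%MM.
Proof. by rewrite -[X in ordle X _]add0m ordle_add ordle_0. Qed.

Lemma ord_addl a c : c != 0%MM -> lt a (c + a)%MM.
Proof.
move=> c0; have /orP[/eqP|//] := ordle_addl a c.
by rewrite -[X in X = _]add0m => /addIm e; rewrite -e eqxx in c0.
Qed.

Lemma tile_top (G : groupType) (f : tile n G) :
  f = 1%g \/ exists2 a, f a != 1%g & within (fun b => ordle b a) f.
Proof.
suff [s0|[a as_ ha]] : finsupp f = [::] :> seq _ \/
    exists2 a, a \in finsupp f & forall b, b \in finsupp f -> ordle b a.
- left; apply/fsfunP => a; rewrite tile_1; apply/eqP; rewrite -[_ == _]negbK.
  by rewrite -[_ != _]mem_finsupp; apply/negP => h;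
    have : a \in (finsupp f : seq _) by []; rewrite s0.
- by right; exists a; [rewrite -mem_finsupp | move=> b; rewrite -mem_finsupp;
    apply: ha].
have : forall s : seq 'X_{1..n}, s = [::] \/
    exists2 a, a \in s & forall b, b \in s -> ordle b a; last exact.
elim=> [|a s [->|[m ms hm]]]; [by left | right | right].
  by exists a; rewrite ?mem_head // => b; rewrite inE => /eqP->; apply: ordle_refl.
have /orP[am|ma] := ordle_total a m.
  by exists m => [|b]; rewrite inE ?ms ?orbT // => /orP[/eqP->|/hm].
exists a; rewrite ?mem_head // => b; rewrite inE => /orP[/eqP->|/hm bm].
  exact: ordle_refl.
exact: ordle_trans bm ma.
Qed.

End MonomialOrder.

(* The standard basis property without leading terms: no cancellation above the
   top of [f] is needed to write it as a product of shifts of [F]. *)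
Definition reducing n (gT : finGroupType) (lt : rel 'X_{1..n})
    (F : tile n gT -> Prop) : Prop :=
  forall f a, gen (shifts_in F (fun=> True)) f ->
    within (fun b => ordle lt b a) f ->
    gen (shifts_in F (fun b => ordle lt b a)) f.

Section Criterion.
Variables (n : nat) (gT : finGroupType) (lt : rel 'X_{1..n}).
Hypothesis hlt : monomial_order lt.
Variables (F L : tile n gT -> Prop) (E : nat).
Implicit Types (f g h x : tile n gT) (a b c : 'X_{1..n}).
Notation le := (ordle lt).
Hypothesis F_box : forall j, F j -> within (inbox E) j.
Hypothesis L_1 : L 1%g.
Hypothesis L_M : forall x y, L x -> L y -> L (x * y)%g.
Hypothesis L_shift : forall j c, F j -> inbox E c -> L (shift c j).
Hypothesis L_lt : forall h a, L h -> within (fun b => lt b a) h ->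
  gen (shifts_in F (fun b => lt b a)) h.

Notation Ile a := (gen (shifts_in F (fun b => le b a))).
Notation Ilt a := (gen (shifts_in F (fun b => lt b a))).
(** The statement of the induction: when the values at [a] cancel in a product, the product can be
    rewritten with factors that stay below [a]. *)
Let P a := forall f, Ile a f -> within (fun b => lt b a) f -> Ilt a f.

Let L_V x : L x -> L (x^-1)%g.
Proof.
move=> Lx; rewrite tile_invX; elim: _.-1 => [|k IHk]; first by rewrite expg0.
by rewrite expgS; apply: L_M.
Qed.

Let Ilt_shift a d f : Ilt a f -> Ilt (a + d)%MM (shift d f).
Proof.
move=> /(gen_shift d); apply: shifts_in_sub => // _ [c ca ->].
by rewrite (ord_add hlt).
Qed.

Let within_conj (D : 'X_{1..n} -> Prop) f g : within D g -> within D (f * g *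
  f^-1)%g.
Proof.
move=> Dg a; rewrite !tile_M tile_V => h; apply: Dg; apply: contra_neq h => ->.
by rewrite mulg1 mulgV.
Qed.

Let disjoint_conj f g : (forall a, f a = 1%g \/ g a = 1%g) -> (f * g * f^-1)%g = g.
Proof.
move=> fg; apply/fsfunP => a; rewrite !tile_M tile_V.
by case: (fg a) => ->; rewrite ?invg1 ?mul1g ?mulg1 // mulgV.
Qed.

Let far c b i j k : F j -> F k -> E < c i -> b i = 0 ->
  forall a, shift c j a = 1%g \/ shift b k a = 1%g.
Proof.
move=> Fj Fk Ec b0 a;
  case: (eqVneq (shift c j a) 1%g) => [|/shift_supp[a1 e1 _]]; first by left.
case: (eqVneq (shift b k a) 1%g) => [|/shift_supp[a2 e2 ka]]; first by right.
have /inboxP/(_ i) := F_box Fk ka.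
by move: (congr1 (fun m : 'X_{1..n} => m i) (etrans (esym e1) e2));
  rewrite !mnmDE; lia.
Qed.

(* If both shifts move along a common variable, the conjugation happens already
   at a smaller index; if one shift leaves the box in a direction the other one
   does not move, then the supports are disjoint; otherwise it happens in [L]. *)
Let conj_shifts a u g : (forall b, lt b a -> P b) ->
  shifts_in F (fun b => le b a) u -> shifts_in F (fun b => lt b a) g ->
  Ilt a (u * g * u^-1)%g.
Proof.
move=> IH [[j [c [Fj uE]]] leu] [[k [b [Fk gE]]] ltg].
have gg : Ilt a g by apply: gen_base; split=> //; exists k, b.
case: (eqVneq (u a) 1%g) => [ua1|ua].
  have gu : Ilt a u.
    apply: gen_base; split; first by exists j, c.
    move=> m um; have /orP[/eqP me|//] := leu m um.
    by rewrite me ua1 eqxx in um.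
  by apply: gen_M; [apply: gen_M | apply: gen_V].
have [m aE jm] : exists2 m, a = (m + c)%MM & j m != 1%g.
  by apply: shift_supp; rewrite -uE.
case: (boolP [exists i,
  (0 < c i) && (0 < b i)]) => [/existsP[i /andP[ci bi]]|/existsPn cb0].
  have cE : (c - U_(i) + U_(i))%MM = c by rewrite submK // lep1mP -lt0n.
  have bE : (b - U_(i) + U_(i))%MM = b by rewrite submK // lep1mP -lt0n.
  pose a' := (m + (c - U_(i)))%MM.
  have a'E : a = (a' + U_(i))%MM by rewrite aE /a' -addmA cE.
  have lta : lt a' a by rewrite a'E addmC (ord_addl hlt) // mnm1_eq0.
  have uE' : u = shift U_(i) (shift (c - U_(i)) j) by rewrite shift_shift addmC cE.
  have gE' : g = shift U_(i) (shift (b - U_(i)) k) by rewrite shift_shift addmC bE.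
  have leu' : within (fun b => le b a') (shift (c - U_(i)) j).
    move: leu; rewrite uE' => /within_shift; apply: within_sub => d.
    by rewrite a'E (ordle_add hlt).
  have ltg' : within (fun b => lt b a') (shift (b - U_(i)) k).
    move: ltg; rewrite gE' => /within_shift; apply: within_sub => d.
    by rewrite a'E (ord_add hlt).
  have gu' : Ile a' (shift (c - U_(i)) j).
    by apply: gen_base; split=> //; exists j, (c - U_(i))%MM.
  have gg' : Ile a' (shift (b - U_(i)) k).
    apply: gen_base; split; first by exists k, (b - U_(i))%MM.
    by apply: within_sub ltg' => d; apply: ord_le.
  set u' := shift _ j in uE' leu' gu'; set g' := shift _ k in gE' ltg' gg'.
  have -> : (u * g * u^-1)%g = shift U_(i) (u' * g' * u'^-1)%g.
    by rewrite !tile_invX uE' gE' !shift_mul; congr (_ * _)%g;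
      elim: _.-1 => [|r IHr]; rewrite ?expg0 ?shift_1 // !expgS shift_mul IHr.
  rewrite a'E; apply: Ilt_shift; apply: IH => //; last exact: within_conj.
  by apply: gen_M; [apply: gen_M | apply: gen_V].
have cb i : 0 < c i -> b i = 0.
  by move=> ci; have := cb0 i; rewrite ci /= lt0n negbK => /eqP.
case: (boolP (inbox E c)) => [cE|/forallPn[i]]; last first.
  rewrite -ltnNge => ci; rewrite disjoint_conj // uE gE.
  by apply: (far Fj Fk ci); apply: cb; apply: leq_ltn_trans ci.
case: (boolP (inbox E b)) => [bE|/forallPn[i]]; last first.
  rewrite -ltnNge => bi; rewrite disjoint_conj // uE gE => d.
  suff: shift b k d = 1%g \/ shift c j d = 1%g by case; [right|left].
  apply: (far Fk Fj bi); apply/eqP; rewrite -leqn0 leqNgt; apply/negP => /cb b0.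
  by rewrite b0 in bi.
apply: L_lt; last exact: within_conj.
by apply: L_M; [apply: L_M | apply: L_V]; rewrite ?uE ?gE; apply: L_shift.
Qed.

(** Every shift of [F] that is nontrivial at [a] has this form. Recording only the position [m] of
    [a] relative to the shift, and not the value there, is enough to bound [c] from below. *)
Let top a x := exists j c m, [/\ F j, x = shift c j, a = (m + c)%MM & inbox E m].

(** The factors that are trivial at [a] are collected on the left, which is possible because the
    others normalize the group [Ilt a]. *)
Let split_top a f : (forall b, lt b a -> P b) -> Ile a f ->
  exists r v, [/\ f = (r * v)%g, Ilt a r & gen (top a) v].
Proof.
move=> IH; elim=> [|u g hu _ [r [v [-> hr hv]]]].
  by exists 1%g, 1%g; split; rewrite ?mulg1 //; apply: gen_1.
case: (eqVneq (u a) 1%g) => [ua1|ua].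
  exists (u * r)%g, v; split; rewrite ?mulgA //; apply: gen_cons hr.
  case: hu => hu leu; split=> // m um; have /orP[/eqP me|//] := leu m um.
  by rewrite me ua1 eqxx in um.
(* The new factor passes [r] by conjugation: [u * (r * v) = (u * r * u^-1) * (u * v)]. *)
exists (u * r * u^-1)%g, (u * v)%g; split.
- by rewrite !mulgA mulgKV.
- elim: hr => [|x r' hx _ IHr]; first by rewrite mulg1 mulgV; apply: gen_1.
  have -> : (u * (x * r') * u^-1)%g = (u * x * u^-1 * (u * r' * u^-1))%g.
    by rewrite !mulgA mulgKV.
  by apply: gen_M IHr; apply: conj_shifts.
- apply: gen_cons hv; case: hu => -[j [c [Fj uE]]] _.
  have [m aE jm] : exists2 m, a = (m + c)%MM & j m != 1%g.
    by apply: shift_supp; rewrite -uE.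
  by exists j, c, m; split=> //; apply: F_box jm.
Qed.

(** [a - l] is the largest shift common to all tops at [a]: a position [m] in the box with [m <= a]
    satisfies [m <= l]. The remaining shift [l - m] stays in the box, so each factor comes from
    [L]. *)
Let top_shift a v : gen (top a) v -> 
  let l := [multinom minn (a i) E | i < n] in
  exists2 v', v = shift (a - l)%MM v' & L v'.
Proof.
move=> hv l; elim: hv => [|x g [j [c [m [Fj -> aE mE]]]] _ [v' -> Lv']].
  by exists 1%g; rewrite ?shift_1.
exists (shift (l - m)%MM j * v')%g; last first.
  apply: L_M => //; apply: L_shift => //; apply/inboxP => i.
  by rewrite mnmBE mnmE; lia.
rewrite shift_mul shift_shift; congr (shift _ _ * _)%g.
apply/mnmP => i; rewrite mnmDE !mnmBE mnmE.
by have /inboxP/(_ i) := mE; rewrite aE mnmDE; lia.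
Qed.

Let descent a : P a.
Proof.
elim/(well_founded_ind (ord_wf hlt)): a => a IH f hf ltf.
have [r [v [fE hr hv]]] := split_top IH hf.
suff: Ilt a v by rewrite fE; apply: gen_M.
have [v' vE Lv'] := top_shift hv.
set l := [multinom _ | i < n] in vE.
have la : (l + (a - l))%MM = a.
  by rewrite addmC submK //; apply/mnm_lepP => i; rewrite mnmE geq_minl.
(* The values of the top factors cancel at [a], since neither [f] nor [r] reaches [a]. This is the
   situation of [L_lt], at the index [l] instead of [a]. *)
have ltv : within (fun b => lt b a) v.
  have -> : v = (r^-1 * f)%g by rewrite fE mulKg.
  by apply: within_M => //; apply: within_V; apply: shifts_in_within hr.
rewrite -la vE; apply: Ilt_shift; apply: L_lt => //.
move: ltv; rewrite vE => /within_shift; apply: within_sub => d.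
by rewrite -{2}la (ord_add hlt).
Qed.

Theorem criterion : reducing lt F.
Proof.
have Ile_sub b a f : le b a -> Ile b f -> Ile a f.
  by move=> ba; apply: shifts_in_sub => // c /(ordle_trans hlt); apply.
(* A product has finitely many factors, so their tops have a maximum, and it is strictly below
   [a]. *)
have Ilt_le a f : Ilt a f -> f = 1%g \/ exists2 b, lt b a & Ile b f.
  elim=> [|x g [[j [c [Fj ->]]] ltx] _ IH]; first by left.
  case: (tile_top hlt (shift c j)) => [->|[d fd led]]; first by rewrite mul1g.
  have hx : Ile d (shift c j) by apply: gen_base; split=> //; exists j, c.
  right; case: IH => [->|[b ba gb]]; first by exists d;
    [exact: ltx | rewrite mulg1].
  have /orP[bd|db] := ordle_total hlt b d.
    by exists d; [exact: ltx | apply: gen_M => //; apply: Ile_sub gb].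
  by exists b => //; apply: gen_M => //; apply: Ile_sub hx.
have bounded f : gen (shifts_in F (fun=> True)) f -> f = 1%g \/ exists a, Ile a f.
  elim=> [|x g [[j [c [Fj ->]]] _] _ IH]; first by left.
  case: (tile_top hlt (shift c j)) => [->|[d fd led]]; first by rewrite mul1g.
  have hx : Ile d (shift c j) by apply: gen_base; split=> //; exists j, c.
  right; case: IH => [->|[b gb]]; first by exists d; rewrite mulg1.
  have /orP[bd|db] := ordle_total hlt b d.
    by exists d; apply: gen_M => //; apply: Ile_sub gb.
  by exists b; apply: gen_M => //; apply: Ile_sub hx.
move=> f a /bounded[->|[b]]; first by move=> _; apply: gen_1.
(* As long as the bound [b] of the factors exceeds [a], the product is trivial at [b], and [descent]
   lowers the bound. *)
elim/(well_founded_ind (ord_wf hlt)): b => b IH gb lef.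
case: (boolP (le b a)) => [/Ile_sub|]; first exact.
rewrite (ordleNgt hlt) negbK => ab.
have /Ilt_le[->|[d db gd]] : Ilt b f.
- by apply: descent gb _; apply: within_sub lef => d /(ordle_lt_trans hlt); apply.
- exact: gen_1.
- exact: IH db gd lef.
Qed.

End Criterion.

(** * Finite bases and compactness *)

Lemma uniform_bound (T : eqType) (s : seq T) (Q : nat -> T -> Prop) :
  (forall m m' x, m <= m' -> Q m x -> Q m' x) ->
  (forall x, x \in s -> exists m, Q m x) ->
  exists m, forall x, x \in s -> Q m x.
Proof.
move=> mono; elim: s => [|x s IHs] ex; first by exists 0.
have [m hm] : exists m, forall y, y \in s -> Q m y.
  by apply: IHs => y ys; apply: ex; rewrite inE ys orbT.
have [m' hm'] := ex x (mem_head _ _).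
exists (maxn m m') => y; rewrite inE => /orP[/eqP->|/hm].
  by apply: mono hm'; apply: leq_maxr.
by apply: mono; apply: leq_maxl.
Qed.

Lemma classical_filter (T : eqType) (s : seq T) (P : T -> Prop) :
  exists t : seq T, forall x, x \in t <-> x \in s /\ P x.
Proof.
elim: s => [|y s [t ht]]; first by exists [::] => x; split=> [|[]].
have [Py|nPy] := classic (P y); last first.
  exists t => x; rewrite inE; split=> [/ht[xs Px]|[/orP[/eqP->//|xs] Px]].
    by rewrite xs orbT.
  exact/ht.
exists (y :: t) => x; rewrite !inE; split=> [/orP[/eqP->|/ht[-> //]]|].
- by rewrite eqxx.
- by rewrite orbT.
- by case=> /orP[->//|xs] Px; apply/orP; right; apply/ht.
Qed.

Lemma dickson n (P : 'X_{1..n} -> Prop) :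
  exists2 s : seq 'X_{1..n}, forall b, b \in s -> P b &
    forall a, P a -> exists2 b, b \in s & (b <= a)%MM.
Proof.
(* Induction on the number of coordinates that are compared, for all predicates at once. *)
suff H k : k <= n -> forall Q : 'X_{1..n} -> Prop,
    exists2 s : seq 'X_{1..n}, forall b, b \in s -> Q b &
    forall a, Q a -> exists2 b, b \in s & forall i : 'I_n, i < k -> b i <= a i.
  have [s sP hs] := H n (leqnn n) P; exists s => // a /hs[b bs ba].
  by exists b => //; apply/mnm_lepP => i; apply: ba.
elim: k => [_|k IHk kn] Q.
  have [[a Qa]|nQ] := classic (exists a, Q a); last by exists [::] => // a Qa;
    case: nQ; exists a.
  by exists [:: a] => [b|b _]; [rewrite inE => /eqP-> | exists a; rewrite ?inE].
have [s sQ hs] := IHk (ltnW kn) Q; pose ik := Ordinal kn.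
pose M := \max_(b <- s) b ik.
(* The list [s] already covers the monomials whose coordinate [k] is at least [M]. The others lie in
   [M] slices of constant coordinate, and the induction hypothesis covers each slice. *)
have [t tQ ht] : exists2 t : seq 'X_{1..n}, forall b, b \in t -> Q b &
    forall a, Q a -> a ik < M ->
      exists2 b, b \in t & forall i : 'I_n, i < k.+1 -> b i <= a i.
  elim: M {hs} => [|M [t tQ ht]]; first by exists [::].
  have [u uQ hu] := IHk (ltnW kn) (fun a => Q a /\ a ik = M).
  exists (t ++ u) => [b|a Qa]; first by rewrite mem_cat => /orP[/tQ|/uQ[]].
  rewrite ltnS leq_eqVlt => /orP[/eqP aM|/(ht a Qa)[b bt ba]]; last first.
    by exists b; rewrite // mem_cat bt.
  have [b bu ba] := hu a (conj Qa aM).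
  exists b => [|i]; first by rewrite mem_cat bu orbT.
  rewrite ltnS leq_eqVlt => /orP[/eqP ie|/ba //].
  by have -> : i = ik by [apply: val_inj]; rewrite aM; case: (uQ b bu) => _ ->.
exists (s ++ t) => [b|a Qa]; first by rewrite mem_cat => /orP[/sQ|/tQ].
have [aM|Ma] := ltnP (a ik) M.
  by have [b bt ba] := ht a Qa aM; exists b; rewrite // mem_cat bt orbT.
have [b bs ba] := hs a Qa; exists b => [|i]; first by rewrite mem_cat bs.
rewrite ltnS leq_eqVlt => /orP[/eqP ie|/ba //].
have -> : i = ik by apply: val_inj.
by apply: leq_trans Ma; rewrite /M (big_rem b bs) leq_maxl.
Qed.

Section FiniteBasis.
Variables (n : nat) (gT : finGroupType).
Implicit Types (f g h : tile n gT) (I : tile n gT -> Prop).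

Lemma within_box_le (E E' : nat) f :
  E <= E' -> within (inbox E) f -> within (inbox E') f.
Proof.
by move=> EE'; apply: within_sub => a /inboxP h; apply/inboxP => i;
  apply: leq_trans EE'.
Qed.

Lemma box_bound f : exists E, within (inbox E) f.
Proof.
have [E hE] : exists E, forall a, a \in finsupp f -> inbox E a.
  apply: (@uniform_bound _ (finsupp f : seq _) (fun E a => inbox E a)).
    by move=> m m' a mm' /inboxP h; apply/inboxP => i; apply: leq_trans mm'.
  move=> a _; exists (mdeg a); apply/inboxP => i.
  by rewrite mdegE (bigD1 i) //= leq_addr.
by exists E => a fa; apply: hE; rewrite mem_finsupp.
Qed.

(** A tile of I with the same top value at a divisor of the top cancels it exactly. The values are
    treated separately because nothing relates two tops with different values. *)
Lemma finite_basis I (lt : rel 'X_{1..n}) :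
  shift_subgroup I -> monomial_order lt ->
  exists E, forall f a, I f -> within (fun b => ordle lt b a) f ->
    gen (shifts_in (fun j => I j /\ within (inbox E) j)
                   (fun b => ordle lt b a)) f.
Proof.
move=> [I1 IM IV Is] hlt.
pose lead E (x : gT) a := exists f, [/\ I f, f a = x,
  within (fun b => ordle lt b a) f & within (inbox E) f].
have [E hE] : exists E, forall x : gT, x \in enum gT -> forall a f,
  x != 1%g -> I f ->
    f a = x -> within (fun b => ordle lt b a) f ->
    exists2 b, (b <= a)%MM & lead E x b.
  apply: uniform_bound => [m m' g mm' h a f g1 If fa lef|g _].
    have [b ba [j [Ij jb lej bj]]] := h a f g1 If fa lef.
    by exists b => //; exists j; split=> //; apply: within_box_le bj.
  have [s sP hs] := dickson (fun a => exists f, [/\ I f, f a = g &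
    within (fun b => ordle lt b a) f]).
  have [E hE] : exists E, forall b, b \in s -> lead E g b.
    apply: uniform_bound => [m m' b mm' [j [Ij jb lej bj]]|b /sP[f [If fb lef]]].
      by exists j; split=> //; apply: within_box_le bj.
    by have [E bf] := box_bound f; exists E, f.
  exists E => a f g1 If fa lef; have [|b /hE lb ba] := hs a; first by exists f.
  by exists b.
exists E; set F := (fun j => _); move=> f a.
elim/(well_founded_ind (ord_wf hlt)): a f => a IH f If lef.
case: (eqVneq (f a) 1%g) => [fa|fa]; last first.
  have [|b ba [j [Ij jb lej bj]]] := hE (f a) _ a f fa If erefl lef.
    by rewrite mem_enum.
  pose x := shift (a - b)%MM j.
  have ab : (b + (a - b))%MM = a by rewrite addmC submK.
  have xa : x a = f a by rewrite -{1}ab shift_add.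
  have lex : within (fun c => ordle lt c a) x.
    apply/within_shift; apply: within_sub lej => c cb.
    by rewrite -{2}ab (ordle_add hlt).
  have -> : f = (x * (x^-1 * f))%g by rewrite mulKVg.
  apply: gen_cons; first by split=> //; exists j, (a - b)%MM.
  have lt' : within (fun c => lt c a) (x^-1 * f)%g.
    move=> c hc; have : ordle lt c a.
      by have := within_M (within_V lex) lef; apply.
    case/orP => // /eqP ca; move: hc.
    by rewrite ca tile_M tile_V xa mulVg eqxx.
  case: (tile_top hlt (x^-1 * f)%g) => [->|[d /lt' da led]]; first exact: gen_1.
  have If' : I (x^-1 * f)%g by apply: IM => //; apply: IV; apply: Is.
  have := IH d da _ If' led; apply: shifts_in_sub => // c /ordle_lt_trans.
  by move/(_ hlt _ da)/ord_le.
(* Here [a] bounds the support without belonging to it, so the induction hypothesis is used at the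
   true top. *)
case: (tile_top hlt f) => [->|[d fd led]]; first exact: gen_1.
have da : lt d a.
  by have /orP[/eqP e|//] := lef d fd; rewrite e fa eqxx in fd.
have := IH d da _ If led; apply: shifts_in_sub => // c /ordle_lt_trans.
by move/(_ hlt _ da)/ord_le.
Qed.

Lemma finite_support_tiles (s : seq 'X_{1..n}) :
  exists t : seq (tile n gT), forall f, within (fun a => a \in s) f -> f \in t.
Proof.
elim: s => [|a s [t ht]].
  exists [:: 1%g] => f hf; rewrite inE; apply/eqP/fsfunP => a.
  by rewrite tile_1; apply/eqP; rewrite -[_ == _]negbK; apply/negP => /hf.
pose delta x : tile n gT := [fsfun b in [fset a]%fset => x].
have deltaE x b : delta x b = if b == a then x else 1%g.
  by rewrite fsfunE in_fset1.
exists [seq (delta x * f)%g | x <- enum gT, f <- t] => f hf.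
apply/allpairsP; exists (f a, ((delta (f a))^-1 * f)%g); split.
- by rewrite mem_enum.
- apply: ht => b /=; rewrite tile_M tile_V deltaE.
  case: (b =P a) => [->|ba]; first by rewrite mulVg eqxx.
  by rewrite invg1 mul1g => /hf; rewrite inE => /orP[/eqP|].
- by rewrite mulKVg.
Qed.

End FiniteBasis.

(* Compactness of the Cantor space. *)
Lemma bool_cluster (T : countType) (r : nat -> T -> bool) :
  exists r0 : T -> bool, forall (s : seq T) M,
    exists2 N, M <= N & forall x, x \in s -> r N x = r0 x.
Proof.
(* A point of the Cantor space is read as a sequence of bits in the order of [pickle]; [p] is a
   finite prefix. *)
pose agree (p : seq bool) N := forall x, choice.pickle x < size p ->
  r N x = nth false p (choice.pickle x).
(* The cluster point is the union of a chain of prefixes, each shared by infinitely many members of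
   the sequence [r]. *)
pose often p := forall M, exists2 N, M <= N & agree p N.
have next p : often p -> exists b, often (rcons p b).
  move=> op; apply: NNPP => nb.
  have H b : exists M, forall N, M <= N -> ~ agree (rcons p b) N.
    apply: NNPP => h; apply: nb; exists b => M; apply: NNPP => hN; apply: h.
    by exists M => N MN aN; apply: hN; exists N.
  have [[M0 h0] [M1 h1]] := (H false, H true).
  have [N MN aN] := op (maxn M0 M1).
  (* The number [size p] may belong to no element of [T]; any bit is then a correct extension. *)
  have [[x xp]|nx] := classic (exists x : T, choice.pickle x = size p); last first.
    apply: (h0 N) => [|x]; first exact: leq_trans (leq_maxl _ _) MN.
    rewrite size_rcons ltnS leq_eqVlt => /orP[/eqP e|xp]; first by case: nx;
      exists x.
    by rewrite nth_rcons xp; apply: aN.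
  have key b : r N x = b -> agree (rcons p b) N.
    move=> rx y; rewrite size_rcons ltnS leq_eqVlt nth_rcons => /orP[/eqP e|yp].
      rewrite e ltnn eqxx -rx; congr (r N _).
      by apply: (pcan_inj choice.pickleK); rewrite e.
    by rewrite yp; apply: aN.
  case rx : (r N x).
    by apply: (h1 N) (key _ rx); apply: leq_trans (leq_maxr _ _) MN.
  by apply: (h0 N) (key _ rx); apply: leq_trans (leq_maxl _ _) MN.
pose step (p : {p | often p}) : {p | often p} :=
  let: exist b hb := constructive_indefinite_description _ (next _ (proj2_sig p)) in
  exist _ (rcons (proj1_sig p) b) hb.
have often0 : often [::] by move=> M; exists M.
pose ps k := proj1_sig (iter k step (exist _ [::] often0)).
have psS k : exists b, ps k.+1 = rcons (ps k) b.
  rewrite /ps iterS /step.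
  by case: constructive_indefinite_description => b hb /=; exists b.
have size_ps k : size (ps k) = k.
  by elim: k => // k IHk; have [b ->] := psS k; rewrite size_rcons IHk.
have ps_nth k d i : i < k -> nth false (ps (k + d)) i = nth false (ps k) i.
  move=> ik; elim: d => [|d IHd]; first by rewrite addn0.
  by rewrite addnS; have [b ->] := psS (k + d); rewrite nth_rcons size_ps ltn_addr.
exists (fun x => nth false (ps (choice.pickle x).+1) (choice.pickle x)) => s M.
pose K := (\max_(x <- s) choice.pickle x).+1.
have [N MN aN] : exists2 N, M <= N & agree (ps K) N.
  exact: (proj2_sig (iter K step (exist _ [::] often0))).
exists N => // x xs.
have xK : (choice.pickle x).+1 <= K by rewrite ltnS (big_rem x xs) leq_maxl.
by rewrite aN ?size_ps // -(subnKC xK) ps_nth.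
Qed.

(** * Tiles in a box as vectors *)

Definition gmul (m : seq (seq nat)) (x y : nat) : nat := nth 0 (nth [::] m x) y.

(** The unit is the only idempotent of a group. *)
Definition gid (m : seq (seq nat)) : nat :=
  find (fun x => gmul m x x == x) (iota 0 (size m)).

Definition box (n N : nat) : seq (seq nat) := words (iota 0 N.+1) n.

Definition addv (n : nat) (a b : seq nat) : seq nat :=
  [seq nth 0 a i + nth 0 b i | i <- iota 0 n].

Definition subv (n : nat) (a b : seq nat) : seq nat :=
  [seq nth 0 a i - nth 0 b i | i <- iota 0 n].

Definition lev (n : nat) (a b : seq nat) : bool :=
  all (fun i => nth 0 a i <= nth 0 b i) (iota 0 n).

(* A tile supported in the box [0, N]^n is coded by the list of its values at
   the elements of [box n N], where [m] is the multiplication table. *)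
Section Vectors.
Variables (n : nat) (m : seq (seq nat)) (N : nat).
Implicit Types (a c : seq nat) (u v : seq nat) (l : seq (seq nat)).

(** Outside the box, [index] returns the length of the list and the default applies: the value is
    trivial there, as it is for the tile. *)
Definition value v a : nat := nth (gid m) v (index a (box n N)).

Definition one_vec : seq nat := [seq gid m | a <- box n N].

Definition mul_vec u v : seq nat :=
  [seq gmul m (value u a) (value v a) | a <- box n N].

Definition shift_vec c v : seq nat :=
  [seq if lev n c a then value v (subv n a c) else gid m | a <- box n N].

Definition supp_vec v : seq (seq nat) := [seq a <- box n N | value v a != gid m].

Definition fits c v : bool := all (fun a => addv n a c \in box n N) (supp_vec v).

Definition inbox_vec E v : bool :=
  all (fun a => all (fun x => x <= E) a) (supp_vec v).

Definition within_vec l v : bool := all (fun a => a \in l) (supp_vec v).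

(** With [one_vec] among the factors, shorter products are included as well. *)
Definition prods k (V : seq (seq nat)) : seq (seq nat) :=
  iter k (fun acc =>
    flatten [seq [seq mul_vec x y | y <- acc] | x <- one_vec :: V]) [:: one_vec].

Definition shifts (V : seq (seq nat)) : seq (seq nat) :=
  flatten [seq [seq shift_vec c v | c <- [seq c <- box n N | fits c v]] | v <- V].

(** Well-foundedness cannot be seen in a finite box. Minimality of 0 replaces it, and for a total
    order compatible with addition it implies well-foundedness, by [monomial_order_intro]. Sums that
    leave the box are ignored. *)
Definition local_order l : bool :=
  [&& all (fun a => a \in l) (box n N),
      all (fun a => index (nseq n 0) l <= index a l) (box n N)
    & all (fun a => all (fun b => all (fun c =>
        [&& addv n a c \in box n N, addv n b c \in box n N
          & index a l < index b l]
          ==> (index (addv n a c) l < index (addv n b c) l))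
        (box n N)) (box n N)) (box n N)].

(* The hypotheses of [criterion], where the initial segments of the order are
   replaced by the prefixes of the enumeration [l] of the box. *)
Definition local_criterion l (S J : seq (seq nat)) (E : nat) : bool :=
  let F := [seq v <- J | inbox_vec E v] in
  let L := [seq v <- J | inbox_vec (E + E) v] in
  [&& E + E <= N,
      all (fun s => s \in F) S,
      all (fun j => all (fun c => shift_vec c j \in L) (box n E)) F,
      all (fun x => all (fun y => mul_vec x y \in L) L) L
    & all (fun k => all (fun h => within_vec (take k l) h ==>
        (h \in prods N [seq v <- shifts F | within_vec (take k l) v])) L)
        (iota 0 (size l).+1)].

(** [N] bounds both the box and the length of products, so one parameter is searched. Each order may
    pass the test with its own [E], but all the resulting bases are parts of this list, which
    therefore serves for every order. *)
Definition window (S : seq (seq nat)) : seq (seq nat) := prods N (shifts S).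

(* An order that is not computable is not available to a program, so all linear
   orders of the box which look like monomial orders are tested. *)
Definition universal_test (S : seq (seq nat)) : bool :=
  all (fun l => local_order l ==>
         has (local_criterion l S (window S)) (iota 0 N.+1))
      (words (box n N) (size (box n N))).

Definition dense (c : seq (seq nat * nat)) : seq nat :=
  [seq head (gid m) [seq p.2 | p <- c & p.1 == a] | a <- box n N].

Definition sparse v : seq (seq nat * nat) := [seq (a, value v a) | a <- supp_vec v].

Definition keys_in_box (c : seq (seq (seq nat * nat))) : bool :=
  all (fun t => all (fun p => p.1 \in box n N) t) c.

End Vectors.

(** * Computability of the vector operations *)

Ltac comp_hyp := match goal with
  | H : computable ?g |- computable (fun p => ?g (@?f p)) =>
      refine (computable_comp (f := f) H _)
  end.
Ltac comp_words := first [comp_hyp | lazymatch goal with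
  | |- computable (fun _ => words _ _) => simple apply computable_words
  end].
Ltac comp_defs ::= comp_words.

Section ComputableVectors.
Context {X : Type} {codeX : code X}.
Variables (n : nat) (m : X -> seq (seq nat)) (N : X -> nat).
Hypotheses (hm : computable m) (hN : computable N).

Lemma computable_gmul x y : computable x -> computable y ->
  computable (fun z => gmul (m z) (x z) (y z)).
Proof. by move=> hx hy; rewrite /gmul; comp. Qed.

Lemma computable_box : computable (fun z => box n (N z)).
Proof. by rewrite /box; comp. Qed.

Lemma computable_addv a b : computable a -> computable b ->
  computable (fun z : X => addv n (a z) (b z)).
Proof. by move=> ha hb; rewrite /addv; comp. Qed.

Lemma computable_subv a b : computable a -> computable b ->
  computable (fun z : X => subv n (a z) (b z)).
Proof. by move=> ha hb; rewrite /subv; comp. Qed.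

Lemma computable_lev a b : computable a -> computable b ->
  computable (fun z : X => lev n (a z) (b z)).
Proof. by move=> ha hb; rewrite /lev; comp. Qed.

End ComputableVectors.

Lemma computable_gid {X} {_ : code X} (m : X -> seq (seq nat)) :
  computable m -> computable (fun z => gid (m z)).
Proof. by move=> hm; rewrite /gid; comp; apply: computable_gmul; comp. Qed.

Ltac comp_monomial := first [comp_words | lazymatch goal with
  | |- computable (fun _ => gmul _ _ _) => simple apply computable_gmul
  | |- computable (fun _ => gid _) => simple apply computable_gid
  | |- computable (fun _ => box _ _) => simple apply computable_box
  | |- computable (fun _ => addv _ _ _) => simple apply computable_addv
  | |- computable (fun _ => subv _ _ _) => simple apply computable_subv
  | |- computable (fun _ => lev _ _ _) => simple apply computable_lev
  end].
Ltac comp_defs ::= comp_monomial.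

Section ComputableVectors1.
Context {X : Type} {codeX : code X}.
Variables (n : nat) (m : X -> seq (seq nat)) (N : X -> nat).
Hypotheses (hm : computable m) (hN : computable N).

Lemma computable_value v a : computable v -> computable a ->
  computable (fun z => value n (m z) (N z) (v z) (a z)).
Proof. by move=> hv ha; rewrite /value; comp. Qed.

Lemma computable_one_vec : computable (fun z => one_vec n (m z) (N z)).
Proof. by rewrite /one_vec; comp. Qed.

Lemma computable_dense c : computable c ->
  computable (fun z => dense n (m z) (N z) (c z)).
Proof. by move=> hc; rewrite /dense; comp. Qed.

Lemma computable_keys_in_box c : computable c ->
  computable (fun z => keys_in_box n (N z) (c z)).
Proof. by move=> hc; rewrite /keys_in_box; comp. Qed.

Lemma computable_local_order l : computable l ->
  computable (fun z => local_order n (N z) (l z)).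
Proof. by move=> hl; rewrite /local_order; comp. Qed.

End ComputableVectors1.

Ltac comp_value := first [comp_monomial | lazymatch goal with
  | |- computable (fun _ => value _ _ _ _ _) => simple apply computable_value
  | |- computable (fun _ => one_vec _ _ _) => simple apply computable_one_vec
  | |- computable (fun _ => dense _ _ _ _) => simple apply computable_dense
  | |- computable (fun _ => keys_in_box _ _ _) => simple apply
    computable_keys_in_box
  | |- computable (fun _ => local_order _ _ _) => simple apply
    computable_local_order
  end].
Ltac comp_defs ::= comp_value.

Section ComputableVectors2.
Context {X : Type} {codeX : code X}.
Variables (n : nat) (m : X -> seq (seq nat)) (N : X -> nat).
Hypotheses (hm : computable m) (hN : computable N).

Lemma computable_mul_vec u v : computable u -> computable v ->
  computable (fun z => mul_vec n (m z) (N z) (u z) (v z)).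
Proof. by move=> hu hv; rewrite /mul_vec; comp. Qed.

Lemma computable_shift_vec c v : computable c -> computable v ->
  computable (fun z => shift_vec n (m z) (N z) (c z) (v z)).
Proof. by move=> hu hv; rewrite /shift_vec; comp. Qed.

Lemma computable_supp_vec v : computable v ->
  computable (fun z => supp_vec n (m z) (N z) (v z)).
Proof. by move=> hv; rewrite /supp_vec; comp. Qed.

End ComputableVectors2.

Ltac comp_vec := first [comp_value | lazymatch goal with
  | |- computable (fun _ => mul_vec _ _ _ _ _) => simple apply computable_mul_vec
  | |- computable (fun _ => shift_vec _ _ _ _ _) => simple apply
    computable_shift_vec
  | |- computable (fun _ => supp_vec _ _ _ _) => simple apply computable_supp_vec
  end].
Ltac comp_defs ::= comp_vec.

Section ComputableVectors3.
Context {X : Type} {codeX : code X}.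
Variables (n : nat) (m : X -> seq (seq nat)) (N : X -> nat).
Hypotheses (hm : computable m) (hN : computable N).

Lemma computable_fits c v : computable c -> computable v ->
  computable (fun z => fits n (m z) (N z) (c z) (v z)).
Proof. by move=> hc hv; rewrite /fits; comp. Qed.

Lemma computable_inbox_vec c v : computable c -> computable v ->
  computable (fun z => inbox_vec n (m z) (N z) (c z) (v z)).
Proof. by move=> hc hv; rewrite /inbox_vec; comp. Qed.

Lemma computable_within_vec l v : computable l -> computable v ->
  computable (fun z => within_vec n (m z) (N z) (l z) (v z)).
Proof. by move=> hc hv; rewrite /within_vec; comp. Qed.

Lemma computable_sparse v : computable v ->
  computable (fun z => sparse n (m z) (N z) (v z)).
Proof. by move=> hc; rewrite /sparse; comp. Qed.

Lemma computable_prods k V : computable k -> computable V ->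
  computable (fun z => prods n (m z) (N z) (k z) (V z)).
Proof. by move=> hk hV; rewrite /prods; comp. Qed.

End ComputableVectors3.

Ltac comp_predicate := first [comp_vec | lazymatch goal with
  | |- computable (fun _ => fits _ _ _ _ _) => simple apply computable_fits
  | |- computable (fun _ => inbox_vec _ _ _ _ _) => simple apply
    computable_inbox_vec
  | |- computable (fun _ => within_vec _ _ _ _ _) => simple apply
    computable_within_vec
  | |- computable (fun _ => sparse _ _ _ _) => simple apply computable_sparse
  | |- computable (fun _ => prods _ _ _ _ _) => simple apply computable_prods
  end].
Ltac comp_defs ::= comp_predicate.

Lemma computable_shifts {X} {_ : code X} n (m : X -> seq (seq nat)) N V :
  computable m -> computable N -> computable V ->
  computable (fun z => shifts n (m z) (N z) (V z)).
Proof. by move=> hm hN hV; rewrite /shifts; comp. Qed.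

Ltac comp_shifts := first [comp_predicate | lazymatch goal with
  | |- computable (fun _ => shifts _ _ _ _) => simple apply computable_shifts
  end].
Ltac comp_defs ::= comp_shifts.

Lemma computable_window {X} {_ : code X} n (m : X -> seq (seq nat)) N V :
  computable m -> computable N -> computable V ->
  computable (fun z => window n (m z) (N z) (V z)).
Proof. by move=> hm hN hV; rewrite /window; comp. Qed.

Lemma computable_local_criterion {X} {_ : code X} n (m : X -> seq (seq nat)) N
  l S J E :
  computable m -> computable N -> computable l -> computable S ->
  computable J -> computable E ->
  computable (fun z => local_criterion n (m z) (N z) (l z) (S z) (J z) (E z)).
Proof.
by move=> hm hN hl hS hJ hE; rewrite /local_criterion; comp.
Qed.

Ltac comp_criterion := first [comp_shifts | lazymatch goal with
  | |- computable (fun _ => window _ _ _ _) => simple apply computable_window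
  | |- computable (fun _ => local_criterion _ _ _ _ _ _ _) =>
      simple apply computable_local_criterion
  end].
Ltac comp_defs ::= comp_criterion.

Lemma computable_universal_test {X} {_ : code X} n (m : X -> seq (seq nat)) N S :
  computable m -> computable N -> computable S ->
  computable (fun z => universal_test n (m z) (N z) (S z)).
Proof. by move=> hm hN hS; rewrite /universal_test; comp. Qed.

Ltac comp_test := first [comp_criterion | lazymatch goal with
  | |- computable (fun _ => universal_test _ _ _ _) =>
      simple apply computable_universal_test
  end].
Ltac comp_defs ::= comp_test.

(** * Correctness of the vector operations *)

Lemma mem_words (A : eqType) (s : seq A) k w :
  (w \in words s k) = (size w == k) && all (fun a => a \in s) w.
Proof.
elim: k w => [|k IHk] w; first by rewrite inE; case: w.
rewrite /words iterS -/(words s k); apply/flatten_mapP/idP.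
  move=> [a as_ /mapP[v]]; rewrite IHk => /andP[/eqP sv av] ->.
  by rewrite /= sv eqxx as_ av.
case: w => // a w /=; rewrite eqSS => /andP[sw /andP[as_ aw]].
by exists a => //; apply/mapP; exists w; rewrite // IHk sw aw.
Qed.

Lemma words_uniq (A : eqType) (s : seq A) k : uniq s -> uniq (words s k).
Proof.
move=> us; elim: k => // k IHk.
apply: (@allpairs_uniq _ _ _ (fun a w => a :: w)) => // -[a w] [b v] _ _ /=.
by case=> -> ->.
Qed.

Section Monomials.
Variable n : nat.
Implicit Types a b c : 'X_{1..n}.

Definition mon (s : seq nat) : 'X_{1..n} := [multinom nth 0 s i | i < n].

Definition exps a : seq nat := tval (multinom_val a).

Lemma size_exps a : size (exps a) = n.
Proof. exact: size_tuple. Qed.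

Lemma nth_exps a (i : 'I_n) : nth 0 (exps a) i = a i.
Proof. by rewrite (mnm_nth 0). Qed.

Lemma expsK a : mon (exps a) = a.
Proof. by apply/mnmP => i; rewrite mnmE nth_exps. Qed.

Lemma monK s : size s = n -> exps (mon s) = s.
Proof.
move=> ss; apply: (@eq_from_nth _ 0); first by rewrite size_exps.
by rewrite size_exps => i ni; rewrite (nth_exps _ (Ordinal ni)) mnmE.
Qed.

Lemma exps_inj : injective exps.
Proof. exact: can_inj expsK. Qed.

Lemma exps_map (f : nat -> nat) :
  [seq f i | i <- iota 0 n] = exps [multinom f i | i < n].
Proof.
apply: (@eq_from_nth _ 0); first by rewrite size_map size_iota size_exps.
rewrite size_map size_iota => i ni.
by rewrite (nth_map 0) ?size_iota // nth_iota // (nth_exps _ (Ordinal ni)) mnmE.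
Qed.

Lemma addvE a b : addv n (exps a) (exps b) = exps (a + b)%MM.
Proof.
rewrite /addv exps_map; congr exps; apply/mnmP => i.
by rewrite mnmE mnmDE !nth_exps.
Qed.

Lemma subvE a b : subv n (exps a) (exps b) = exps (a - b)%MM.
Proof.
rewrite /subv exps_map; congr exps; apply/mnmP => i.
by rewrite mnmE mnmBE !nth_exps.
Qed.

Lemma levE a b : lev n (exps a) (exps b) = (a <= b)%MM.
Proof.
apply/allP/mnm_lepP => h i; first by have := h i;
  rewrite mem_iota /= ltn_ord !nth_exps; apply.
rewrite mem_iota add0n => /= ni.
by rewrite (nth_exps _ (Ordinal ni)) (nth_exps _ (Ordinal ni)).
Qed.

Lemma all_exps (p : nat -> bool) a : all p (exps a) = [forall i, p (a i)].
Proof.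
apply/(all_nthP 0)/forallP => h i; last first.
  by rewrite size_exps => ni; rewrite (nth_exps _ (Ordinal ni)).
by rewrite -nth_exps; apply: h; rewrite size_exps.
Qed.

Lemma mem_box N a : (exps a \in box n N) = inbox N a.
Proof.
rewrite mem_words size_exps eqxx /= all_exps; apply: eq_forallb => i.
by rewrite (mem_iota 0 N.+1).
Qed.

Lemma boxP N s : reflect (exists2 a, s = exps a & inbox N a) (s \in box n N).
Proof.
apply: (iffP idP) => [sb|[a -> ]]; last by rewrite mem_box.
have ss : size s = n by move: sb; rewrite mem_words => /andP[/eqP].
by exists (mon s); rewrite -?mem_box monK.
Qed.

Lemma box_uniq N : uniq (box n N).
Proof. exact/words_uniq/iota_uniq. Qed.

Lemma exps0 : exps 0%MM = nseq n 0.
Proof.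
apply: (@eq_from_nth _ 0); rewrite size_exps ?size_nseq // => i ni.
by rewrite (nth_exps _ (Ordinal ni)) mnm0E nth_nseq ni.
Qed.

End Monomials.

Section Semantics.
Variables (n : nat) (gT : finGroupType) (e : seq gT) (N : nat).
Hypothesis he : numbering e.
Notation m := (mul_table e).
Notation code := (elt_code e).
Implicit Types (t x y : tile n gT) (a b c : 'X_{1..n}) (A F : tile n gT -> Prop).
Implicit Types (u v : seq nat) (V : seq (seq nat)).

Lemma mem_numbering g : g \in e.
Proof. by rewrite (perm_mem he) mem_enum. Qed.

Lemma elt_code_inj : injective code.
Proof. by move=> g h /index_inj; apply; rewrite ?inE ?mem_numbering. Qed.

Lemma elt_code_lt g : code g < size e.
Proof. by rewrite index_mem mem_numbering. Qed.

Lemma gmulE g h : gmul m (code g) (code h) = code (g * h)%g.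
Proof.
rewrite /gmul /mul_table (nth_map 1%g) ?elt_code_lt //.
by rewrite (nth_map 1%g) ?elt_code_lt // !nth_index ?mem_numbering.
Qed.

Lemma gidE : gid m = code 1%g.
Proof.
have sm : size m = size e by rewrite size_map.
set P := fun k : nat => gmul m k k == k.
have P1 : P (code 1%g) by rewrite /P gmulE mulg1.
have hP : has P (iota 0 (size m)).
  by apply/hasP; exists (code 1%g); rewrite // mem_iota sm elt_code_lt.
have ksz : find P (iota 0 (size m)) < size m by rewrite -{2}(size_iota 0 (size
  m)) -has_find.
have := nth_find 0 hP; rewrite nth_iota // [_ + _]/= -/(gid m) => Pk.
have kE : code (nth 1%g e (gid m)) = gid m.
  by rewrite /elt_code index_uniq ?(perm_uniq he) ?enum_uniq // -sm.
move: Pk; rewrite /P -kE gmulE => /eqP/elt_code_inj/eqP.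
by rewrite -[X in _ == X]mulg1 (inj_eq (mulgI _)) => /eqP->.
Qed.

Definition tvec t : seq nat := [seq code (t (mon n s)) | s <- box n N].

Lemma value_map (f : seq nat -> nat) a :
  value n m N [seq f s | s <- box n N] (exps a) =
  if inbox N a then f (exps a) else gid m.
Proof.
rewrite /value; case: ifP => [ab|/negbT nab].
  by rewrite (nth_map [::]) ?index_mem ?mem_box // nth_index ?mem_box.
by rewrite nth_default // size_map memNindex // mem_box.
Qed.

Lemma value_tvec t a : within (inbox N) t -> value n m N (tvec t) (exps a) =
  code (t a).
Proof.
move=> tb; rewrite value_map expsK; case: ifP => // /negbT nab; rewrite gidE.
congr code; apply/esym/eqP; rewrite -[_ == _]negbK; apply/negP => /tb ab.
by rewrite ab in nab.
Qed.

Lemma value_eq_id t a : within (inbox N) t ->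
  (value n m N (tvec t) (exps a) != gid m) = (t a != 1%g).
Proof. by move=> tb; rewrite value_tvec // gidE (inj_eq elt_code_inj). Qed.

Lemma tvec_inj t x : within (inbox N) t -> within (inbox N) x ->
  tvec t = tvec x -> t = x.
Proof.
move=> tb xb tx; apply/fsfunP => a; apply: elt_code_inj.
by rewrite -!value_tvec // tx.
Qed.

Lemma eq_vec (f g : seq nat -> nat) : (forall a,
  inbox N a -> f (exps a) = g (exps a)) ->
  [seq f s | s <- box n N] = [seq g s | s <- box n N].
Proof. by move=> fg; apply/eq_in_map => s /boxP[a -> ab]; apply: fg. Qed.

Lemma tvec_1 : one_vec n m N = tvec 1%g.
Proof. by apply: eq_vec => a _; rewrite expsK tile_1 gidE. Qed.

Lemma tvec_M t x : within (inbox N) t -> within (inbox N) x ->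
  mul_vec n m N (tvec t) (tvec x) = tvec (t * x)%g.
Proof. by move=> tb xb; apply: eq_vec => a _;
  rewrite !value_tvec // gmulE expsK tile_M. Qed.

Lemma tvec_shift c t : within (inbox N) t ->
  shift_vec n m N (exps c) (tvec t) = tvec (shift c t).
Proof.
move=> tb; apply: eq_vec => a _; rewrite levE subvE value_tvec // expsK shiftE gidE.
by case: ifP.
Qed.

Lemma mem_supp_vec t s : within (inbox N) t ->
  reflect (exists2 a, s = exps a & t a != 1%g) (s \in supp_vec n m N (tvec t)).
Proof.
move=> tb; rewrite mem_filter; apply: (iffP andP) => [[hs /boxP[a sE _]]|[a -> ta]].
  by exists a => //; rewrite -value_eq_id // -sE.
by rewrite value_eq_id // mem_box; split=> //; apply: tb.
Qed.

Lemma all_supp_vec (p : seq nat -> bool) t : within (inbox N) t ->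
  all p (supp_vec n m N (tvec t)) <-> within (fun a => p (exps a)) t.
Proof.
move=> tb; split=> [/allP h a ta|h]; first by apply: h;
  apply/mem_supp_vec => //; exists a.
by apply/allP => s /(mem_supp_vec _ tb)[a -> /h].
Qed.

Lemma fitsE c t : within (inbox N) t ->
  fits n m N (exps c) (tvec t) <-> within (inbox N) (shift c t).
Proof.
move=> tb; rewrite within_shift; apply: (iff_trans (all_supp_vec _ tb)).
by split; apply: within_sub => a; rewrite addvE mem_box.
Qed.

Lemma inbox_vecE E t : within (inbox N) t ->
  inbox_vec n m N E (tvec t) <-> within (inbox E) t.
Proof.
move=> tb; apply: (iff_trans (all_supp_vec _ tb)).
by split; apply: within_sub => a; rewrite all_exps.
Qed.

Lemma within_vecE l t : within (inbox N) t ->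
  within_vec n m N l (tvec t) <-> within (fun a => exps a \in l) t.
Proof. exact: all_supp_vec. Qed.

(** Relates a computed list to a predicate on tiles; order and repetitions in the list are
    irrelevant. *)
Definition codes V A : Prop :=
  [/\ forall t, A t -> within (inbox N) t, forall t, A t -> tvec t \in V
    & forall v, v \in V -> exists2 t, A t & v = tvec t].

Lemma codesP V A t : codes V A -> within (inbox N) t -> tvec t \in V <-> A t.
Proof.
move=> [Ab AV VA] tb; split=> [/VA[x Ax e']|/AV //].
by rewrite (tvec_inj tb (Ab _ Ax) e').
Qed.

Lemma codes_filter V A (p : seq nat -> bool) (B : tile n gT -> Prop) :
  codes V A -> (forall t, A t -> p (tvec t) <-> B t) ->
  codes [seq v <- V | p v] (fun t => A t /\ B t).
Proof.
move=> [Ab AV VA] AB; split=> [t [/Ab]|t [At Bt]|v] //.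
  by rewrite mem_filter AV // andbT; apply/AB.
by rewrite mem_filter => /andP[pv /VA[t At vE]]; exists t => //; split=> //;
  apply/AB; rewrite -?vE.
Qed.

Lemma codes_shifts V A : codes V A ->
  codes (shifts n m N V) (shifts_in A (inbox N)).
Proof.
move=> [Ab AV VA]; split=> [t []|t [[j [c [Aj ->]]] jb]|v] //.
  apply/flatten_mapP; exists (tvec j); first exact: AV.
  (* The trivial tile fits into the box after any shift, even one that is not in the list; its shift
     by 0 represents them all. For other tiles, a fitting shift lies in the box. *)
  case: (eqVneq j 1%g) => [j1|].
    apply/mapP; exists (exps (0%MM : 'X_{1..n}));
      last by rewrite tvec_shift ?j1 ?shift_1 //; apply: within_1.
    rewrite mem_filter mem_box; apply/andP; split.
      by apply/fitsE; rewrite j1 ?shift_1; apply: within_1.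
    by apply/inboxP => i; rewrite mnm0E.
  move=> j1; apply/mapP; exists (exps c); last by rewrite tvec_shift //; apply: Ab.
  rewrite mem_filter mem_box; apply/andP; split; first by apply/fitsE => //;
    apply: Ab.
  have [a ja] : exists a, j a != 1%g.
    apply: NNPP => h; case/eqP: j1; apply/fsfunP => a; rewrite tile_1.
    by apply/eqP; rewrite -[_ == _]negbK; apply/negP => ja; apply: h; exists a.
  have := jb (a + c)%MM; rewrite shift_add => /(_ ja)/inboxP h.
  by apply/inboxP => i; have := h i; rewrite mnmDE; lia.
move=> /flatten_mapP[w /VA[j Aj ->] /mapP[s]].
rewrite mem_filter => /andP[fs /boxP[c sE _]] ->; move: fs; rewrite sE => fs.
exists (shift c j); last by rewrite tvec_shift //; apply: Ab.
by split; [exists j, c | apply/fitsE => //; apply: Ab].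
Qed.

End Semantics.

Inductive genn n (gT : finGroupType) (A : tile n gT -> Prop) :
    nat -> tile n gT -> Prop :=
  | genn_1 : genn A 0 1%g
  | genn_S k x : genn A k x -> genn A k.+1 x
  | genn_M k x y : A x -> genn A k y -> genn A k.+1 (x * y)%g.

Section Genn.
Variables (n : nat) (gT : finGroupType).
Implicit Types (A B : tile n gT -> Prop) (t : tile n gT).

Lemma genn_gen A k t : genn A k t -> gen A t.
Proof. by elim=> // [|{}k x y Ax _]; [apply: gen_1 | apply: gen_cons]. Qed.

Lemma genn_leq A k k' t : k <= k' -> genn A k t -> genn A k' t.
Proof.
by move=> /subnKC <- h; elim: (k' - k) => [|d IHd]; rewrite ?addn0 // addnS;
  apply: genn_S.
Qed.

Lemma gen_genn A t : gen A t -> exists k, genn A k t.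
Proof.
elim=> [|x y Ax _ [k hk]]; first by exists 0; apply: genn_1.
by exists k.+1; apply: genn_M.
Qed.

Lemma genn_sub A B k t : (forall x, A x -> B x) -> genn A k t -> genn B k t.
Proof.
by move=> AB; elim=> [|{}k x _|{}k x y /AB Bx _];
  [apply: genn_1 | apply: genn_S | apply: genn_M].
Qed.

Lemma genn_0 A t : genn A 0 t -> t = 1%g.
Proof. by move=> h; inversion h. Qed.

Lemma genn_inv A k t : genn A k.+1 t ->
  genn A k t \/ exists x y, [/\ A x, genn A k y & t = (x * y)%g].
Proof.
by move=> h; inversion h as [|? ? h'|? x y Ax hy]; [left | right; exists x, y].
Qed.

Lemma codes_prods (e : seq gT) N V A k : numbering e -> codes e N V A ->
  codes e N (prods n (mul_table e) N k V) (genn A k).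
Proof.
move=> he [Ab AV VA].
have gb j t : genn A j t -> within (inbox N) t by move=> /genn_gen;
  apply: gen_within.
elim: k => [|k [_ IH1 IH2]]; split=> [t|t|v]; try exact: gb.
- by move/genn_0 ->; rewrite inE tvec_1.
- by rewrite inE tvec_1 // => /eqP->; exists 1%g => //; apply: genn_1.
- move=> /genn_inv h; apply/flatten_mapP; case: h => [h|[x [y [Ax hy ->]]]].
    exists (one_vec n (mul_table e) N); first exact: mem_head.
    apply/mapP; exists (tvec e N t); first exact: IH1.
    rewrite tvec_1 // tvec_M // ?mul1g //; first exact: within_1.
    exact: gb h.
  exists (tvec e N x); first by rewrite inE AV ?orbT.
  apply/mapP; exists (tvec e N y); first exact: IH1.
  by rewrite tvec_M //; [apply: Ab | apply: gb hy].
- move=> /flatten_mapP[w]; rewrite inE => hw /mapP[u /IH2[y hy ->] ->].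
  case/orP: hw => [/eqP->|/VA[x Ax ->]].
    exists y; first exact: genn_S.
    by rewrite tvec_1 // tvec_M // ?mul1g //; [apply: within_1 | apply: gb hy].
  exists (x * y)%g; first exact: genn_M.
  by rewrite tvec_M //; [apply: Ab | apply: gb hy].
Qed.

End Genn.

(** * Universal bases *)

Definition window_tiles n (gT : finGroupType) (S : seq (tile n gT)) (N : nat) :
    tile n gT -> Prop :=
  genn (shifts_in (fun s => s \in S) (inbox N)) N.

(** As every nontrivial tile has a top, this includes that the shifts of [A] generate I. It speaks
    of factorizations instead of leading terms because membership, elimination and saturation all
    need control over the supports of the factors. *)
Definition universal n (gT : finGroupType) (I A : tile n gT -> Prop) : Prop :=
  (forall t, A t -> I t) /\
  forall lt, monomial_order lt -> forall f a, I f ->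
    within (fun b => ordle lt b a) f ->
    gen (shifts_in A (fun b => ordle lt b a)) f.

Section SortedBox.
Variables (n : nat) (lt : rel 'X_{1..n}) (N : nat).
Hypothesis hlt : monomial_order lt.
Implicit Types a b : 'X_{1..n}.

Definition sorted_box : seq (seq nat) :=
  sort (fun s s' => ordle lt (mon n s) (mon n s')) (box n N).

Lemma mem_sorted_box s : (s \in sorted_box) = (s \in box n N).
Proof. exact: mem_sort. Qed.

Let le_tr : transitive (fun s s' => ordle lt (mon n s) (mon n s')).
Proof. by move=> x y z; apply: ordle_trans. Qed.

Lemma sorted_box_index a b : inbox N a -> inbox N b ->
  (index (exps a) sorted_box < index (exps b) sorted_box) = lt a b.
Proof.
move=> ab bb; have srt : sorted (fun s s' => ordle lt (mon n s) (mon n s'))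
  sorted_box.
  by apply: sort_sorted => x y; apply: ordle_total.
have al : exps a \in sorted_box by rewrite mem_sorted_box mem_box.
have bl : exps b \in sorted_box by rewrite mem_sorted_box mem_box.
apply/idP/idP => h.
  have := sorted_ltn_index le_tr srt _ _ al bl h; rewrite !expsK => /orP[/eqP e|//].
  by rewrite e ltnn in h.
rewrite ltnNge leq_eqVlt;
  apply/negP => /orP[/eqP e|/(sorted_ltn_index le_tr srt _ _ bl al)].
  by move: h; rewrite -(exps_inj (index_inj [::] bl al e)) (ord_irr hlt).
by rewrite !expsK (ordleNgt hlt) h.
Qed.

Lemma sorted_box_words : sorted_box \in words (box n N) (size (box n N)).
Proof.
rewrite mem_words size_sort eqxx; apply/allP => s.
by rewrite mem_sorted_box.
Qed.

Lemma local_order_sorted_box : local_order n N sorted_box.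
Proof.
apply/and3P; split.
- by apply/allP => s; rewrite mem_sorted_box.
- apply/allP => s /boxP[a -> ab]; rewrite -exps0 leqNgt sorted_box_index //.
    by rewrite -(ordleNgt hlt) (ordle_0 hlt).
  by apply/inboxP => i; rewrite mnm0E.
- apply/allP => _ /boxP[a -> ab]; apply/allP => _ /boxP[b -> bb].
  apply/allP => _ /boxP[c -> cb]; rewrite !addvE !mem_box.
  apply/implyP => /and3P[acb bcb]; rewrite !sorted_box_index //.
  by rewrite (ord_add hlt).
Qed.

(** Translates initial segments of a monomial order into the prefixes used by the test; [k] is the
    position of the first element outside [p]. *)
Lemma sorted_box_prefix (p : pred 'X_{1..n}) :
  (forall a b, ordle lt a b -> p b -> p a) ->
  exists2 k, k <= size sorted_box &
    forall a, inbox N a -> (exps a \in take k sorted_box) = p a.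
Proof.
move=> pd; pose k := find (fun s => ~~ p (mon n s)) sorted_box.
exists k; first exact: find_size.
move=> a ab; have al : exps a \in sorted_box by rewrite mem_sorted_box mem_box.
rewrite in_take //; apply/idP/idP => [ik|pa].
  by have := before_find [::] ik; rewrite nth_index // expsK => /negbFE.
rewrite ltnNge; apply/negP => ki.
have ks : k < size sorted_box by apply: leq_ltn_trans ki _; rewrite index_mem.
have hp : has (fun s => ~~ p (mon n s)) sorted_box by rewrite has_find.
move: (nth_find [::] hp); rewrite -/k /=.
have : nth [::] sorted_box k \in box n N by rewrite -mem_sorted_box mem_nth.
case/boxP => b bE bb; rewrite bE expsK => /negP; apply; apply: (pd _ a) => //.
rewrite (ordleNgt hlt) -sorted_box_index // -bE -leqNgt.
by rewrite index_uniq // sort_uniq box_uniq.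
Qed.

End SortedBox.

Lemma codes_window n (gT : finGroupType) (e : seq gT) (S : seq (tile n gT)) N :
  numbering e -> (forall s, s \in S -> within (inbox N) s) ->
  codes e N (window n (mul_table e) N [seq tvec e N s | s <- S]) (window_tiles S N).
Proof.
move=> he Sb; apply: codes_prods => //; apply: codes_shifts => //; split=> // t.
  by move=> tS; apply: map_f.
by case/mapP => s sS ->; exists s.
Qed.

Theorem universal_test_sound n (gT : finGroupType) (e : seq gT)
    (S : seq (tile n gT)) (I : tile n gT -> Prop) N :
  numbering e -> shift_subgroup I -> generates S I ->
  (forall s, s \in S -> within (inbox N) s) ->
  universal_test n (mul_table e) N [seq tvec e N s | s <- S] ->
  universal I (window_tiles S N).
Proof.
move=> he sI gI Sb /allP test; pose W := window_tiles S N.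
have WI t : W t -> I t.
  move/genn_gen => gt; apply/gI; apply/span_gen.
  by apply: shifts_in_sub gt.
split=> // lt hlt f a If lef.
have := test _ (sorted_box_words lt N); rewrite local_order_sorted_box // implyTb.
move=> /hasP[E _ /and5P[EN /allP SF /allP shL /allP mulL /allP red]].
have cW := codes_window he Sb.
have Wb t : W t -> within (inbox N) t by case: cW => h _ _; apply: h.
pose F t := W t /\ within (inbox E) t; pose L t := W t /\ within (inbox (E + E)) t.
have cF : codes e N [seq v <- window n (mul_table e) N [seq tvec e N s | s <- S]
    | inbox_vec n (mul_table e) N E v] F.
  by apply: codes_filter cW _ => t /Wb; apply: inbox_vecE.
have cL : codes e N [seq v <- window n (mul_table e) N [seq tvec e N s | s <- S]
    | inbox_vec n (mul_table e) N (E + E) v] L.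
  by apply: codes_filter cW _ => t /Wb; apply: inbox_vecE.
have redF : reducing lt F.
  apply: (criterion hlt (L := L) (E := E)).
  - by move=> j [].
  - split; last exact: within_1.
    exact: genn_leq (leq0n _) (genn_1 _).
  - move=> x y Lx Ly; have [[Wx _] [Wy _]] := (Lx, Ly).
    apply/(codesP he cL); first by apply: within_M; apply: Wb.
    have [_ Lv _] := cL.
    have /allP/(_ _ (Lv y Ly)) := mulL _ (Lv x Lx).
    by rewrite tvec_M //; apply: Wb.
  - move=> j c Fj cE; have [Wj jE] := Fj.
    apply/(codesP he cL).
      apply/within_shift; apply: within_sub jE => b /inboxP bE.
      by apply/inboxP => i; have := bE i; have /inboxP/(_ i) := cE;
        rewrite mnmDE; lia.
    have [_ Fv _] := cF.
    have /allP/(_ (exps c)) := shL _ (Fv j Fj).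
    by rewrite mem_box => /(_ cE); rewrite tvec_shift //; apply: Wb.
  (* The index [b] may lie outside the box; only the elements of the box below it matter, and they
     form a prefix. *)
  - move=> h b Lh lth; have [Wh _] := Lh.
    have [k ks hk] := @sorted_box_prefix _ _ N hlt (fun c => lt c b)
      (fun c d cd db => ordle_lt_trans hlt cd db).
    have /red/allP : k \in iota 0 (size (sorted_box lt N)).+1 by rewrite mem_iota.
    have [_ Lv _] := cL; move/(_ _ (Lv h Lh))/implyP.
    have hw : within (fun c => exps c \in take k (sorted_box lt N)) h.
      by move=> c hc; rewrite hk; [apply: lth | apply: Wb hc].
    have -> : within_vec n (mul_table e) N (take k (sorted_box lt N)) (tvec e N h).
      by apply/within_vecE => //; apply: Wb.
    move/(_ isT) => hp.
    have cP := codes_prods N he (codes_filter (codes_shifts he cF)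
      (fun t (ht : shifts_in F (inbox N) t) =>
        within_vecE he (take k (sorted_box lt N)) ht.2)).
    have /genn_gen := proj1 (codesP he cP (Wb _ Wh)) hp.
    apply: gen_sub => x [[[j [c [Fj xE]]] xN] xk]; split; first by exists j, c.
    by move=> c' xc; rewrite -hk; [apply: xk | apply: xN].
have gF : gen (shifts_in F (fun=> True)) f.
  have /gI/span_gen : I f by [].
  apply: shifts_in_sub => // s sS.
  apply/(codesP he cF); first exact: Sb.
  by apply: SF; apply: map_f.
by apply: shifts_in_sub (redF _ _ gF lef) => // j [].
Qed.

(** Minimality of 0 makes the order extend divisibility. By Dickson's lemma the inaccessible
    elements are multiples of finitely many of them; the least of these has an inaccessible element
    below it, which is again a multiple of one of them, a contradiction. *)
Lemma monomial_order_intro n (lt : rel 'X_{1..n}) :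
  irreflexive lt -> transitive lt ->
  (forall a b, [|| lt a b, a == b | lt b a]) ->
  (forall a b c, lt a b -> lt (a + c)%MM (b + c)%MM) ->
  (forall a, ~~ lt a 0%MM) -> monomial_order lt.
Proof.
move=> irr tr tot add min0; suff wf : well_founded (fun a b => lt a b) by split.
move=> a.
have lem_le b c : (b <= c)%MM -> b = c \/ lt b c.
  move=> /submK <-; case/or3P: (tot 0%MM (c - b)%MM) => [/(add _ _ b)|/eqP<-|].
  - by rewrite add0m; right.
  - by rewrite add0m; left.
  - by rewrite (negbTE (min0 _)).
apply: NNPP => na.
have [s sN hs] := dickson (fun b => ~ Acc (fun a b => lt a b) b).
have [c cs cmin] : exists2 c, c \in s & forall b, b \in s -> ~~ lt b c.
  have [b0 b0s _] := hs a na.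
  have : s != [::] by case: (s) b0s.
  elim: (s) => // x t IHt _; case: (eqVneq t [::]) => [->|/IHt[c ct hc]].
    by exists x => [|b]; rewrite inE // => /eqP->; rewrite irr.
  case xc : (lt x c); last first.
    by exists c => [|b]; rewrite inE ?ct ?orbT // => /orP[/eqP->|/hc]; rewrite ?xc.
  exists x => [|b]; rewrite inE ?eqxx // => /orP[/eqP->|/hc]; first by rewrite irr.
  by apply: contra => /tr; apply.
have [d dc nd] : exists2 d, lt d c & ~ Acc (fun a b => lt a b) d.
  apply: NNPP => h; apply: (sN c cs); constructor => d dc.
  by apply: NNPP => nd; apply: h; exists d.
have [b bs /lem_le[bd|bd]] := hs d nd.
  by move: (cmin b bs); rewrite bd dc.
by move: (cmin b bs); rewrite (tr _ _ _ bd dc).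
Qed.

(** One number bounds the length of a factorization and the box containing its factors, which is the
    form required by [window_tiles]. *)
Lemma gen_bounded n (gT : finGroupType) (A : tile n gT -> Prop)
    (D : 'X_{1..n} -> Prop) t : gen (shifts_in A D) t ->
  exists K, genn (shifts_in A (fun a => D a /\ inbox K a)) K t.
Proof.
have mono K K' x : K <= K' -> genn (shifts_in A (fun a => D a /\ inbox K a)) K x ->
    genn (shifts_in A (fun a => D a /\ inbox K' a)) K' x.
  move=> KK' /(genn_leq KK'); apply: genn_sub => y [Ay yD];
    split=> // a /yD[Da /inboxP aK].
  by split=> //; apply/inboxP => i; apply: leq_trans KK'.
elim=> [|x y [Ax Dx] _ [K hK]]; first by exists 0; apply: genn_1.
have [K' xK'] := box_bound x; exists (maxn K K').+1.
apply: genn_M; last first.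
  apply: genn_sub (mono _ _ _ (leq_maxl K K') hK) => z [Az zD];
    split=> // a /zD[Da /inboxP aK].
  by split=> //; apply/inboxP => i; apply/leqW.
split=> // a xa; split; first exact: Dx.
have /inboxP h := xK' a xa.
by apply/inboxP => i; apply: leqW; apply: leq_trans (h i) (leq_maxr _ _).
Qed.

Theorem universal_test_complete n (gT : finGroupType) (e : seq gT)
    (S : seq (tile n gT)) (I : tile n gT -> Prop) M :
  numbering e -> shift_subgroup I -> generates S I ->
  exists N, [/\ M <= N, forall s, s \in S -> within (inbox N) s
    & universal_test n (mul_table e) N [seq tvec e N s | s <- S]].
Proof.
move=> he sI gI; apply: NNPP => nex.
have [ES hES] : exists ES, forall s, s \in S -> within (inbox ES) s.
  apply: uniform_bound => [E E' x EE'|x _];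
    [exact: within_box_le | exact: box_bound].
pose M1 := maxn M ES.
(* The condition on [N] stands under the existential quantifier, so that choice yields a total
   function [l] of bad orders. *)
have bad N : exists l : seq (seq nat),
  M1 <= N -> [/\ l \in words (box n N) (size (box n N)),
    local_order n N l & forall E, E <= N -> ~~ local_criterion n (mul_table e) N l
      [seq tvec e N s | s <- S] (window n (mul_table e) N [seq tvec e N s | s
        <- S]) E].
  case: (leqP M1 N) => [MN|]; last by exists [::].
  have Sb s : s \in S -> within (inbox N) s.
    by move/hES; apply: within_box_le; apply: leq_trans MN; apply: leq_maxr.
  have : ~~ universal_test n (mul_table e) N [seq tvec e N s | s <- S].
    apply/negP => h; apply: nex; exists N; split=> //.
    by apply: leq_trans MN; apply: leq_maxl.
  case/allPn => l lw; rewrite negb_imply => /andP[ll /hasPn h].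
  by exists l => _; split=> // E EN; apply: h; rewrite mem_iota.
have [l hl] : exists l : nat -> seq (seq nat), forall N, M1 <= N ->
    [/\ l N \in words (box n N) (size (box n N)), local_order n N (l N)
      & forall E, E <= N -> ~~ local_criterion n (mul_table e) N (l N)
      [seq tvec e N s | s <- S] (window n (mul_table e) N [seq tvec e N s | s
        <- S]) E].
  exists (fun N => proj1_sig (constructive_indefinite_description _ (bad N))) => N.
  exact: (proj2_sig (constructive_indefinite_description _ (bad N))).
(* Each bad order is viewed as a Boolean function on all pairs of monomials, so that compactness
   applies although the boxes vary. *)
pose r N (ab : 'X_{1..n} * 'X_{1..n}) :=
  index (exps ab.1) (l N) < index (exps ab.2) (l N).
have [r0 hr0] := bool_cluster r.
pose lt : rel 'X_{1..n} := fun a b => r0 (a, b).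
(* On any finite set of monomials the limit coincides with some bad order of an arbitrarily large
   box that contains the set. *)
have agree (s : seq 'X_{1..n}) K : exists N, [/\ K <= N, M1 <= N,
    forall a, a \in s -> inbox N a &
    forall a b, a \in s -> b \in s ->
      lt a b = (index (exps a) (l N) < index (exps b) (l N))].
  have [B hB] : exists B, forall a, a \in s -> inbox B a.
    apply: uniform_bound => [E E' a EE' /inboxP h|a _].
      by apply/inboxP => i; apply: leq_trans EE'.
    by exists (mdeg a); apply/inboxP => i; rewrite mdegE (bigD1 i) //= leq_addr.
  have [N] := hr0 [seq (a, b) | a <- s, b <- s] (maxn K (maxn M1 B)).
  rewrite geq_max => /andP[KN]; rewrite geq_max => /andP[MN BN] hN; exists N;
    split=> // [a /hB/inboxP h|a b as_ bs].
    by apply/inboxP => i; apply: leq_trans BN.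
  by rewrite /lt -hN //; apply/allpairsP; exists (a, b).
have inl N (a : 'X_{1..n}) : M1 <= N -> inbox N a -> exps a \in l N.
  by move=> /hl[_ /and3P[/allP h _ _] _] ab; apply: h; rewrite mem_box.
(* Each axiom to be checked involves finitely many monomials, so it is inherited from one bad
   order. *)
have hlt : monomial_order lt.
  apply: monomial_order_intro => [a|b a c|a b|a b c|a].
  - by have [N [_ _ _ h]] := agree [:: a] 0; rewrite h ?inE ?eqxx // ltnn.
  - have [N [_ _ _ h]] := agree [:: a; b; c] 0.
    by rewrite !h ?inE ?eqxx ?orbT //; apply: ltn_trans.
  - have [N [_ MN bx h]] := agree [:: a; b] 0.
    rewrite !h ?inE ?eqxx ?orbT //; case: ltngtP => [//|_|e0];
      first by rewrite !orbT.
    rewrite orbF /=; apply/eqP/exps_inj/(index_inj [::] _ _ e0);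
    by apply: inl => //; apply: bx; rewrite !inE eqxx ?orbT.
  - have [N [_ MN bx h]] := agree [:: a; b; c; (a + c)%MM; (b + c)%MM] 0.
    rewrite !h ?inE ?eqxx ?orbT // => ab.
    have [_ /and3P[_ _ /allP/(_ (exps a)) h3] _] := hl N MN; move: h3.
    rewrite mem_box bx ?inE ?eqxx // => /(_ isT)/allP/(_ (exps b)).
    rewrite mem_box bx ?inE ?eqxx ?orbT // => /(_ isT)/allP/(_ (exps c)).
    rewrite mem_box bx ?inE ?eqxx ?orbT // => /(_ isT).
    by rewrite !addvE !mem_box !bx ?inE ?eqxx ?orbT // ab.
  - have [N [_ MN bx h]] := agree [:: a; 0%MM] 0.
    rewrite h ?inE ?eqxx ?orbT // -leqNgt exps0.
    have [_ /and3P[_ /allP/(_ (exps a)) h2 _] _] := hl N MN; apply: h2.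
    by rewrite mem_box bx ?inE ?eqxx.
have [E0 hE0] := finite_basis sI hlt.
(* The test also requires the generators to occur in [F], hence the bound [ES]. *)
pose E := maxn E0 ES; pose F0 t := I t /\ within (inbox E) t.
have hE f a : I f -> within (fun b => ordle lt b a) f ->
    gen (shifts_in F0 (fun b => ordle lt b a)) f.
  move=> If lef; apply: shifts_in_sub (hE0 f a If lef) => // j [Ij jE].
  by split=> //; apply: within_box_le jE; apply: leq_maxl.
(* [T] lists all tiles of I in the box of side [E + E]. It is finite, so the sizes of the
   factorizations below have common bounds. *)
have [T0 hT0] := finite_support_tiles gT [seq mon n s | s <- box n (E + E)].
have [T hT] := classical_filter T0 (fun t => I t /\ within (inbox (E + E)) t).
have inT t : I t -> within (inbox (E + E)) t -> t \in T.
  move=> It tb; apply/hT; split=> //; apply: hT0 => a /tb ab.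
  by apply/mapP; exists (exps a); rewrite ?mem_box // expsK.
have [K1 hK1] : exists K, forall t, t \in T -> forall N,
  K <= N -> window_tiles S N t.
  apply: uniform_bound => [K K' t KK' h N KN|t /hT[_ [It _]]].
    by apply: h; apply: leq_trans KN.
  have /gI/span_gen/gen_bounded[K hK] := It.
  exists K => N KN; apply: (genn_leq KN); move: hK; apply: genn_sub.
  move=> x [hx xK]; split=> // a /xK[_ /inboxP aK].
  by apply/inboxP => i; apply: leq_trans KN.
(* Unlike [K1], which bounds factorizations into shifts of [S], this bounds the factorizations into
   tiles of [F0] that respect the limit order. *)
have [K2 hK2] : exists K, forall t, t \in T -> t = 1%g \/ exists2 a, t a != 1%g &
    genn (shifts_in F0 (fun b => ordle lt b a /\ inbox K b)) K t.
  apply: uniform_bound => [K K' t KK' [|[a ta h]]|t /hT[_ [It _]]].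
  - by left.
  - right; exists a => //; apply: (genn_leq KK'); move: h; apply: genn_sub.
    move=> x [hx xK]; split=> // b /xK[ba /inboxP bK]; split=> //.
    by apply/inboxP => i; apply: leq_trans KK'.
  - have [->|[a ta lea]] := tile_top hlt t; first by exists 0; left.
    by have [K hK] := gen_bounded (hE t a It lea); exists K; right; exists a.
pose K := maxn (E + E) (maxn K1 K2).
have [N [KN MN _ hN]] := agree [seq mon n s | s <- box n K] K.
have inK (a : 'X_{1..n}) : inbox K a -> a \in [seq mon n s | s <- box n K].
  by move=> aK; apply/mapP; exists (exps a); rewrite ?mem_box // expsK.
have [EK K1K K2K] : [/\ E + E <= K, K1 <= K & K2 <= K].
  by rewrite /K; split; lia.
have Sb s : s \in S -> within (inbox N) s.
  by move/hES; apply: within_box_le; apply: leq_trans MN; apply: leq_maxr.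
have [_ _ nc] := hl N MN; have EN : E <= N by lia.
(* On the box of side [K] the bad order [l N] agrees with a true monomial order, and this part of it
   is all that the test with [E] needs in order to succeed. *)
apply: (negP (nc E EN)).
have cW := codes_window he Sb.
have Wb t : window_tiles S N t -> within (inbox N) t by case: cW => h _ _; apply: h.
have WI t : window_tiles S N t -> I t.
  by move/genn_gen => gt; apply/gI/span_gen; apply: shifts_in_sub gt.
have IW t : I t -> within (inbox (E + E)) t -> window_tiles S N t.
  by move=> It tb; apply: hK1; [apply: inT | lia].
pose F t := window_tiles S N t /\ within (inbox E) t.
pose L t := window_tiles S N t /\ within (inbox (E + E)) t.
have cF : codes e N [seq v <- window n (mul_table e) N [seq tvec e N s | s <- S]
    | inbox_vec n (mul_table e) N E v] F.
  by apply: codes_filter cW _ => t /Wb; apply: inbox_vecE.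
have cL : codes e N [seq v <- window n (mul_table e) N [seq tvec e N s | s <- S]
    | inbox_vec n (mul_table e) N (E + E) v] L.
  by apply: codes_filter cW _ => t /Wb; apply: inbox_vecE.
have F0F t : F0 t -> F t.
  by move=> [It tE]; split=> //; apply: IW => //; apply: within_box_le tE; lia.
have [I1 IM _ Is] := sI.
have [_ Fv vF] := cF; have [_ Lv vL] := cL.
apply/and5P; split; first by lia.
- apply/allP => _ /mapP[s sS ->]; apply: Fv; apply: F0F; split.
    by apply/gI => J sJ; apply.
  by apply: within_box_le (hES s sS); apply: leq_maxr.
- apply/allP => _ /vF[j [Wj jE] ->]; apply/allP => _ /boxP[c -> cE].
  rewrite tvec_shift //; last exact: Wb.
  have sE : within (inbox (E + E)) (shift c j).
    apply/within_shift; apply: within_sub jE => b /inboxP bE.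
    by apply/inboxP => i; have := bE i; have /inboxP/(_ i) := cE;
      rewrite mnmDE; lia.
  by apply: Lv; split=> //; apply: IW => //; apply/Is/WI.
- apply/allP => _ /vL[x [Wx xE] ->]; apply/allP => _ /vL[y [Wy yE] ->].
  rewrite tvec_M //; try exact: Wb.
  have xyE := within_M xE yE.
  by apply: Lv; split=> //; apply: IW => //; apply: IM; apply: WI.
- apply/allP => k _; apply/allP => _ /vL[h [Wh hb] ->].
  apply/implyP => /(within_vecE he _ (Wb _ Wh)) hk.
  have cP := codes_prods N he (codes_filter (codes_shifts he cF)
      (fun t (ht : shifts_in F (inbox N) t) => within_vecE he (take k (l N)) ht.2)).
  have [_ Pv _] := cP; apply: Pv.
  case: (hK2 h (inT _ (WI _ Wh) hb)) => [->|[a ha hg]].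
    exact: genn_leq (leq0n _) (genn_1 _).
  have K2N : K2 <= N by lia.
  apply: (genn_leq K2N); move: hg; apply: genn_sub => x [[j [c [F0j xE]]] xK].
  split; first split.
  - by exists j, c; split=> //; apply: F0F.
  - by move=> b /xK[_ /inboxP bK]; apply/inboxP => i; apply: leq_trans K2N.
  (* [a] belongs to the support of [h], hence to the prefix. Both [a] and [b] lie in the box where
     [l N] agrees with [lt], so [b] belongs to the prefix as well. *)
  - move=> b /xK[ba bK2].
    have ak := hk a ha.
    have bN : inbox N b by apply/inboxP => i; have /inboxP/(_ i) := bK2; lia.
    case/orP: ba => [/eqP->//|ba].
    have bK : inbox K b by apply/inboxP => i; have /inboxP/(_ i) := bK2; lia.
    have aK : inbox K a.
      have /inboxP aE := hb a ha.
      by apply/inboxP => i; have := aE i; lia.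
    have al : exps a \in l N by apply: mem_take ak.
    move: ak; rewrite in_take // => ak; rewrite in_take ?inl //.
    by apply: ltn_trans ak; rewrite -hN ?inK.
Qed.

(** * Standard bases and membership *)

Lemma grlex_order n : monomial_order (fun a b : 'X_{1..n} => (a < b)%O).
Proof.
apply: monomial_order_intro => [a|b a c|a b|a b c|a].
- exact: Order.POrderTheory.ltxx.
- exact: Order.POrderTheory.lt_trans.
- by case: Order.TotalTheory.ltgtP.
- by rewrite ltmc_add2l.
- by rewrite -Order.TotalTheory.leNgt le0m.
Qed.

Definition refine n (phi : 'X_{1..n} -> nat) (lt : rel 'X_{1..n}) : rel 'X_{1..n} :=
  fun a b => (phi a < phi b) || (phi a == phi b) && lt a b.

Lemma refine_order n (phi : 'X_{1..n} -> nat) (lt : rel 'X_{1..n}) :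
  {morph phi : a b / (a + b)%MM >-> a + b} -> monomial_order lt ->
  monomial_order (refine phi lt).
Proof.
move=> phiD hlt; have phi0 : phi 0%MM = 0.
  by have := phiD 0%MM 0%MM; rewrite addm0; lia.
rewrite /refine; apply: monomial_order_intro => [a|b a c|a b|a b c|a].
- by rewrite ltnn eqxx (ord_irr hlt).
- case: (ltngtP (phi a) (phi b)) => //= [ab _|-> ab].
    by case: (ltngtP (phi b) (phi c)) => //= [bc|<-] _;
      rewrite ?ab ?(ltn_trans ab bc).
  by case: (ltngtP (phi b) (phi c)) => //= _; apply: (ord_trans hlt ab).
- by case: (ltngtP (phi a) (phi b)) => //= ab; rewrite ?orbT //;
    case: hlt => _ _ + _ _.
- rewrite !phiD ltn_add2r eqn_add2r => /orP[->//|/andP[-> ab]].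
  by rewrite (ord_add hlt) ab orbT.
- by rewrite phi0 ltn0 /= negb_and -(ordleNgt hlt) (ordle_0 hlt) orbT.
Qed.

Lemma refine_le n (phi : 'X_{1..n} -> nat) (lt : rel 'X_{1..n}) a b :
  ordle (refine phi lt) a b -> phi a <= phi b.
Proof. by case/orP => [/eqP->//|/orP[/ltnW//|/andP[/eqP->]]]. Qed.

Lemma refine_eq n (phi : 'X_{1..n} -> nat) (lt : rel 'X_{1..n}) a b :
  ordle (refine phi lt) a b -> phi a = phi b -> ordle lt a b.
Proof.
case/orP => [/eqP-> _|/orP[|/andP[_ ab _]]]; first by rewrite /ordle eqxx.
  by move=> h e; rewrite e ltnn in h.
exact: ord_le.
Qed.

(** * Conversion between codes of tiles and vectors *)

Section InputOutput.
Variables (n : nat) (gT : finGroupType) (e : seq gT) (N : nat).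
Hypothesis he : numbering e.
Notation m := (mul_table e).
Notation code := (elt_code e).
Implicit Types (f t : tile n gT) (cf : seq (seq nat * nat)).

Lemma mem_tile_code f cf s x : tile_code code f cf ->
  ((s, x) \in cf) <-> exists a, [/\ s = exps a, x = code (f a) & f a != 1%g].
Proof.
move=> /perm_mem ->; split=> [/mapP[a]|[a [-> -> fa]]].
  by rewrite mem_finsupp => fa [-> ->]; exists a.
by apply/mapP; exists a; rewrite ?mem_finsupp.
Qed.

Lemma dense_tile_code f cf : tile_code code f cf -> dense n m N cf = tvec e N f.
Proof.
move=> fc; apply: eq_vec => a ab; rewrite expsK (gidE he).
(* At most one pair has the key [a], so the unspecified order of the pairs in [cf] does not affect
   [head]. *)
have -> : [seq p.2 | p <- cf & p.1 == exps a] = [seq code (f a) | _ <- nseq (f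
  a != 1%g) tt].
  apply: perm_small_eq; first by rewrite size_map size_nseq; case: (_ != _).
  apply: perm_trans (perm_map _ (perm_filter _ fc)) _.
  rewrite filter_map -map_comp /=.
  have -> : [seq i <- finsupp f | exps i == exps a] = nseq (f a != 1%g) a.
    rewrite (eq_filter (a2 := pred1 a)); last by move=> i;
      rewrite /= (inj_eq (@exps_inj n)).
    rewrite -mem_finsupp; case: (boolP (a \in finsupp f)) => [af|naf].
      by rewrite filter_pred1_uniq ?fset_uniq.
    by apply/eqP; rewrite -[_ == _]negbK -has_filter has_pred1.
  by case: (_ != _).
case: (eqVneq (f a) 1%g) => [->|] //=.
Qed.

Lemma keys_tile_code f cf : tile_code code f cf ->
  all (fun p => p.1 \in box n N) cf <-> within (inbox N) f.
Proof.
move=> fc; split=> [/allP h a fa|h].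
  by rewrite -mem_box; apply: (h (exps a, code (f a)));
    apply/(mem_tile_code _ _ fc); exists a.
by apply/allP => -[s x] /(mem_tile_code _ _ fc)[a [-> _ /h]]; rewrite /= mem_box.
Qed.

Lemma dense_tiles_code (S : seq (tile n gT)) c : tiles_code code S c ->
  [seq dense n m N x | x <- c] = [seq tvec e N s | s <- S].
Proof.
rewrite /tiles_code; elim: S c => [|s S IHS] [|t c] //= /andP[st /IHS ->].
by rewrite (dense_tile_code st).
Qed.

Lemma keys_tiles_code (S : seq (tile n gT)) c : tiles_code code S c ->
  keys_in_box n N c <-> forall s, s \in S -> within (inbox N) s.
Proof.
rewrite /tiles_code /keys_in_box;
  elim: S c => [|s S IHS] [|t c] //= /andP[st /IHS Sc].
split=> [/andP[/(keys_tile_code st) sb /Sc Sb] x|h].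
  by rewrite inE => /orP[/eqP->|/Sb].
apply/andP; split; first by apply/(keys_tile_code st); apply: h; rewrite mem_head.
by apply/Sc => x xS; apply: h; rewrite inE xS orbT.
Qed.

Lemma sparse_tile_code t : within (inbox N) t ->
  tile_code code t (sparse n m N (tvec e N t)).
Proof.
move=> tb; rewrite /tile_code.
have -> : [seq (tval (multinom_val a), code (t a)) | a <- finsupp t] =
    [seq (s, value n m N (tvec e N t) s) | s <- [seq exps a | a <- finsupp t]].
  by rewrite -map_comp; apply: eq_map => a /=; rewrite value_tvec.
apply: perm_map; apply: uniq_perm.
- by apply: filter_uniq; apply: box_uniq.
- by rewrite map_inj_uniq ?fset_uniq //; apply: exps_inj.
move=> s; apply/(mem_supp_vec he _ tb)/mapP => [[a -> ta]|[a ta ->]].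
  by exists a; rewrite ?mem_finsupp.
by exists a; rewrite -?mem_finsupp.
Qed.

Lemma codes_list V (A : tile n gT -> Prop) : codes e N V A ->
  exists B : seq (tile n gT), [/\ V = [seq tvec e N b | b <- B],
    forall b, b \in B -> A b & forall t, A t -> t \in B].
Proof.
move=> [Ab AV VA].
have [B [VE BA]] : exists B : seq (tile n gT), V = [seq tvec e N b | b <- B] /\
    forall b, b \in B -> A b.
  elim: V VA {AV} => [|v V IHV] VA; first by exists [::].
  have [t At vE] := VA v (mem_head _ _).
  have [u uV|B [-> BA]] := IHV; first by apply: VA; rewrite inE uV orbT.
  by exists (t :: B); rewrite vE; split=> // b; rewrite inE => /orP[/eqP->|/BA].
exists B; split=> // t At; have := AV t At; rewrite VE => /mapP[b bB tb].
by rewrite (tvec_inj he (Ab _ At) (Ab _ (BA b bB)) tb).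
Qed.

End InputOutput.

(** The first condition ensures that [dense] does not silently drop values outside the box. *)
Definition basis_test (n : nat) (m : seq (seq nat)) (c : seq (seq (seq nat * nat)))
    (N : nat) : bool :=
  keys_in_box n N c && universal_test n m N [seq dense n m N t | t <- c].

Definition basis_vecs (n : nat) (m : seq (seq nat)) (c : seq (seq (seq nat * nat)))
    (N : nat) : seq (seq nat) :=
  window n m N [seq dense n m N t | t <- c].

Lemma computable_basis_test {X} {_ : code X} n (m : X -> seq (seq nat)) c N :
  computable m -> computable c -> computable N ->
  computable (fun x => basis_test n (m x) (c x) (N x)).
Proof. by move=> hm hc hN; rewrite /basis_test; comp. Qed.

Lemma computable_basis_vecs {X} {_ : code X} n (m : X -> seq (seq nat)) c N :
  computable m -> computable c -> computable N ->
  computable (fun x => basis_vecs n (m x) (c x) (N x)).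
Proof. by move=> hm hc hN; rewrite /basis_vecs; comp. Qed.

Ltac comp_basis := first [comp_test | lazymatch goal with
  | |- computable (fun _ => basis_test _ _ _ _) => simple apply
    computable_basis_test
  | |- computable (fun _ => basis_vecs _ _ _ _) => simple apply
    computable_basis_vecs
  end].
Ltac comp_defs ::= comp_basis.

Section Basis.
Variables (n : nat) (gT : finGroupType) (e : seq gT) (I : tile n gT -> Prop).
Variable (c : seq (seq (seq nat * nat))).
Hypotheses (he : numbering e) (sI : shift_subgroup I).
Hypothesis (hc : gens_code (elt_code e) I c).

(** The lower bound [M] allows a search to require in addition that the box accommodates other data,
    such as the tile whose membership is asked or the number [d]. *)
Lemma basis_test_complete M :
  exists2 N, M <= N & basis_test n (mul_table e) c N.
Proof.
have [S gS Sc] := hc.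
have [N [MN Sb ut]] := universal_test_complete M he sI gS.
exists N => //; apply/andP; split; first exact/(keys_tiles_code N Sc).
by rewrite (dense_tiles_code N he Sc).
Qed.

Lemma basis_test_sound N : basis_test n (mul_table e) c N ->
  exists A, universal I A /\ codes e N (basis_vecs n (mul_table e) c N) A.
Proof.
have [S gS Sc] := hc; rewrite /basis_test /basis_vecs (dense_tiles_code N he Sc).
move=> /andP[/(keys_tiles_code N Sc) Sb ut].
exists (window_tiles S N); split; last exact: codes_window.
exact: universal_test_sound ut.
Qed.

End Basis.

Section StandardBasis.
Variables (n : nat) (gT : finGroupType) (lt : rel 'X_{1..n}).
Hypothesis hlt : monomial_order lt.
Implicit Types (f g : tile n gT) (a b c : 'X_{1..n}).

Let restr a f : tile n gT := [fsfun b in [fset a]%fset => f b].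

Let restrE a f b : restr a f b = if b == a then f b else 1%g.
Proof. by rewrite fsfunE in_fset1. Qed.

Lemma multideg_top f a : f a != 1%g -> within (fun b => ordle lt b a) f ->
  multideg lt f = a.
Proof.
move=> fa lea; rewrite /multideg; set s := [seq _ <- _ | _].
have sa : a \in s.
  rewrite mem_filter mem_finsupp fa andbT; apply/allP => b.
  by rewrite mem_finsupp => /lea.
have : forall b, b \in s -> b = a.
  move=> b; rewrite mem_filter mem_finsupp => /andP[/allP h fb].
  have := lea b fb; rewrite (ordleNgt hlt) => nab.
  have := h a; rewrite mem_finsupp => /(_ fa).
  by rewrite (negbTE nab) orbF => /eqP.
by case: s sa => // b s _; apply; rewrite mem_head.
Qed.

Lemma LT_top f a : f a != 1%g -> within (fun b => ordle lt b a) f ->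
  LT lt f = restr a f.
Proof. by move=> fa lea; rewrite /LT (multideg_top fa lea). Qed.

(** Restriction to one index is a homomorphism. Applied at the top of [h] to a factorization that
    does not exceed it, it turns each factor into 1 or into a shift of the leading term of a tile of
    [A]. *)
Lemma universal_standard_basis (I A : tile n gT -> Prop) B :
  universal I A -> (forall g, g \in B -> A g) -> (forall g, A g -> g \in B) ->
  standard_basis lt I B.
Proof.
move=> [AI red] BA AB; split=> [g /BA/AI //|f].
have LT1 : LT lt (1%g : tile n gT) = 1%g.
  by apply/fsfunP => b; rewrite fsfunE !tile_1; case: ifP.
split=> spf J sJ hJ; apply: spf => //; last first.
  by move=> g /mapP[h hB ->]; apply: hJ; exists h => //; apply/AI/BA.
have [J1 JM _ Js] := sJ.
move=> g [h Ih ->]; case: (tile_top hlt h) => [->|[a ha lea]]; first by rewrite LT1.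
rewrite (LT_top ha lea);
  elim: (red lt hlt h a Ih lea) => [|x y [[j [c [Aj ->]]] lex] _ Jy].
  by rewrite (_ : restr a 1%g = 1%g) //; apply/fsfunP => b;
    rewrite restrE !tile_1; case: ifP.
have -> : restr a (shift c j * y)%g = (restr a (shift c j) * restr a y)%g.
  by apply/fsfunP => b; rewrite !(restrE, tile_M); case: ifP => //; rewrite mulg1.
apply: JM => //; case: (eqVneq (shift c j a) 1%g) => [e1|ja].
  by rewrite (_ : restr a (shift c j) = 1%g) //; apply/fsfunP => b;
    rewrite restrE tile_1; case: eqP => // ->.
have [d aE jd] := shift_supp ja.
have led : within (fun b => ordle lt b d) j.
  move=> b jb; rewrite -(ordle_add hlt c) -aE; apply: lex.
  by rewrite shift_add.
suff -> : restr a (shift c j) = shift c (LT lt j).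
  by apply/Js/hJ/map_f/AB.
rewrite (LT_top jd led); apply/fsfunP => b; rewrite restrE !shiftE restrE.
case: ifP => [/eqP->|ba]; first by rewrite aE lem_addl addmK eqxx.
by case: ifP => // cb; case: eqP => // bd; rewrite aE -bd submK // eqxx in ba.
Qed.

End StandardBasis.

(** The products all lie in the finite set of tiles supported in the box. The conclusion concerns
    one step only, so that a program can test it; by [genn_stable] one step without growth
    suffices. *)
Lemma gen_stable n (gT : finGroupType) (A : tile n gT -> Prop) N :
  (forall x, A x -> within (inbox N) x) ->
  exists T, forall t, genn A T.+1 t -> genn A T t.
Proof.
move=> Ab; have [U0 hU0] := finite_support_tiles gT [seq mon n s | s <- box n N].
have [U hU] := classical_filter U0 (gen A).
have [T hT] : exists T, forall t, t \in U -> genn A T t.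
  apply: uniform_bound => [k k' t kk'|t /hU[_]]; first exact: genn_leq.
  exact: gen_genn.
exists T => t /genn_gen gt; apply/hT/hU; split=> //; apply: hU0 => a ta.
apply/mapP; exists (exps a); rewrite ?expsK // mem_box.
exact: (gen_within Ab gt ta).
Qed.

Lemma genn_stable n (gT : finGroupType) (A : tile n gT -> Prop) T :
  (forall t, genn A T.+1 t -> genn A T t) -> forall t, gen A t -> genn A T t.
Proof.
move=> st t; elim=> [|x y Ax _ hy]; first exact: (genn_leq (leq0n _) (genn_1 _)).
by apply: st; apply: genn_M.
Qed.

Lemma standard_basis_program n (lt : rel 'X_{1..n}) : monomial_order lt ->
  exists P : recfun,
    forall (gT : finGroupType) (e : seq gT) (I : tile n gT -> Prop)
      (c : seq (seq (seq nat * nat))),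
      numbering e -> shift_subgroup I -> gens_code (elt_code e) I c ->
      exists (B : seq (tile n gT)) (b : seq (seq (seq nat * nat))),
        [/\ standard_basis lt I B, tiles_code (elt_code e) B b
          & eval P [:: encode (mul_table e); encode c] (encode b)].
Proof.
move=> hlt; have [pk hpk] := pack2_program (A := seq (seq nat)) (B :=
  seq (seq (seq nat * nat))).
have [P hP] := search_program pk
  (chk := fun x N => basis_test n x.1 x.2 N)
  (out := fun x N => [seq sparse n x.1 N v | v <- basis_vecs n x.1 x.2 N])
  ltac:(by comp) ltac:(by comp).
exists P => gT e I c he sI hc.
have [|N bt ev] := hP (mul_table e, c) _ (hpk _ _).
  by have [N _ hN] := basis_test_complete he sI hc 0; exists N.
have [A [uA cA]] := basis_test_sound he sI hc bt.
have [B [VE BA AB]] := codes_list he cA.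
exists B, [seq sparse n (mul_table e) N v | v <- basis_vecs n (mul_table e) c
  N]; split.
- exact: universal_standard_basis uA BA AB.
- rewrite VE -map_comp /tiles_code all2E size_map eqxx /=.
  have [Ab _ _] := cA; elim: (B) BA => //= b B' IHB BA.
  rewrite sparse_tile_code //; last by apply/Ab/BA/mem_head.
  by apply: IHB => b' b'B; apply: BA; rewrite inE b'B orbT.
- do !rewrite ?(encode_seq (encode_seq (encode_prod (encode_seq encode_nat)
    encode_nat))) //.
  by rewrite (encode_seq (encode_seq encode_nat)).
Qed.

Lemma computable_chead {X} {_ : code X} (f : X -> nat) :
  computable f -> computable (fun x => chead (f x)).
Proof. move=> hf; exact: (@computable_lift1 _ _ _ _ code_nat code_nat _ _ chead
  recursive_chead (fun=> erefl) hf). Qed.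

Lemma computable_ctail {X} {_ : code X} (f : X -> nat) :
  computable f -> computable (fun x => ctail (f x)).
Proof. move=> hf; exact: (@computable_lift1 _ _ _ _ code_nat code_nat _ _ ctail
  recursive_ctail (fun=> erefl) hf). Qed.

Lemma membership_program n :
  exists P : recfun,
    forall (gT : finGroupType) (e : seq gT) (I : tile n gT -> Prop)
      (c : seq (seq (seq nat * nat))) (f : tile n gT) (cf : seq (seq nat * nat)),
      numbering e -> shift_subgroup I -> gens_code (elt_code e) I c ->
      tile_code (elt_code e) f cf ->
      exists2 r : bool,
        eval P [:: encode (mul_table e); encode c; encode cf] (nat_of_bool r)
        & (r <-> I f).
Proof.
pose V m c w := shifts n m (chead w) (basis_vecs n m c (chead w)).
have [pk hpk] := pack3_program (A := seq (seq nat)) (B := seq (seq (seq nat * nat)))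
  (C := seq (seq nat * nat)).
(* The number [w] codes a pair: a box size, which must also bound the degree of the tile, and a
   product length at which the products inside the box have stabilized. *)
pose chk (x : seq (seq nat) * seq (seq (seq nat * nat)) * seq (seq nat * nat)) w :=
  [&& basis_test n x.1.1 x.1.2 (chead w),
      all (fun p => sumn p.1 <= chead w) x.2
    & all (fun v => v \in prods n x.1.1 (chead w) (ctail w) (V x.1.1 x.1.2 w))
        (prods n x.1.1 (chead w) (ctail w).+1 (V x.1.1 x.1.2 w))].
pose out (x : seq (seq nat) * seq (seq (seq nat * nat)) * seq (seq nat * nat)) w :=
  dense n x.1.1 (chead w) x.2 \in prods n x.1.1 (chead w) (ctail w) (V x.1.1
    x.1.2 w).
have [||P hP] := search_program pk (chk := chk) (out := out).
- by rewrite /chk /V; comp;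
    first [apply: computable_chead | apply: computable_ctail]; comp.
- by rewrite /out /V; comp;
    first [apply: computable_chead | apply: computable_ctail]; comp.
exists P => gT e I c f cf he sI hc fc.
have fdeg N : all (fun p => sumn p.1 <= N) cf <-> forall a,
  f a != 1%g -> mdeg a <= N.
  split=> [/allP h a fa|h].
    rewrite /mdeg -sumnE; apply: (h (exps a, elt_code e (f a))).
    by apply/(mem_tile_code _ _ fc); exists a.
  apply/allP => -[s x] /(mem_tile_code _ _ fc)[a [-> _ /h]].
  by rewrite /mdeg -sumnE.
have [|w] := hP (mul_table e, c, cf) _ (hpk _ _ _).
  have [D hD] : exists D, forall a, a \in finsupp f -> mdeg a <= D.
    apply: uniform_bound => [k k' a kk' h|a _]; first exact: leq_trans h kk'.
    by exists (mdeg a).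
  have [N DN bt] := basis_test_complete he sI hc D.
  have [A [uA cA]] := basis_test_sound he sI hc bt.
  have cS := codes_shifts he cA.
  have [T hT] : exists T, forall t, genn (shifts_in A (inbox N)) T.+1 t ->
      genn (shifts_in A (inbox N)) T t.
    by apply: (@gen_stable _ _ _ N) => x [].
  exists (ccons N T); rewrite /chk /V !cconsK !ctailK /= bt /=.
  apply/andP; split.
    apply/fdeg => a fa; apply: leq_trans DN; apply: hD.
    by rewrite mem_finsupp.
  have [_ _ VA] := codes_prods T.+1 he cS; have [_ AV _] := codes_prods T he cS.
  by apply/allP => v /VA[t ht' ->]; apply/AV/hT.
set N := chead w; set T := ctail w; move=> /and3P[bt /fdeg df /allP st] ev.
exists (out (mul_table e, c, cf) w).
  rewrite (encode_seq (encode_seq (encode_prod (encode_seq encode_nat)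
    encode_nat))).
  rewrite (encode_seq (encode_seq encode_nat)).
  by rewrite (encode_seq (encode_prod (encode_seq encode_nat) encode_nat)).
have [A [uA cA]] := basis_test_sound he sI hc bt.
have cS := codes_shifts he cA.
have fb : within (inbox N) f.
  move=> a /df ha; apply/inboxP => i; apply: leq_trans ha.
  by rewrite mdegE (bigD1 i) //= leq_addr.
rewrite /out /= (dense_tile_code _ he fc) -/N -/T /V -/N.
apply: (iff_trans (codesP he (codes_prods T he cS) fb)); split.
  move/genn_gen => gf; have [AI _] := uA.
  exact: shift_subgroup_gen sI AI gf.
move=> If; have hT : forall t, genn (shifts_in A (inbox N)) T.+1 t ->
    genn (shifts_in A (inbox N)) T t.
  move=> t ht'; have [Ab AV VA] := codes_prods T.+1 he cS.
  apply/(codesP he (codes_prods T he cS)); first exact: Ab.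
  by apply: st; apply: AV.
apply: (genn_stable hT).
(* The factors provided by the degree order have no larger degree than [f], hence lie in the box
   already. *)
case: (tile_top (grlex_order n) f) => [->|[a fa lea]]; first exact: gen_1.
have [_ /(_ _ (grlex_order n) f a If lea)] := uA.
apply: shifts_in_sub => // b /orP[/eqP->|/Order.POrderTheory.ltW/lemc_mdeg ba].
  exact: fb.
apply/inboxP => i; apply: leq_trans (leq_trans ba (df a fa)).
by rewrite mdegE (bigD1 i) //= leq_addr.
Qed.

(** * Variable elimination *)

Section ConsMonomials.
Variable n : nat.
Implicit Types (a b : 'X_{1..n}) (c d : 'X_{1..n.+1}).

Lemma exps_mcons i a : exps (mcons i a) = i :: exps a.
Proof. by []. Qed.

Lemma exps_mbehead c : exps (mbehead c) = behead (exps c).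
Proof. by []. Qed.

Lemma mconsK i a : mbehead (mcons i a) = a.
Proof. by apply: exps_inj. Qed.

Lemma mcons_mbehead c : mcons (c ord0) (mbehead c) = c.
Proof.
apply: exps_inj; rewrite exps_mcons exps_mbehead -nth_exps.
by have := size_exps c; case: (exps c).
Qed.

Lemma mcons0E i a : mcons i a ord0 = i.
Proof. by rewrite -nth_exps. Qed.

Lemma mconsSE i a j : mcons i a (lift ord0 j) = a j.
Proof. by rewrite -!nth_exps exps_mcons. Qed.

Lemma mbeheadE c j : mbehead c j = c (lift ord0 j).
Proof. by rewrite -{2}[c]mcons_mbehead mconsSE. Qed.

Lemma mcons_eqP c d : c ord0 = d ord0 -> mbehead c = mbehead d -> c = d.
Proof. by move=> e0 eb; rewrite -[c]mcons_mbehead e0 eb mcons_mbehead. Qed.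

Lemma forall_ord_split (P : 'I_n.+1 -> Prop) :
  (forall i, P i) <-> P ord0 /\ forall j, P (lift ord0 j).
Proof.
split=> [h|[h0 hS] i]; first by split.
by case: (unliftP ord0 i) => [j ->|->].
Qed.

Lemma mcons_lem i a c : (mcons i a <= c)%MM = (i <= c ord0) && (a <= mbehead c)%MM.
Proof.
apply/mnm_lepP/andP => [h|[h0 /mnm_lepP h]].
  split; first by have := h ord0; rewrite mcons0E.
  by apply/mnm_lepP => j; have := h (lift ord0 j); rewrite mconsSE mbeheadE.
apply/forall_ord_split; rewrite mcons0E; split=> // j.
by have := h j; rewrite mconsSE mbeheadE.
Qed.

Lemma lem_mcons c i a : (c <= mcons i a)%MM = (c ord0 <= i) && (mbehead c <= a)%MM.
Proof. by rewrite -{1}[c]mcons_mbehead mcons_lem mcons0E mconsK. Qed.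

Lemma mconsD i j a b : (mcons i a + mcons j b)%MM = mcons (i + j) (a + b)%MM.
Proof.
apply/mnmP; apply/forall_ord_split.
by split=> [|k]; rewrite mnmDE ?mcons0E // !mconsSE mnmDE.
Qed.

Lemma mbeheadD c d : mbehead (c + d)%MM = (mbehead c + mbehead d)%MM.
Proof. by apply/mnmP => j; rewrite !(mbeheadE, mnmDE). Qed.

Lemma mbeheadB c d : mbehead (c - d)%MM = (mbehead c - mbehead d)%MM.
Proof. by apply/mnmP => j; rewrite !(mbeheadE, mnmBE). Qed.

Lemma mdeg_mcons i a : mdeg (mcons i a) = i + mdeg a.
Proof.
rewrite !mdegE big_ord_recl mcons0E; congr (_ + _).
by apply: eq_bigr => j _; rewrite mconsSE.
Qed.

Lemma mdeg_mbehead c : mdeg c = c ord0 + mdeg (mbehead c).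
Proof. by rewrite -{1}[c]mcons_mbehead mdeg_mcons. Qed.

Lemma inbox_mcons N i a : inbox N (mcons i a) = (i <= N) && inbox N a.
Proof.
apply/inboxP/andP => [h|[h0 /inboxP h]].
  split; first by have := h ord0; rewrite mcons0E.
  by apply/inboxP => j; have := h (lift ord0 j); rewrite mconsSE.
by apply/forall_ord_split; rewrite mcons0E; split=> // j; rewrite mconsSE.
Qed.

End ConsMonomials.

Definition hat_value n m N d (v a : seq nat) : seq nat :=
  [seq value n.+1 m N v (k :: a) | k <- iota 0 d].

Definition id_values m d : seq nat := [seq gid m | k <- iota 0 d].

Definition hat_code n m N d (v : seq nat) : seq (seq nat * seq nat) :=
  [seq (a, hat_value n m N d v a) | a <- box n N
    & hat_value n m N d v a != id_values m d].

Lemma computable_hat_value {X} {_ : code X} n m N d v a :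
  computable m -> computable N -> computable d -> computable v -> computable a ->
  computable (fun x : X => hat_value n (m x) (N x) (d x) (v x) (a x)).
Proof. by move=> hm hN hd hv ha; rewrite /hat_value; comp. Qed.

Lemma computable_id_values {X} {_ : code X} m d : computable m -> computable d ->
  computable (fun x : X => id_values (m x) (d x)).
Proof. by move=> hm hd; rewrite /id_values; comp. Qed.

Ltac comp_hat := first [comp_basis | lazymatch goal with
  | |- computable (fun _ => hat_value _ _ _ _ _ _) => simple apply
    computable_hat_value
  | |- computable (fun _ => id_values _ _) => simple apply computable_id_values
  end].
Ltac comp_defs ::= comp_hat.

Lemma computable_hat_code {X} {_ : code X} n m N d v :
  computable m -> computable N -> computable d -> computable v ->
  computable (fun x : X => hat_code n (m x) (N x) (d x) (v x)).
Proof. by move=> hm hN hd hv; rewrite /hat_code; comp. Qed.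

Ltac comp_hat_code := first [comp_hat | lazymatch goal with
  | |- computable (fun _ => hat_code _ _ _ _ _) => simple apply computable_hat_code
  end].
Ltac comp_defs ::= comp_hat_code.

Section Hat.
Variables (n d : nat) (gT : finGroupType) (e : seq gT).
Hypothesis he : numbering e.
Implicit Types (f g : tile n.+1 gT) (a b : 'X_{1..n}).

Lemma ffunM (I : finType) (x y : {ffun I -> gT}) i : (x * y)%g i = (x i * y i)%g.
Proof. by rewrite ffunE. Qed.

Lemma ffun_1 (I : finType) (i : I) : (1%g : {ffun I -> gT}) i = 1%g.
Proof. by rewrite ffunE. Qed.

Lemma hat_M f g : hat d (f * g)%g = (hat d f * hat d g)%g.
Proof. by apply/fsfunP => a; apply/ffunP => i;
  rewrite tile_M ffunM !hatE tile_M. Qed.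

Lemma hat_1 : hat d (1%g : tile n.+1 gT) = 1%g.
Proof. by apply/fsfunP => a; apply/ffunP => i; rewrite hatE !tile_1 ffun_1. Qed.

Lemma hat_V f : hat d (f^-1)%g = ((hat d f)^-1)%g.
Proof. by apply/(mulgI (hat d f)); rewrite mulgV -hat_M mulgV hat_1. Qed.

Lemma hat_shift b f : hat d (shift (mcons 0 b) f) = shift b (hat d f).
Proof.
apply/fsfunP => a; apply/ffunP => i; rewrite hatE !shiftE mcons_lem mconsK leq0n /=.
case: ifP => ba; rewrite ?ffun_1 // hatE; congr (f _).
by apply: mcons_eqP; rewrite ?mnmBE ?mbeheadB ?mcons0E ?mconsK ?subn0.
Qed.

Lemma hat_valueE N f a : within (inbox N) f ->
  hat_value n (mul_table e) N d (tvec e N f) (exps a) = vec_code e (hat d f a).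
Proof.
move=> fb; rewrite /hat_value /vec_code -val_enum_ord -map_comp.
apply: eq_map => i /=; rewrite -exps_mcons value_tvec //.
by rewrite -(hatE f a i).
Qed.

Lemma vec_code_inj : injective (vec_code e (d := d)).
Proof.
move=> x y /eq_in_map xy; apply/ffunP => i; apply: (elt_code_inj he).
by apply: xy; rewrite mem_enum.
Qed.

Lemma vec_code_1 : vec_code e (1%g : {ffun 'I_d -> gT}) = id_values (mul_table e) d.
Proof.
rewrite /vec_code /id_values -val_enum_ord -map_comp; apply: eq_map => i /=.
by rewrite ffun_1 gidE.
Qed.

Lemma hat_code_tile N f : within (inbox N) f ->
  tile_code (vec_code e) (hat d f) (hat_code n (mul_table e) N d (tvec e N f)).
Proof.
move=> fb; rewrite /tile_code /hat_code.
have -> : [seq (tval (multinom_val a),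
  vec_code e (hat d f a)) | a <- finsupp (hat d f)]
    = [seq (s, hat_value n (mul_table e) N d (tvec e N f) s) | s <- [seq exps a
      | a <- finsupp (hat d f)]].
  by rewrite -map_comp; apply: eq_map => a /=; rewrite hat_valueE.
apply: perm_map; apply: uniq_perm.
- by apply: filter_uniq; apply: box_uniq.
- by rewrite map_inj_uniq ?fset_uniq //; apply: exps_inj.
move=> s; rewrite mem_filter -vec_code_1;
  apply/andP/mapP => [[hs /boxP[a sE ab]]|[a ha ->]].
  exists a => //; rewrite mem_finsupp; apply: contra_neq hs => ha.
  by rewrite sE hat_valueE // ha.
move: ha; rewrite mem_finsupp hat_valueE // (inj_eq vec_code_inj) mem_box => ha.
split=> //; suff [i] : exists i, f (mcons i a) != 1%g.
  by move=> /fb; rewrite inbox_mcons => /andP[].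
apply: NNPP => h; case/eqP: ha; apply/ffunP => i; rewrite hatE ffun_1.
by apply/eqP; rewrite -[_ == _]negbK; apply/negP => fi; apply: h; exists i.
Qed.

End Hat.

Lemma elimination_program n :
  exists P : recfun,
    forall (gT : finGroupType) (e : seq gT) (I : tile n.+1 gT -> Prop)
      (c : seq (seq (seq nat * nat))) (d : nat),
      numbering e -> shift_subgroup I -> gens_code (elt_code e) I c -> 0 < d ->
      exists2 c' : seq (seq (seq nat * seq nat)),
        gens_code (vec_code e) (elimination d I) c'
        & eval P [:: encode (mul_table e); encode c; d] (encode c').
Proof.
have [pk hpk] := pack3_program (A := seq (seq nat)) (B := seq (seq (seq nat * nat)))
  (C := nat).
pose low m N d v := all (fun a => nth 0 a 0 < d) (supp_vec n.+1 m N v).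
(* The shifts acting on tiles of the form [hat d f] do not move the first coordinate, so shifts in
   that direction have to be listed among the generators. *)
pose out (x : seq (seq nat) * seq (seq (seq nat * nat)) * nat) N :=
  [seq hat_code n x.1.1 N x.2 v
  | v <- shifts n.+1 x.1.1 N (basis_vecs n.+1 x.1.1 x.1.2 N) & low x.1.1 N x.2 v].
have [||P hP] := search_program pk
  (chk := fun x N => basis_test n.+1 x.1.1 x.1.2 N && (x.2 <= N)) (out := out).
- by comp.
- by rewrite /out /low; comp.
exists P => gT e I c d he sI hc d0.
have [|N /andP[bt dN] ev] := hP (mul_table e, c, d) _ (hpk _ _ _).
  have [N dN bt] := basis_test_complete he sI hc d.
  by exists N => /=; rewrite bt dN.
have [A [uA cA]] := basis_test_sound he sI hc bt.
have [AI red] := uA; have [Ab _ _] := cA.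
have cS := codes_shifts he cA.
have Sb t : shifts_in A (inbox N) t -> within (inbox N) t by case.
pose small t := within (fun a : 'X_{1..n.+1} => a ord0 < d) t.
have cL : codes e N [seq v <- shifts n.+1 (mul_table e) N
      (basis_vecs n.+1 (mul_table e) c N) | low (mul_table e) N d v]
    (fun t => shifts_in A (inbox N) t /\ small gT t).
  apply: codes_filter cS _ => t /Sb tb.
  apply: (iff_trans (all_supp_vec he _ tb)).
  by split; apply: within_sub => a; rewrite (nth_exps a ord0).
have [B [VE BA AB]] := codes_list he cL.
exists (out (mul_table e, c, d) N); last first.
  rewrite (encode_seq (encode_seq (encode_prod (encode_seq encode_nat)
    encode_nat))).
  rewrite (encode_seq (encode_seq (encode_prod (encode_seq encode_nat)
    (encode_seq encode_nat)))).
  by rewrite (encode_seq (encode_seq encode_nat)).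
exists [seq hat d b | b <- B]; last first.
  rewrite /out VE -map_comp /tiles_code all2E !size_map eqxx /=.
  elim: (B) BA => //= b B' IHB BA.
  rewrite hat_code_tile //; last by have [/Sb] := BA b (mem_head _ _).
  by apply: IHB => b' b'B; apply: BA; rewrite inE b'B orbT.
have [I1 IM IV Is] := sI.
have elim_sub : shift_subgroup (elimination d I).
  split=> [|_ _ [f [If fd ->]] [g [Ig gd ->]]|_ [f [If fd ->]]|b _ [f [If fd ->]]].
  - by exists 1%g; rewrite hat_1; split=> // a; rewrite mem_finsupp tile_1 eqxx.
  - exists (f * g)%g; rewrite hat_M; split=> // [|a]; first exact: IM.
    rewrite mem_finsupp => fga; have h := @within_M _ _ (fun a => a ord0 < d) f g.
    by apply: h fga => a'; rewrite -mem_finsupp; [apply: fd | apply: gd].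
  - exists (f^-1)%g; rewrite hat_V; split=> // [|a]; first exact: IV.
    by rewrite mem_finsupp tile_V invg_eq1 -mem_finsupp; apply: fd.
  - exists (shift (mcons 0 b) f); rewrite hat_shift; split=> // [|a];
      first exact: Is.
    rewrite mem_finsupp => /shift_supp[a' -> fa'].
    by rewrite mnmDE mcons0E addn0; apply: fd; rewrite mem_finsupp.
move=> h; split=> [|[f [If fd ->]] J sJ BJ].
  apply=> // _ /mapP[b /BA[[[j [c' [Aj ->]]] jb] sm] ->].
  exists (shift c' j); split=> // [|a]; first by apply/Is/AI.
  by rewrite mem_finsupp => /sm.
have [J1 JM _ Js] := sJ.
(* For this order, a factor that does not exceed a top with first exponent below [d] is supported
   entirely below [d]. *)
have hlt := @refine_order n.+1 (fun a => a ord0) _ (fun a b => mnmDE _ a b)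
  (grlex_order n.+1).
case: (tile_top hlt f) => [->|[a fa lea]]; first by rewrite hat_1.
have ad : a ord0 < d by apply: fd; rewrite mem_finsupp.
elim: (red _ hlt f a If lea) => [|x y [[j [c' [Aj xE]]] lex] _ Jy];
  first by rewrite hat_1.
rewrite hat_M; apply: JM => //.
(* The shift splits into a part along the first variable, which is built into the listed generator,
   and a part that acts after [hat]. *)
have cE : c' = (mcons 0 (mbehead c') + mcons (c' ord0) 0)%MM.
  by rewrite mconsD add0n addm0 mcons_mbehead.
have xE' : x = shift (mcons 0 (mbehead c')) (shift (mcons (c' ord0) 0%MM) j).
  by rewrite shift_shift -cE.
rewrite xE' hat_shift; apply: Js; apply: BJ; apply: map_f; apply: AB.
have sm : small gT (shift (mcons (c' ord0) 0%MM) j).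
  move: lex; rewrite xE' => /within_shift; apply: within_sub => b.
  by move/refine_le; rewrite mnmDE mcons0E addn0 => /leq_ltn_trans; apply.
split=> //; split; first by exists j, (mcons (c' ord0) 0%MM).
(* The listed shift moves only the first coordinate, which stays below [d <= N]; this is why the
   search requires [d <= N]. *)
move=> b hb; have := sm b hb; have [b' bE jb'] := shift_supp hb.
rewrite -[b]mcons_mbehead inbox_mcons mcons0E => bd.
apply/andP; split; first by apply: leq_trans dN; apply: ltnW.
rewrite bE mbeheadD mconsK addm0.
by have := Ab j Aj b' jb'; rewrite -{1}[b']mcons_mbehead inbox_mcons => /andP[].
Qed.

(** * Saturation *)

Section Homogenization.
Variables (n : nat) (gT : finGroupType).
Implicit Types (f g : tile n gT) (q : tile n.+1 gT) (a : 'X_{1..n}) (b c :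
  'X_{1..n.+1}).

(* The part of degree [k] of the homogenization, the first coordinate being the
   homogenizing variable; it is the whole of [f] when [k] bounds its degree. *)
Definition homogenize k f : tile n.+1 gT :=
  [fsfun b in [fset mcons (k - mdeg a) a | a in finsupp f]%fset =>
    if mdeg b == k then f (mbehead b) else 1%g].

Lemma homogE k f b : homogenize k f b = if mdeg b == k then f (mbehead b) else 1%g.
Proof.
rewrite fsfunE; case: ifP => // nb; case: eqP => // bk; apply/esym/eqP.
rewrite -[_ == _]negbK -mem_finsupp; apply/negP => fb.
case/negP: (negbT nb); apply/imfsetP; exists (mbehead b) => //=.
by rewrite -bk mdeg_mbehead addnK mcons_mbehead.
Qed.

(** Setting the homogenizing variable to 1 in all degrees at once would multiply values of different
    degrees, which is not a homomorphism over a noncommutative group. In one fixed degree, each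
    value comes from a single monomial. *)
Definition dehomogenize k q : tile n gT :=
  [fsfun a in [fset mbehead b | b in finsupp q]%fset =>
    if mdeg a <= k then q (mcons (k - mdeg a) a) else 1%g].

Lemma dehomogE k q a :
  dehomogenize k q a = if mdeg a <= k then q (mcons (k - mdeg a) a) else 1%g.
Proof.
rewrite fsfunE; case: ifP => // na; case: ifP => // ak; apply/esym/eqP.
rewrite -[_ == _]negbK -mem_finsupp; apply/negP => qa.
case/negP: (negbT na); apply/imfsetP; exists (mcons (k - mdeg a) a) => //=.
by rewrite mconsK.
Qed.

Lemma homog_M k f g : homogenize k (f * g)%g = (homogenize k f * homogenize k g)%g.
Proof.
apply/fsfunP => b; rewrite tile_M !homogE; case: ifP => _; last by rewrite mulg1.
by rewrite tile_M.
Qed.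

Lemma homog_1 k : homogenize k (1%g : tile n gT) = 1%g.
Proof. by apply/fsfunP => b; rewrite homogE !tile_1; case: ifP. Qed.

Lemma dehomog_M k q q' : dehomogenize k (q * q')%g = (dehomogenize k q *
  dehomogenize k q')%g.
Proof.
apply/fsfunP => b; rewrite tile_M !dehomogE; case: ifP => _; last by rewrite mulg1.
by rewrite tile_M.
Qed.

Lemma dehomog_1 k : dehomogenize k (1%g : tile n.+1 gT) = 1%g.
Proof. by apply/fsfunP => b; rewrite dehomogE !tile_1; case: ifP. Qed.

Lemma dehomog_homog k f : within (fun a => mdeg a <= k) f -> dehomogenize k
  (homogenize k f) = f.
Proof.
move=> fk; apply/fsfunP => a; rewrite dehomogE homogE mdeg_mcons mconsK.
case: ifP => [ak|/negP nak]; first by rewrite subnK // eqxx.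
by apply/esym/eqP; rewrite -[_ == _]negbK; apply/negP => /fk.
Qed.

(** The degree determines the exponent of the homogenizing variable, so [c] enters only through its
    degree and its other exponents. *)
Lemma dehomog_shift k c q : dehomogenize k (shift c q) =
  if mdeg c <= k then shift (mbehead c) (dehomogenize (k - mdeg c) q) else 1%g.
Proof.
apply/fsfunP => a; rewrite dehomogE; case: ifP => [ak|nak]; last first.
  case: ifP => ck; last by rewrite tile_1.
  rewrite shiftE dehomogE; case: ifP => // /submK ca; case: ifP => // h.
  move: nak; rewrite -ca mdegD; move: ck h; rewrite (mdeg_mbehead c); lia.
rewrite shiftE lem_mcons [in RHS](fun_if (fun f => f a)) tile_1.
rewrite shiftE dehomogE; case: (boolP (mbehead c <= a)%MM) => [ca|_];
  last by rewrite andbF if_same.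
have aE := congr1 (@mdeg n) (submK ca); rewrite mdegD in aE.
have cE := mdeg_mbehead c.
have -> : (mcons (k - mdeg a) a - c)%MM = mcons (k - mdeg a - c ord0) (a -
  mbehead c)%MM.
  by apply: mcons_eqP; rewrite ?mnmBE ?mcons0E // mbeheadB !mconsK.
rewrite andbT; case: (leqP (c ord0) (k - mdeg a)) => h; last first.
  by case: ifP => // h1; case: ifP => // h2; lia.
rewrite ifT; last by lia.
rewrite ifT; last by lia.
by congr (q (mcons _ _)); lia.
Qed.

Lemma homog_shift D k a f : within (fun a => mdeg a <= D) f -> D + mdeg a <= k ->
  homogenize k (shift a f) = shift (mcons (k - D - mdeg a) a) (homogenize D f).
Proof.
move=> fD Dk; apply/fsfunP => b; rewrite homogE !shiftE mcons_lem homogE.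
case: (boolP (a <= mbehead b)%MM) => [ab|_]; last by rewrite andbF; case: ifP.
rewrite andbT; have bE := mdeg_mbehead b.
have dE := congr1 (@mdeg n) (submK ab); rewrite mdegD in dE.
have -> : mbehead (b - mcons (k - D - mdeg a) a)%MM = (mbehead b - a)%MM.
  by rewrite mbeheadB mconsK.
have eE : k - D - mdeg a <= b ord0 ->
    mdeg (b - mcons (k - D - mdeg a) a)%MM = mdeg b - (k - D).
  by move=> h; rewrite mdeg_mbehead mnmBE mbeheadB mconsK mcons0E; lia.
case: (eqVneq (f (mbehead b - a)%MM) 1%g) => [->|/fD fb]; first by rewrite !if_same.
case: eqP => bk; first by rewrite ifT; [rewrite eE ?ifT //; lia | lia].
case: ifP => // h; rewrite eE // ifF //; apply/eqP; lia.
Qed.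

End Homogenization.

Section Unshift.
Variables (n : nat) (gT : finGroupType).
Implicit Types (f : tile n gT) (a c : 'X_{1..n}).

Definition unshift c f : tile n gT :=
  [fsfun a in [fset (b - c)%MM | b in finsupp f]%fset => f (a + c)%MM].

Lemma unshiftE c f a : unshift c f a = f (a + c)%MM.
Proof.
rewrite fsfunE; case: ifP => // na; apply/esym/eqP.
rewrite -[_ == _]negbK -mem_finsupp; apply/negP => fa.
case/negP: (negbT na); apply/imfsetP; exists (a + c)%MM => //=.
by rewrite addmK.
Qed.

Lemma shift_unshift c f : within (fun a => c <= a)%MM f -> shift c (unshift c
  f) = f.
Proof.
move=> fc; apply/fsfunP => a; rewrite shiftE unshiftE;
  case: ifP => [/submK->//|/negP na].
by apply/esym/eqP; rewrite -[_ == _]negbK; apply/negP => /fc.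
Qed.

End Unshift.

Lemma mulm_add n (c : 'X_{1..n}) s t : (c *+ (s + t))%MM = (c *+ s + c *+ t)%MM.
Proof. by apply/mnmP => i; rewrite mnmDE !mulmnE mulnDr. Qed.

Lemma unit_mulm_lem n (i : 'I_n) t (a : 'X_{1..n}) : (U_(i) *+ t <= a)%MM = (t
  <= a i).
Proof.
apply/mnm_lepP/idP => [/(_ i)|h j]; first by rewrite mulmnE mnm1E eqxx mul1n.
by rewrite mulmnE mnm1E; case: eqP => [<-|_]; rewrite ?mul1n.
Qed.

Lemma saturation_shift_subgroup n (gT : finGroupType) (I : tile n.+1 gT -> Prop) :
  shift_subgroup I -> shift_subgroup (saturation I).
Proof.
move=> [I1 IM IV Is].
have up t s (f : tile n.+1 gT) : I (shift (U_(ord_max) *+ t)%MM f) ->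
    I (shift (U_(ord_max) *+ (s + t))%MM f).
  by move/(Is (U_(ord_max) *+ s)%MM); rewrite shift_shift mulm_add.
split=> [|f g [t ft] [s gs]|f [t ft]|b f [t ft]].
- by exists 0; rewrite shift_1.
- by exists (s + t); rewrite shift_mul; apply: IM; [apply: up | rewrite addnC;
    apply: up].
- exists t; suff -> : shift (U_(ord_max) *+ t)%MM (f^-1)%g = (shift
    (U_(ord_max) *+ t)%MM f)^-1%g by apply: IV.
  by apply/(mulgI (shift (U_(ord_max) *+ t)%MM f));
    rewrite -shift_mul !mulgV shift_1.
- by exists t; rewrite shift_shift addmC -shift_shift; apply: Is.
Qed.

Section HomogeneousSpan.
Variables (n : nat) (gT : finGroupType) (S : seq (tile n gT)) (D : nat).
Hypothesis S_deg : forall s, s \in S -> within (fun a => mdeg a <= D) s.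

Definition homog_span : tile n.+1 gT -> Prop :=
  Defs.span (fun q => q \in [seq homogenize D s | s <- S]).

(** All generators are homogenized in the same degree [D], so the degree [k] part of a shifted one
    is either everything or trivial. *)
Lemma dehomog_span I k q : shift_subgroup I -> generates S I -> homog_span q ->
  I (dehomogenize k q).
Proof.
move=> sI gS /span_gen; have [I1 IM _ Is] := sI.
elim=> [|x y [[j [c [/mapP[s sS ->] ->]]] _] _ IH]; first by rewrite dehomog_1.
rewrite dehomog_M; apply: IM => //; rewrite dehomog_shift; case: ifP => // _.
apply: Is; have [->|kD] := eqVneq (k - mdeg c) D.
  rewrite (dehomog_homog (S_deg sS)).
  by apply: (proj1 (gS s)) => J _; apply.
rewrite (_ : dehomogenize _ _ = 1%g) //; apply/fsfunP => a.
rewrite dehomogE tile_1 homogE mdeg_mcons; case: ifP => // ak.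
by rewrite subnK // (negbTE kD).
Qed.

(** Once [k] is large enough for every factor, the missing degree is supplied by a shift in the
    homogenizing variable. *)
Lemma homog_in_span I f : generates S I -> I f ->
  exists k0, forall k, k0 <= k -> homog_span (homogenize k f).
Proof.
move=> gS /gS/span_gen.
have QM (x y : tile n.+1 gT) : homog_span x -> homog_span y -> homog_span (x * y)%g.
  by move=> hx hy J sJ SJ; have [_ JM _ _] := sJ; apply: JM;
    [apply: hx | apply: hy].
elim=> [|x y [[s [a [sS ->]]] _] _ [k0 hk0]].
  by exists 0 => k _; rewrite homog_1 => J [].
exists (maxn k0 (D + mdeg a)) => k; rewrite geq_max => /andP[/hk0 hy Dk].
rewrite homog_M; apply: QM => //; rewrite (homog_shift (S_deg sS) Dk).
move=> J sJ SJ; have [_ _ _ Js] := sJ.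
by apply/Js/SJ/map_f.
Qed.

End HomogeneousSpan.

(* Among monomials of the same degree, those with a smaller last exponent are
   larger; hence if the top of a homogeneous tile is divisible by a power of that
   variable then so is the tile. *)
Definition revlex_last n : rel 'X_{1..n.+1} :=
  refine (@mdeg n.+1) (refine (fun a => mdeg a - a ord_max) (fun a b => (a < b)%O)).

Lemma revlex_last_order n : monomial_order (@revlex_last n).
Proof.
have le_mdeg (a : 'X_{1..n.+1}) : a ord_max <= mdeg a.
  by rewrite mdegE (bigD1 ord_max) //= leq_addr.
apply: refine_order; first by move=> a b; rewrite mdegD.
apply: refine_order; last exact: grlex_order.
by move=> a b; rewrite mdegD mnmDE; have := le_mdeg a; have := le_mdeg b; lia.
Qed.

Lemma revlex_last_le n (a b : 'X_{1..n.+1}) :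
  ordle (@revlex_last n) a b -> mdeg a = mdeg b -> b ord_max <= a ord_max.
Proof.
move=> ab e; have := refine_le (refine_eq ab e).
have : b ord_max <= mdeg b by rewrite mdegE (bigD1 ord_max) //= leq_addr.
by rewrite e; lia.
Qed.

Lemma inbox_mdeg n N (a : 'X_{1..n}) : inbox N a -> mdeg a <= iter n (addn N) 0.
Proof.
move=> /inboxP h; rewrite iter_addn_0 mdegE.
apply: (@leq_trans (\sum_(i < n) N)); first by apply: leq_sum => i _; apply: h.
by rewrite sum_nat_const card_ord mulnC.
Qed.

Lemma mbehead_max n (b : 'X_{1..n.+2}) : mbehead b ord_max = b ord_max.
Proof. by rewrite mbeheadE; congr (fun_of_multinom b _); apply: val_inj. Qed.

Section Saturation.
Variables (n : nat) (gT : finGroupType) (S : seq (tile n.+1 gT)) (D N : nat).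
Variables (I : tile n.+1 gT -> Prop) (A : tile n.+2 gT -> Prop).
Hypothesis S_deg : forall s, s \in S -> within (fun a => mdeg a <= D) s.
Hypotheses (sI : shift_subgroup I) (gS : generates S I).
Hypotheses (uA : universal (homog_span S D) A).
Hypothesis A_box : forall t, A t -> within (inbox N) t.

(** Tiles of [A] need not be homogeneous, so each degree is treated separately and divided by a
    power of the last variable that divides this part. The bounds on [k] and [t] make the set
    finite; the iterated sum is [n.+2 * N], in a form covered by [comp]. *)
Definition saturation_gen (g : tile n.+1 gT) : Prop :=
  exists (j : tile n.+2 gT) k t, [/\ A j,
    g = unshift (U_(ord_max) *+ t)%MM (dehomogenize k j),
    within (fun b => mdeg b = k -> t <= b ord_max) j,
    k <= iter n.+2 (addn N) 0 & t <= N].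

Let divisible (j : tile n.+2 gT) k t : within (fun b => mdeg b = k -> t <= b
  ord_max) j ->
  within (fun a => U_(ord_max) *+ t <= a)%MM (dehomogenize k j).
Proof.
move=> jt a; rewrite dehomogE; case: ifP => [ak ja|]; last by rewrite eqxx.
rewrite unit_mulm_lem; have := jt _ ja.
by rewrite mdeg_mcons subnK // -mbehead_max mconsK; apply.
Qed.

Lemma saturation_gen_sub g : saturation_gen g -> saturation I g.
Proof.
move=> [j [k [t [Aj -> jt _ _]]]]; exists t; rewrite shift_unshift;
  last exact: divisible.
apply: (dehomog_span S_deg k sI gS).
by have [AQ _] := uA; apply: AQ.
Qed.

Lemma saturation_span (J : tile n.+1 gT -> Prop) h : shift_subgroup J ->
  (forall g, saturation_gen g -> J g) -> saturation I h -> J h.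
Proof.
move=> sJ GJ [t It]; have [J1 JM _ Js] := sJ.
set th := shift _ h in It.
have [k0 hk0] := homog_in_span S_deg gS It.
have [k1 hk1] : exists k, forall a, a \in finsupp th -> mdeg a <= k.
  apply: uniform_bound => [k k' a kk' ak|a _]; first exact: leq_trans kk'.
  by exists (mdeg a).
(* The degree must be large both for the homogenization to lie in the span and for it to lose no
   value of [th]. *)
pose k := maxn k0 k1; have Qk := hk0 k (leq_maxl _ _).
have dk : within (fun a => mdeg a <= k) th.
  by move=> a; rewrite -mem_finsupp => /hk1 h1; apply: leq_trans h1 (leq_maxr _ _).
suff [y Jy hy] : exists2 y, J y & th = shift (U_(ord_max) *+ t)%MM y.
  by rewrite (shift_inj hy).
rewrite -(dehomog_homog dk).
have hlt := @revlex_last_order n.+1.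
case: (tile_top hlt (homogenize k th)) => [->|[u qu leu]].
  by exists 1%g; rewrite // dehomog_1 shift_1.
have [uk ut] : mdeg u = k /\ t <= u ord_max.
  move: qu; rewrite homogE; case: (mdeg u =P k) => [uk tu|]; last by rewrite eqxx.
  split=> //; rewrite -mbehead_max.
  by have [a -> _] := shift_supp tu; rewrite mnmDE mulmnE mnm1E eqxx mul1n leq_addl.
have [_ red] := uA.
elim: (red _ hlt _ u Qk leu) => [|x y [[j [c [Aj xE]]] lex] _ [z Jz ez]].
  by exists 1%g; rewrite // dehomog_1 shift_1.
suff [w Jw we] : exists2 w, J w & dehomogenize k x = shift (U_(ord_max) *+ t)%MM w.
  by exists (w * z)%g; [apply: JM | rewrite dehomog_M we ez shift_mul].
rewrite xE dehomog_shift; case: ifP => [ck|_]; last by exists 1%g; rewrite ?shift_1.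
have [->|p1] := eqVneq (dehomogenize (k - mdeg c) j) 1%g.
  by exists 1%g; rewrite ?shift_1.
(* The shift [c] contributes its own power of the last variable; only the remaining power has to
   divide the part of [j] of degree [k - mdeg c]. The order guarantees this, because the top [u] is
   divisible by the power [t]. *)
pose s := t - c ord_max.
have js : within (fun b => mdeg b = k - mdeg c -> s <= b ord_max) j.
  move=> b jb bk; have xb : x (b + c)%MM != 1%g by rewrite xE shift_add.
  have := revlex_last_le (lex _ xb); rewrite mdegD bk subnK // uk mnmDE.
  by move/(_ erefl); rewrite /s; lia.
(* A monomial that actually occurs in this degree is needed to bound the degree and [s] in terms of
   the box. *)
have [b jb bk] : exists2 b, j b != 1%g & mdeg b = k - mdeg c.
  apply: NNPP => nb; case/eqP: p1; apply/fsfunP => a; rewrite tile_1 dehomogE.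
  case: ifP => // ak; apply/eqP; rewrite -[_ == _]negbK; apply/negP => ja.
  by apply: nb; exists (mcons (k - mdeg c - mdeg a) a); rewrite // mdeg_mcons subnK.
pose g := unshift (U_(ord_max) *+ s)%MM (dehomogenize (k - mdeg c) j).
have Jg : J g.
  apply: GJ; exists j, (k - mdeg c), s; split=> //.
    by rewrite -bk; apply: inbox_mdeg; apply: A_box jb.
  by apply: leq_trans (js b jb bk) _; have /inboxP := A_box Aj jb; apply.
rewrite -(shift_unshift (divisible js)) -/g shift_shift.
have le_c : (U_(ord_max) *+ t <= mbehead c + U_(ord_max) *+ s)%MM.
  rewrite unit_mulm_lem mnmDE mulmnE mnm1E eqxx mul1n mbehead_max /s; lia.
exists (shift (mbehead c + U_(ord_max) *+ s - U_(ord_max) *+ t)%MM g);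
  first exact: Js.
by rewrite shift_shift [(U_(ord_max) *+ t + _)%MM]addmC submK.
Qed.

End Saturation.

(** A crude common bound for the degrees of the generators. *)
Definition degree_sum (c : seq (seq (seq nat * nat))) : nat :=
  sumn [seq sumn [seq sumn p.1 | p <- t] | t <- c].

Definition homog_code D (t : seq (seq nat * nat)) : seq (seq nat * nat) :=
  [seq (D - sumn p.1 :: p.1, p.2) | p <- t].

(** Reads the value at [a] after passing to degree [k] and dividing by the power [t] of the last
    variable; the first exponent is the one forced by the degree. *)
Definition strip_value n m N k t (v a : seq nat) : nat :=
  value n.+2 m N v (k - (sumn a + t) :: addv n.+1 a (nseq n 0 ++ [:: t])).

Definition strip_code n m N k t (v : seq nat) : seq (seq nat * nat) :=
  [seq (a, strip_value n m N k t v a) | a <- box n.+1 N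
    & (sumn a + t <= k) && (strip_value n m N k t v a != gid m)].

Definition strippable n m N k t (v : seq nat) : bool :=
  all (fun s => (sumn s == k) ==> (t <= nth 0 s n.+1)) (supp_vec n.+2 m N v).

Definition strip_all n m N (V : seq (seq nat)) : seq (seq (seq nat * nat)) :=
  flatten [seq flatten [seq [seq strip_code n m N k t v
      | v <- V & strippable n m N k t v]
    | t <- iota 0 N.+1] | k <- iota 0 (iter n.+2 (addn N) 0).+1].

Section ComputableStrip.
Context {X : Type} {codeX : code X}.
Variables (n : nat) (m : X -> seq (seq nat)) (N k t : X -> nat).
Hypotheses (hm : computable m) (hN : computable N).
Hypotheses (hk : computable k) (ht : computable t).

Lemma computable_degree_sum c : computable c -> computable (fun x : X =>
  degree_sum (c x)).
Proof. by move=> hc; rewrite /degree_sum; comp. Qed.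

Lemma computable_homog_code D c : computable D -> computable c ->
  computable (fun x : X => homog_code (D x) (c x)).
Proof. by move=> hD hc; rewrite /homog_code; comp. Qed.

Lemma computable_strip_value v a : computable v -> computable a ->
  computable (fun x => strip_value n (m x) (N x) (k x) (t x) (v x) (a x)).
Proof. by move=> hv ha; rewrite /strip_value; comp. Qed.

Lemma computable_strippable v : computable v ->
  computable (fun x => strippable n (m x) (N x) (k x) (t x) (v x)).
Proof. by move=> hv; rewrite /strippable; comp. Qed.

End ComputableStrip.

Ltac comp_strip := first [comp_hat_code | lazymatch goal with
  | |- computable (fun _ => degree_sum _) => simple apply computable_degree_sum
  | |- computable (fun _ => homog_code _ _) => simple apply computable_homog_code
  | |- computable (fun _ => strip_value _ _ _ _ _ _ _) => simple apply
    computable_strip_value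
  | |- computable (fun _ => strippable _ _ _ _ _ _) => simple apply
    computable_strippable
  end].
Ltac comp_defs ::= comp_strip.

Lemma computable_strip_code {X} {_ : code X} n (m : X -> seq (seq nat)) N k t v :
  computable m -> computable N -> computable k -> computable t -> computable v ->
  computable (fun x => strip_code n (m x) (N x) (k x) (t x) (v x)).
Proof. by move=> hm hN hk ht hv; rewrite /strip_code; comp. Qed.

Ltac comp_strip_code := first [comp_strip | lazymatch goal with
  | |- computable (fun _ => strip_code _ _ _ _ _ _) => simple apply
    computable_strip_code
  end].
Ltac comp_defs ::= comp_strip_code.

Lemma computable_strip_all {X} {_ : code X} n (m : X -> seq (seq nat)) N V :
  computable m -> computable N -> computable V ->
  computable (fun x => strip_all n (m x) (N x) (V x)).
Proof. by move=> hm hN hV; rewrite /strip_all; comp. Qed.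

Ltac comp_strip_all := first [comp_strip_code | lazymatch goal with
  | |- computable (fun _ => strip_all _ _ _ _) => simple apply computable_strip_all
  end].
Ltac comp_defs ::= comp_strip_all.

Lemma sumn_exps n (a : 'X_{1..n}) : sumn (exps a) = mdeg a.
Proof. by rewrite sumnE. Qed.

Lemma exps_last_power n t :
  exps (U_(ord_max) *+ t : 'X_{1..n.+1})%MM = nseq n 0 ++ [:: t].
Proof.
apply: (@eq_from_nth _ 0); rewrite size_exps ?size_cat ?size_nseq ?addn1 // => i ni.
rewrite (nth_exps _ (Ordinal ni)) mulmnE mnm1E nth_cat size_nseq nth_nseq.
case: ltnP => ini.
  by rewrite (_ : _ == _ = false) //; apply/eqP => /(congr1 val) /= e;
    rewrite -e ltnn in ini.
have ie : i = n by apply/eqP; rewrite eqn_leq ini -ltnS ni.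
have -> : (ord_max == Ordinal ni) = true by apply/eqP/val_inj.
by rewrite ie subnn mul1n.
Qed.

Section StripCodes.
Variables (n : nat) (gT : finGroupType) (e : seq gT).
Hypothesis he : numbering e.
Notation m := (mul_table e).

Lemma tile_code_inj (f g : tile n gT) c :
  tile_code (elt_code e) f c -> tile_code (elt_code e) g c -> f = g.
Proof.
move=> fc gc; have [N1 fN] := box_bound f; have [N2 gN] := box_bound g.
apply: (tvec_inj he (N := maxn N1 N2)).
- by apply: within_box_le fN; apply: leq_maxl.
- by apply: within_box_le gN; apply: leq_maxr.
by rewrite -(dense_tile_code _ he fc) (dense_tile_code _ he gc).
Qed.

Lemma homog_tile_code D (f : tile n gT) c : within (fun a => mdeg a <= D) f ->
  tile_code (elt_code e) f c ->
  tile_code (elt_code e) (homogenize D f) (homog_code D c).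
Proof.
move=> fD fc; rewrite /tile_code /homog_code.
apply: perm_trans (perm_map _ fc) _; rewrite -map_comp.
have -> : [seq (tval (multinom_val b), elt_code e (homogenize D f b))
    | b <- finsupp (homogenize D f)] = [seq (tval (multinom_val b),
    elt_code e (f (mbehead b))) | b <- finsupp (homogenize D f)].
  apply/eq_in_map => b; rewrite mem_finsupp homogE.
  by case: (mdeg b =P D) => //; rewrite eqxx.
have -> : [seq ((fun p : seq nat * nat => (D - sumn p.1 :: p.1, p.2)) \o
      (fun a : 'X_{1..n} => (tval (multinom_val a),
        elt_code e (f a)))) a | a <- finsupp f]
    = [seq (tval (multinom_val b), elt_code e (f (mbehead b)))
      | b <- [seq mcons (D - mdeg a) a | a <- finsupp f]].
  by rewrite -map_comp; apply: eq_map => a /=; rewrite mconsK -sumn_exps.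
apply: perm_map; apply: uniq_perm.
- rewrite map_inj_in_uniq ?fset_uniq // => a b _ _ ab.
  by rewrite -(mconsK (D - mdeg a) a) ab mconsK.
- exact: fset_uniq.
move=> b; rewrite mem_finsupp homogE; apply/mapP/idP => [[a fa ->]|].
  rewrite mem_finsupp in fa; rewrite mdeg_mcons mconsK subnK ?eqxx //.
  exact: fD.
case: (mdeg b =P D) => [<- fb|]; last by rewrite eqxx.
exists (mbehead b); first by rewrite mem_finsupp.
by rewrite mdeg_mbehead addnK mcons_mbehead.
Qed.

Lemma homog_tiles_code D (S : seq (tile n gT)) c :
  (forall s, s \in S -> within (fun a => mdeg a <= D) s) ->
  tiles_code (elt_code e) S c ->
  tiles_code (elt_code e) [seq homogenize D s | s <- S] [seq homog_code D t | t
    <- c].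
Proof.
rewrite /tiles_code; elim: S c => [|s S IHS] [|t c] //= SD /andP[st Sc].
rewrite homog_tile_code //=; last by apply: SD; rewrite mem_head.
by apply: IHS => // x xS; apply: SD; rewrite inE xS orbT.
Qed.

End StripCodes.

Section StripCodes2.
Variables (n : nat) (gT : finGroupType) (e : seq gT) (N : nat).
Hypothesis he : numbering e.
Notation m := (mul_table e).
Implicit Types (j : tile n.+2 gT).

Let strip k t j : tile n.+1 gT := unshift (U_(ord_max) *+ t)%MM (dehomogenize k j).

Lemma strip_tile_code k t j : within (inbox N) j ->
  tile_code (elt_code e) (strip k t j) (strip_code n m N k t (tvec e N j)).
Proof.
move=> jb; pose val s := strip_value n m N k t (tvec e N j) s.
have stripE a : strip k t j a = if mdeg a + t <= k then
    j (mcons (k - (mdeg a + t)) (a + U_(ord_max) *+ t)%MM) else 1%g.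
  by rewrite /strip unshiftE dehomogE mdegD mdegMn mdeg1 mul1n.
have valE a : val (exps a) =
    elt_code e (j (mcons (k - (mdeg a + t)) (a + U_(ord_max) *+ t)%MM)).
  by rewrite /val /strip_value sumn_exps -exps_last_power addvE -exps_mcons
    value_tvec.
rewrite /tile_code /strip_code.
have -> : [seq (tval (multinom_val a),
  elt_code e (strip k t j a)) | a <- finsupp (strip k t j)]
    = [seq (s, val s) | s <- [seq exps a | a <- finsupp (strip k t j)]].
  rewrite -map_comp; apply/eq_in_map => a; rewrite mem_finsupp /= valE stripE.
  by case: ifP; rewrite // eqxx.
apply: perm_map; apply: uniq_perm.
- by apply: filter_uniq; apply: box_uniq.
- by rewrite map_inj_uniq ?fset_uniq //; apply: exps_inj.
move=> s; rewrite mem_filter -/(val s);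
  apply/idP/mapP => [/andP[/andP[sk hs] /boxP[a sE ab]]|[a]].
  exists a => //; rewrite mem_finsupp stripE; move: sk hs.
  rewrite sE sumn_exps => ->; rewrite valE (gidE he).
  by apply: contra_neq => ->.
rewrite mem_finsupp stripE => ha ->; move: ha; rewrite sumn_exps valE (gidE he).
case: ifP => [ak ja|]; last by rewrite eqxx.
rewrite (inj_eq (elt_code_inj he)) ja mem_box /=.
have := jb _ ja; rewrite inbox_mcons => /andP[_ /inboxP h].
by apply/inboxP => i; have := h i; rewrite mnmDE; lia.
Qed.

Lemma strippableE k t j : within (inbox N) j ->
  strippable n m N k t (tvec e N j) <-> within (fun b => mdeg b = k -> t <= b
    ord_max) j.
Proof.
move=> jb; apply: (iff_trans (all_supp_vec he _ jb)).
split; apply: within_sub => b; rewrite sumn_exps (nth_exps b ord_max).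
  by move=> /implyP h /eqP; apply: h.
by move=> h; apply/implyP => /eqP.
Qed.

End StripCodes2.

(** The program outputs codes, whereas [gens_code] asks for tiles; this picks a tile behind each
    code. *)
Lemma all2_exists (T : eqType) (U : eqType) (r : T -> U -> bool) (P : T ->
  Prop) (c : seq U) :
  (forall x, x \in c -> exists2 t, P t & r t x) ->
  exists S : seq T, [/\ all2 r S c, forall s, s \in S -> P s
    & forall x, x \in c -> exists2 s, s \in S & r s x].
Proof.
elim: c => [|x c IHc] h; first by exists [::].
have [t Pt tx] := h x (mem_head _ _).
have [y yc|S [Sc SP cS]] := IHc; first by apply: h; rewrite inE yc orbT.
exists (t :: S); split=> [|s|y].
- by rewrite /= tx.
- by rewrite inE => /orP[/eqP->|/SP].
rewrite inE => /orP[/eqP->|/cS[s sS sy]]; first by exists t; rewrite ?mem_head.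
by exists s; rewrite // inE sS orbT.
Qed.

Lemma saturation_program n :
  exists P : recfun,
    forall (gT : finGroupType) (e : seq gT) (I : tile n.+1 gT -> Prop)
      (c : seq (seq (seq nat * nat))),
      numbering e -> shift_subgroup I -> gens_code (elt_code e) I c ->
      exists2 c' : seq (seq (seq nat * nat)),
        gens_code (elt_code e) (saturation I) c'
        & eval P [:: encode (mul_table e); encode c] (encode c').
Proof.
have [pk hpk] := pack2_program (A := seq (seq nat)) (B :=
  seq (seq (seq nat * nat))).
pose hc (c : seq (seq (seq nat * nat))) :=
  [seq homog_code (degree_sum c) t | t <- c].
have [||P hP] := search_program pk
  (chk := fun x N => basis_test n.+2 x.1 (hc x.2) N)
  (out := fun x N => strip_all n x.1 N (basis_vecs n.+2 x.1 (hc x.2) N)).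
- by rewrite /hc; comp.
- by rewrite /hc; comp.
exists P => gT e I c he sI [S gS Sc]; pose D := degree_sum c.
have S_deg s : s \in S -> within (fun a => mdeg a <= D) s.
  rewrite /D {D}; elim: S c Sc {gS} => [|s0 S IHS] [|t c] //= /andP[st Sc].
  rewrite inE => /orP[/eqP->|/(IHS c Sc)]; last first.
    by apply: within_sub => a ha; apply: leq_trans ha (leq_addl _ _).
  move=> a sa; apply: leq_trans (leq_addr _ _).
  have : (exps a, elt_code e (s0 a)) \in t by apply/(mem_tile_code _ _ st);
    exists a.
  rewrite -sumn_exps; elim: (t) => //= p t' IHt; rewrite inE => /orP[/eqP<-|/IHt h].
    exact: leq_addr.
  exact: leq_trans h (leq_addl _ _).
pose Q := homog_span S D.
have sQ : shift_subgroup Q.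
  split=> [J []|x y hx hy J sJ SJ|x hx J sJ SJ|b x hx J sJ SJ] //.
  - by have [_ JM _ _] := sJ; apply: JM; [apply: hx | apply: hy].
  - by have [_ _ JV _] := sJ; apply: JV; apply: hx.
  - by have [_ _ _ Js] := sJ; apply: Js; apply: hx.
have hQ : gens_code (elt_code e) Q (hc c).
  by exists [seq homogenize D s | s <- S]; rewrite ?homog_tiles_code.
have [|N bt ev] := hP (mul_table e, c) _ (hpk _ _).
  by have [N _ hN] := basis_test_complete he sQ hQ 0; exists N.
have [A [uA cA]] := basis_test_sound he sQ hQ bt.
have [Ab AV VA] := cA.
set V := basis_vecs n.+2 (mul_table e) (hc c) N in cA AV VA.
exists (strip_all n (mul_table e) N V); last first.
  rewrite (encode_seq (encode_seq (encode_prod (encode_seq encode_nat)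
    encode_nat))).
  rewrite (encode_seq (encode_seq (encode_prod (encode_seq encode_nat)
    encode_nat))).
  by rewrite (encode_seq (encode_seq encode_nat)).
have [|B [Bc BG cB]] :=
  @all2_exists _ _ (tile_code (elt_code e)) (saturation_gen N A)
    (strip_all n (mul_table e) N V).
  move=> x /flatten_mapP[k kK /flatten_mapP[t tN /mapP[v]]].
  rewrite mem_filter => /andP[sv /VA[j Aj vE]] ->; move: sv; rewrite vE.
  move/(strippableE he _ _ (Ab j Aj)) => jt.
  exists (unshift (U_(ord_max) *+ t)%MM (dehomogenize k j)); last first.
    exact: strip_tile_code he _ _ _ (Ab j Aj).
  by exists j, k, t; move: kK tN; rewrite !mem_iota !ltnS.
exists B => // h; have satS := saturation_shift_subgroup sI.
split=> [|hI J sJ BJ].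
  by apply=> // s /BG; exact: (saturation_gen_sub S_deg sI gS uA).
apply: (saturation_span S_deg gS uA Ab sJ _ hI) => g gG; apply: BJ.
have [j [k [t [Aj gE jt kK tN]]]] := gG.
have jc := strip_tile_code he k t (Ab j Aj); rewrite -gE in jc.
have [|s sB sc] := cB (strip_code n (mul_table e) N k t (tvec e N j)).
  apply/flatten_mapP; exists k; first by rewrite mem_iota ltnS.
  apply/flatten_mapP; exists t; first by rewrite mem_iota ltnS.
  apply/mapP; exists (tvec e N j) => //.
  by rewrite mem_filter AV // andbT; apply/(strippableE he _ _ (Ab j Aj)).
by rewrite (tile_code_inj he jc sc).
Qed.

Theorem theorem1p1 (n : nat) (lt : rel 'X_{1..n.+1})
    (hlt : monomial_order lt) :
  (exists P : recfun,
    forall (gT : finGroupType) (e : seq gT) (I : tile n.+1 gT -> Prop)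
      (c : seq (seq (seq nat * nat))),
      numbering e -> shift_subgroup I -> gens_code (elt_code e) I c ->
      exists (B : seq (tile n.+1 gT)) (b : seq (seq (seq nat * nat))),
        [/\ standard_basis lt I B,
            tiles_code (elt_code e) B b
          & eval P [:: encode (mul_table e); encode c] (encode b)])
  /\
  (exists P : recfun,
    forall (gT : finGroupType) (e : seq gT) (I : tile n.+1 gT -> Prop)
      (c : seq (seq (seq nat * nat)))
      (f : tile n.+1 gT) (cf : seq (seq nat * nat)),
      numbering e -> shift_subgroup I -> gens_code (elt_code e) I c ->
      tile_code (elt_code e) f cf ->
      exists2 r : bool,
        eval P [:: encode (mul_table e); encode c; encode cf] (nat_of_bool r)
        & (r <-> I f))
  /\
  (exists P : recfun,
    forall (gT : finGroupType) (e : seq gT) (I : tile n.+1 gT -> Prop)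
      (c : seq (seq (seq nat * nat))),
      numbering e -> shift_subgroup I -> gens_code (elt_code e) I c ->
      exists2 c' : seq (seq (seq nat * nat)),
        gens_code (elt_code e) (saturation I) c'
        & eval P [:: encode (mul_table e); encode c] (encode c'))
  /\
  (exists P : recfun,
    forall (gT : finGroupType) (e : seq gT) (I : tile n.+1 gT -> Prop)
      (c : seq (seq (seq nat * nat))) (d : nat),
      numbering e -> shift_subgroup I -> gens_code (elt_code e) I c ->
      0 < d ->
      exists2 c' : seq (seq (seq nat * seq nat)),
        gens_code (vec_code e) (elimination d I) c'
        & eval P [:: encode (mul_table e); encode c; d] (encode c')).
Proof.
split; first exact: standard_basis_program.
split; first exact: membership_program.
by split; [exact: saturation_program | exact: elimination_program].
Qed.
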